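(* Let $M$ be a pseudo-Riemannian manifold, let $Z$ be a metrically proper submanifold of $M$, and let $D$ be a differential operator on $M$ of Laplacian type. Then $$C^{-\infty}(M;Z;D)=0.$$
   Context: All manifolds and maps are smooth; submanifolds are locally closed. For a smooth manifold $M$, $D_0^\infty(M)$ denotes the space of compactly supported smooth (complex) densities on $M$ with the inductive smooth topology, and $C^{-\infty}(M)$ (the space of generalized functions on $M$) is its strong dual. Smooth functions are embedded in $C^{-\infty}(M)$ through the integration pairing of functions and densities. Every differential operator $D:C^\infty(M)\to C^\infty(M)$ extends continuously to $D:C^{-\infty}(M)\to C^{-\infty}(M)$. For a locally closed subset $Z$ of $M$, put $C^{-\infty}(M;Z)=\{f\in C^{-\infty}(U)\mid \mathrm{supp}(f)\subseteq Z\}$, where $U$ is any open subset of $M$ containing $Z$ as a closed subset (the definition is independent of $U$). For a differential operator $D$ on $M$, put $C^{-\infty}(M;Z;D)=\{f\in C^{-\infty}(M;Z)\mid Df=0\}$. $\mathrm{DO}(M)_k$ is the space of differential operators on $M$ of order at most $k$. The principal symbol map $\sigma_k$ from $\mathrm{DO}(M)_k$ to the smooth sections of $\mathrm{S}^k(\mathrm{T}(M)\otimes_{\mathbb R}\mathbb C)$ (where $\mathrm{T}(M)$ is the real tangent bundle and $\mathrm{S}^k$ is the $k$-th symmetric power) is specified by $\sigma_k(X_1X_2\cdots X_k)(x)=X_1(x)X_2(x)\cdots X_k(x)$ for all $x \in M$ and all smooth real vector fields $X_1,\dots,X_k$ on $M$, and $\sigma_k|_{\mathrm{DO}(M)_{k-1}}=0$.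 $M$ is pseudo-Riemannian: its tangent spaces are equipped with a smoothly varying family $\{\langle\,,\,\rangle_x : x\in M\}$ of nondegenerate symmetric bilinear forms. A submanifold $Z$ of $M$ is metrically proper if for all $z\in Z$ the tangent space $\mathrm{T}_z(Z)$ is contained in a proper nondegenerate subspace of $\mathrm{T}_z(M)$. A differential operator $D\in\mathrm{DO}(M)_2$ is of Laplacian type if for all $x\in M$ one has $\sigma_2(D)(x)=u_1v_1+u_2v_2+\cdots+u_mv_m$, where $u_1,\dots,u_m$ is a basis of $\mathrm{T}_x(M)$ and $v_1,\dots,v_m$ is the dual basis in $\mathrm{T}_x(M)$ with respect to $\langle\,,\,\rangle_x$. *)

(* Defs.v *)
From HB Require Import structures.
From mathcomp Require Import all_boot all_order all_algebra.
From mathcomp Require Import all_classical all_reals all_analysis.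
From mathcomp Require Import complex.

Set Implicit Arguments.
Unset Strict Implicit.
Unset Printing Implicit Defensive.

Import Order.TTheory GRing.Theory Num.Theory.
Import numFieldNormedType.Exports.

Local Open Scope classical_set_scope.
Local Open Scope ring_scope.
Local Open Scope complex_scope.

Definition partial (R : realType) (m : nat) (i : 'I_m) (f : 'rV[R]_m -> R) :
  'rV[R]_m -> R := fun y => 'D_(delta_mx 0 i) f y.

Definition partials (R : realType) (m : nat) (s : seq 'I_m)
  (f : 'rV[R]_m -> R) : 'rV[R]_m -> R := foldr (@partial R m) f s.

Definition partialsC (R : realType) (m : nat) (s : seq 'I_m)
  (f : 'rV[R]_m -> R[i]) : 'rV[R]_m -> R[i] :=
  fun y => partials s (fun t => complex.Re (f t)) y
           +i* partials s (fun t => complex.Im (f t)) y.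

Definition smooth_on (R : realType) (m : nat) (V : set 'rV[R]_m)
  (f : 'rV[R]_m -> R) : Prop :=
  forall (s : seq 'I_m) y, V y ->
    {for y, continuous (partials s f)} /\
    forall i : 'I_m, derivable (partials s f) y (delta_mx 0 i).

Definition smoothC_on (R : realType) (m : nat) (V : set 'rV[R]_m)
  (f : 'rV[R]_m -> R[i]) : Prop :=
  smooth_on V (fun y => complex.Re (f y)) /\
  smooth_on V (fun y => complex.Im (f y)).

(* The integral on R^n as an iterated Lebesgue integral; it is only used for
   continuous functions with compact support. *)
Fixpoint iterated_integral (R : realType) (n : nat) :
    ('rV[R]_n -> R) -> R :=
  match n with
  | 0 => fun h => h 0
  | k.+1 => fun h => Rintegral (@lebesgue_measure R) setT
      (fun t : R => @iterated_integral R k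
         (fun y => h (@row_mx R 1 1 k (const_mx t) y)))
  end.

(* The functions of a chart are total, but only their values on
   [cdom], respectively on its image, are relevant. *)
Record chart (R : realType) (m : nat) (T : topologicalType) := Chart {
  cdom : set T;
  cmap :> T -> 'rV[R]_m;
  cinv : 'rV[R]_m -> T;
  cdom_open : open cdom;
  cimage_open : open (cmap @` cdom);
  cmapK : forall x, cdom x -> cinv (cmap x) = x;
  cmap_continuous : forall x, cdom x -> {for x, continuous cmap};
  cinv_continuous : forall y, (cmap @` cdom) y -> {for y, continuous cinv} }.

Definition smooth_transition (R : realType) (m : nat) (T : topologicalType)
  (c c' : chart R m T) : Prop :=
  forall j : 'I_m,
    smooth_on (c @` (cdom c `&` cdom c')) (fun y => c' (cinv c y) 0 j).

Definition compatible (R : realType) (m : nat) (T : topologicalType)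
  (c c' : chart R m T) : Prop :=
  smooth_transition c c' /\ smooth_transition c' c.

(* A smooth structure is a maximal atlas; [chart_at] provides the covering. *)
Record manifold (R : realType) (m : nat) := Manifold {
  carrier :> topologicalType;
  carrier_hausdorff : hausdorff_space carrier;
  carrier_second_countable : @second_countable carrier;
  atlas : set (chart R m carrier);
  chart_at : carrier -> chart R m carrier;
  chart_atP : forall x, atlas (chart_at x) /\ cdom (chart_at x) x;
  atlas_compatible : forall c c', atlas c -> atlas c' -> compatible c c';
  atlas_maximal : forall c,
    (forall c', atlas c' -> compatible c c') -> atlas c }.

Definition smooth_fun (R : realType) (m : nat) (M : manifold R m) (W : set M)
  (g : M -> R[i]) : Prop :=
  forall c : chart R m M, atlas c ->
    smoothC_on (c @` (cdom c `&` W)) (g \o cinv c).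

(* Tangent vectors at [x] are row vectors of components in a chart around [x];
   components [v] in [c] become [v *m jac c c' x] in [c']. *)
Definition jac (R : realType) (m : nat) (M : manifold R m)
  (c c' : chart R m M) (x : M) : 'M[R]_m :=
  \matrix_(i, j) partial i (fun y => c' (cinv c y) 0 j) (c x).

Record pseudo_riemannian (R : realType) (m : nat) (M : manifold R m) :=
  PseudoRiemannian {
  gram :> chart R m M -> M -> 'M[R]_m;
  gram_smooth : forall c, atlas c -> forall i j,
    smooth_on (c @` cdom c) (fun y => gram c (cinv c y) i j);
  gram_transition : forall c c' x, atlas c -> atlas c' ->
    cdom c x -> cdom c' x ->
    gram c x = jac c c' x *m gram c' x *m (jac c c' x)^T;
  gram_symmetric : forall c x, atlas c -> cdom c x ->
    (gram c x)^T = gram c x;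
  gram_nondegenerate : forall c x, atlas c -> cdom c x ->
    gram c x \in unitmx }.

Definition slice_chart (R : realType) (m : nat) (M : manifold R m)
  (Z : set M) (k : nat) (c : chart R m M) : Prop :=
  [/\ atlas c, (k <= m)%N &
      c @` (cdom c `&` Z) =
      (c @` cdom c) `&` [set y | forall i : 'I_m, (k <= i)%N -> y 0 i = 0]].

Definition submanifold (R : realType) (m : nat) (M : manifold R m)
  (Z : set M) : Prop :=
  forall z, Z z -> exists k c, slice_chart Z k c /\ cdom c z.

(* Subspaces of R^m are row spaces of square matrices. In a slice chart, the
   tangent space of [Z] is the span of the first [k] coordinate vectors, i.e.
   the row space of [pid_mx k]. *)
Definition nondegenerate_subspace (R : realType) (m : nat)
  (G W : 'M[R]_m) : Prop :=
  forall w : 'rV[R]_m, (w <= W)%MS ->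
    (forall w' : 'rV[R]_m, (w' <= W)%MS -> w *m G *m w'^T = 0) -> w = 0.

Definition metrically_proper (R : realType) (m : nat) (M : manifold R m)
  (g : pseudo_riemannian M) (Z : set M) : Prop :=
  forall z k c, Z z -> slice_chart Z k c -> cdom c z ->
    exists W : 'M[R]_m,
      [/\ ((pid_mx k : 'M[R]_m) <= W)%MS, (\rank W < m)%N &
          nondegenerate_subspace (g c z) W].

(* An operator on smooth functions is a total map; its values on other
   functions are irrelevant. *)
Definition operator (R : realType) (m : nat) (M : manifold R m) :=
  (M -> R[i]) -> (M -> R[i]).

Definition diff_op (R : realType) (m : nat) (M : manifold R m) (k : nat)
  (D : operator M) : Prop :=
  forall c : chart R m M, atlas c ->
  exists a : seq 'I_m -> M -> R[i],
    (forall s, smooth_fun (cdom c) (a s)) /\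
    forall u, smooth_fun setT u -> forall x, cdom c x ->
      D u x = \sum_(j < k.+1) \sum_(s : j.-tuple 'I_m)
                a s x * partialsC s (u \o cinv c) (c x).

Definition is_vector_field (R : realType) (m : nat) (M : manifold R m)
  (X : chart R m M -> M -> 'rV[R]_m) : Prop :=
  (forall c, atlas c -> forall i,
     smooth_on (c @` cdom c) (fun y => X c (cinv c y) 0 i)) /\
  (forall c c' x, atlas c -> atlas c' -> cdom c x -> cdom c' x ->
     X c' x = X c x *m jac c c' x).

Definition vector_field_op (R : realType) (m : nat) (M : manifold R m)
  (X : chart R m M -> M -> 'rV[R]_m) : operator M :=
  fun u x => let c := chart_at x in
    \sum_(i < m) (X c x 0 i)%:C * partialsC [:: i] (u \o cinv c) (c x).

(* The product of two real tangent vectors in S^2(T_x M (x) C), which is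
   realized as the space of symmetric matrices via u v |-> u (x) v + v (x) u. *)
Definition symprod (R : realType) (m : nat) (u v : 'rV[R]_m) : 'M[R[i]]_m :=
  map_mx (fun t : R => t%:C) (u^T *m v + v^T *m u).

(* [S] is the second symbol of [D]: it is the C-linear map that sends X Y to
   the section X(x) Y(x) and kills operators of order at most 1. The products
   X Y of real vector fields span, over C, the operators of order at most 2
   modulo those of order at most 1. *)
Definition principal_symbol2 (R : realType) (m : nat) (M : manifold R m)
  (D : operator M) (S : chart R m M -> M -> 'M[R[i]]_m) : Prop :=
  exists (n : nat) (a : 'I_n -> R[i])
    (X Y : 'I_n -> chart R m M -> M -> 'rV[R]_m) (D1 : operator M),
    [/\ forall j, is_vector_field (X j) /\ is_vector_field (Y j),
        diff_op 1 D1,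
        forall u, smooth_fun setT u -> forall x,
          D u x = \sum_(j < n)
             a j * vector_field_op (X j) (vector_field_op (Y j) u) x + D1 u x &
        forall c x, atlas c -> cdom c x ->
          S c x = \sum_(j < n) a j *: symprod (X j c x) (Y j c x)].

Definition laplacian_type (R : realType) (m : nat) (M : manifold R m)
  (g : pseudo_riemannian M) (D : operator M) : Prop :=
  diff_op 2 D /\
  exists S, principal_symbol2 D S /\
    forall c x, atlas c -> cdom c x ->
      exists u v : 'M[R]_m,
        [/\ u \in unitmx, u *m g c x *m v^T = 1%:M &
            S c x = \sum_(i < m) symprod (row i u) (row i v)].

(* [r c] is the coefficient of the density with respect to the
   Lebesgue measure |dx| of the chart [c]. *)
Definition density (R : realType) (m : nat) (M : manifold R m) :=
  chart R m M -> M -> R[i].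

Definition smooth_density (R : realType) (m : nat) (M : manifold R m)
  (r : density M) : Prop :=
  (forall c, atlas c -> smoothC_on (c @` cdom c) (r c \o cinv c)) /\
  (forall c c' x, atlas c -> atlas c' -> cdom c x -> cdom c' x ->
     r c x = `|\det (jac c c' x)|%:C * r c' x).

(* D_K: the smooth densities supported in [K]. *)
Definition supported_density (R : realType) (m : nat) (M : manifold R m)
  (K : set M) (r : density M) : Prop :=
  smooth_density r /\
  forall c x, atlas c -> cdom c x -> ~ K x -> r c x = 0.

(* D_0^oo(U), its elements being extended by zero outside the open set [U]. *)
Definition test_density (R : realType) (m : nat) (M : manifold R m)
  (U : set M) (r : density M) : Prop :=
  exists K, [/\ compact K, K `<=` U & supported_density K r].

Definition density_lin (R : realType) (m : nat) (M : manifold R m)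
  (a : R[i]) (r r' : density M) : density M :=
  fun c x => a * r c x + r' c x.

Definition density_scale (R : realType) (m : nat) (M : manifold R m)
  (u : M -> R[i]) (r : density M) : density M := fun c x => u x * r c x.

Definition chart_integral (R : realType) (m : nat) (M : manifold R m)
  (c : chart R m M) (r : density M) : R[i] :=
  let h y := if y \in c @` cdom c then r c (cinv c y) else 0 in
  iterated_integral (fun y => complex.Re (h y))
  +i* iterated_integral (fun y => complex.Im (h y)).

(* The integral of the test density [r] over [U] is [I]: cut [r] into pieces
   with compact support in a chart and add up the integrals of the pieces. By
   the change of variables formula, [I] does not depend on the pieces. *)
Definition density_integral (R : realType) (m : nat) (M : manifold R m)
  (U : set M) (r : density M) (I : R[i]) : Prop :=
  exists (n : nat) (c : 'I_n -> chart R m M) (p : 'I_n -> density M),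
    [/\ forall j, atlas (c j) /\ test_density (U `&` cdom (c j)) (p j),
        forall c' x, atlas c' -> cdom c' x ->
          r c' x = \sum_(j < n) p j c' x &
        I = \sum_(j < n) chart_integral (c j) (p j)].

(* The continuous seminorms of the inductive limit topology on D_0^oo(U) are
   the seminorms whose restriction to every Frechet space D_K is continuous,
   i.e. is dominated by finitely many suprema of the form
   sup_(x in L) |partials s r(x)|, with L compact in the domain of a chart. *)
Definition continuous_seminorm (R : realType) (m : nat) (M : manifold R m)
  (U : set M) (q : density M -> R) : Prop :=
  [/\ forall r r', test_density U r -> test_density U r' ->
        q (density_lin 1 r r') <= q r + q r',
      forall a r, test_density U r ->
        q (density_scale (fun=> a) r) = ComplexField.Normc.normc a * q r &
      forall K, compact K -> K `<=` U ->
      exists (B : R) (n : nat) (c : 'I_n -> chart R m M) (L : 'I_n -> set M)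
        (s : 'I_n -> seq 'I_m),
        (forall j, [/\ atlas (c j), compact (L j) & L j `<=` cdom (c j)]) /\
        forall (r : density M) (t : R), supported_density K r -> 0 <= t ->
          (forall j x, L j x ->
             ComplexField.Normc.normc
               (partialsC (s j) (r (c j) \o cinv (c j)) (c j x)) <= t) ->
          q r <= B * t].

Definition bounded_densities (R : realType) (m : nat) (M : manifold R m)
  (U : set M) (B : set (density M)) : Prop :=
  B `<=` test_density U /\
  forall q, continuous_seminorm U q -> exists b : R, forall r, B r -> q r <= b.

(* C^{-oo}(U). Only the values on test densities are relevant. *)
Record gen_fun (R : realType) (m : nat) (M : manifold R m) (U : set M) :=
  GenFun {
  gf_app :> density M -> R[i];
  gf_linear : forall a r r', test_density U r -> test_density U r' ->
    gf_app (density_lin a r r') = a * gf_app r + gf_app r';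
  gf_continuous :
    continuous_seminorm U (fun r => ComplexField.Normc.normc (gf_app r)) }.

Definition gf_eq (R : realType) (m : nat) (M : manifold R m) (U : set M)
  (f h : gen_fun U) : Prop := forall r, test_density U r -> f r = h r.

Definition gf_is0 (R : realType) (m : nat) (M : manifold R m) (U : set M)
  (f : gen_fun U) : Prop := forall r, test_density U r -> f r = 0.

Definition gf_support (R : realType) (m : nat) (M : manifold R m) (U : set M)
  (f : gen_fun U) : set M :=
  [set x | U x /\ forall V, open V -> V `<=` U -> V x ->
             exists r, test_density V r /\ f r <> 0].

(* [f] is the image in C^{-oo}(U) of the smooth function [u] on [U]. *)
Definition gf_embeds (R : realType) (m : nat) (M : manifold R m) (U : set M)
  (u : M -> R[i]) (f : gen_fun U) : Prop :=
  forall r, test_density U r -> density_integral U (density_scale u r) (f r).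

(* [v] = D|_U [u] on the open set [U]: as D is local, D|_U [u] is computed at
   [x] by means of global smooth functions that agree with [u] near [x]. *)
Definition restricted_image (R : realType) (m : nat) (M : manifold R m)
  (D : operator M) (U : set M) (u v : M -> R[i]) : Prop :=
  forall x, U x -> forall w, smooth_fun setT w ->
    (\forall y \near x, w y = u y) -> v x = D w x.

Definition gf_map_linear (R : realType) (m : nat) (M : manifold R m)
  (U : set M) (T : gen_fun U -> gen_fun U) : Prop :=
  forall (a : R[i]) (f f' h : gen_fun U),
    (forall r, test_density U r -> h r = a * f r + f' r) ->
    forall r, test_density U r -> T h r = a * T f r + T f' r.

(* Continuity of a linear map for the strong dual topology, which is defined by
   the seminorms sup_(r in B) |f r| with B bounded in D_0^oo(U); these form a
   directed family. *)
Definition strongly_continuous (R : realType) (m : nat) (M : manifold R m)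
  (U : set M) (T : gen_fun U -> gen_fun U) : Prop :=
  forall B, bounded_densities U B ->
  exists B' (b : R), bounded_densities U B' /\
    forall (f : gen_fun U) (t : R), 0 <= t ->
      (forall r, B' r -> ComplexField.Normc.normc (f r) <= t) ->
      forall r, B r -> ComplexField.Normc.normc (T f r) <= b * t.

Definition continuous_extension (R : realType) (m : nat) (M : manifold R m)
  (D : operator M) (U : set M) (T : gen_fun U -> gen_fun U) : Prop :=
  [/\ gf_map_linear T, strongly_continuous T &
      forall u v (f h : gen_fun U), smooth_fun U u ->
        restricted_image D U u v ->
        gf_embeds u f -> gf_embeds v h -> gf_eq (T f) h].

Definition closed_in_open (T : topologicalType) (Z U : set T) : Prop :=
  [/\ open U, Z `<=` U & closure Z `&` U `<=` Z].

(* C^{-oo}(M; Z; D) as a subset of C^{-oo}(U), where [Z] is closed in [U].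
   The continuous extension of D|_U exists and is unique up to [gf_eq]. *)
Definition gen_solutions (R : realType) (m : nat) (M : manifold R m)
  (U Z : set M) (D : operator M) : set (gen_fun U) :=
  [set f | gf_support f `<=` Z /\
           exists T, continuous_extension D T /\ gf_is0 (T f)].

(* Main.v *)
(* Let [f] be supported in [Z] with [D f = 0]. By partitions of unity, it is enough to show that
   [f] vanishes near every point [z] of [Z]. Since [Z] is metrically proper, some non-isotropic
   vector [w] is orthogonal to [T_z Z], so the covector [xi = <w, .>] kills [T_z Z] and the symbol
   of [D] at [xi] is [<w, w> != 0]. In a slice chart, [f] is supported in the zero set of the linear
   form [l] given by [xi]; as [f] has finite order locally, it kills [l ^ n psi] for [n] large.
   The transposed equation [f (D^t (l ^ (k + 2) phi)) = 0] then shows by descending induction that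
   [f] kills [l ^ k psi] for all [k].
   The transposed equation [f (D^t r) = 0] holds because [f] can be approximated by smooth
   functions uniformly on bounded sets of densities, where it reduces to integration by parts. *)

Require Import Defs.
From HB Require Import structures.
From mathcomp Require Import all_boot all_order all_algebra.
From mathcomp Require Import all_classical all_reals all_analysis.
From mathcomp Require Import complex ring lra zify.

Set Implicit Arguments.
Unset Strict Implicit.
Unset Printing Implicit Defensive.

Import Order.TTheory GRing.Theory Num.Theory.
Import numFieldNormedType.Exports.

Local Open Scope classical_set_scope.
Local Open Scope ring_scope.
Local Open Scope complex_scope.

(** * Differentiable functions of several variables *)

(** [D] acts on generalized functions only through an extension [T] that is continuous and known on
    smooth functions, so [f (D^t r) = 0] has to be reached by approximation. Locally, [h] is
    replaced, up to finitely many derivatives, by a finite combination of translates of a mollifier,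
    weighted by the integrals of [h] against a partition of unity. Linearity then turns the value of
    a distribution at [h] into the pairing of [h] with a smooth function that does not depend on
    [h], uniformly on a bounded family. For a bounded set of densities this requires that all its
    members be supported in one compact set. Globally the approximant is kept as a sum of pieces,
    each in one chart, and pieces meeting the support of the test density are put in the chart in
    which [D^t] is written. In the descent, two derivatives falling on [l ^ (k + 2)] give
    [(k + 2) (k + 1) l ^ k] times the symbol at [xi]; every other term keeps a factor [l ^ (k + 1)].
    The symbol itself is read off from [D] at [z] on a smooth function equal to [l ^ 2] near [z],
    which operators of order at most 1 send to 0 at [z]. *)

Lemma derivable_line (R : realType) m (f : 'rV[R]_m -> R) x v (t : R) :
  derivable (fun s : R => f (x + s *: v)) t 1 <-> derivable f (x + t *: v) v.
Proof.
rewrite /derivable; set g1 := fun h => h^-1 *: _; set g2 := fun h => h^-1 *: _.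
suff -> : g1 = g2 by [].
rewrite funeqE /g1 /g2 => h /=; congr (_ *: (f _ - _)).
by rewrite scalerDl addrCA -scalerA scale1r.
Qed.

Lemma derive_line (R : realType) m (f : 'rV[R]_m -> R) x v (t : R) :
  'D_1 (fun s : R => f (x + s *: v)) t = 'D_v f (x + t *: v).
Proof.
rewrite /derive; set g1 := fun h => h^-1 *: _; set g2 := fun h => h^-1 *: _.
suff -> : g1 = g2 by [].
rewrite funeqE /g1 /g2 => h /=; congr (_ *: (f _ - _)).
by rewrite scalerDl addrCA -scalerA scale1r.
Qed.

Lemma derivable_line0 (R : realType) m (f : 'rV[R]_m -> R) x v :
  derivable (fun s : R => f (x + s *: v)) 0 1 <-> derivable f x v.
Proof.
have := derivable_line f x v 0; have -> : x + 0 *: v = x by rewrite scale0r addr0.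
exact.
Qed.

Lemma derive_line0 (R : realType) m (f : 'rV[R]_m -> R) x v :
  'D_1 (fun s : R => f (x + s *: v)) 0 = 'D_v f x.
Proof.
have := derive_line f x v 0; have -> // : x + 0 *: v = x by rewrite scale0r addr0.
Qed.

Lemma mean_value_line (R : realType) m (f : 'rV[R]_m -> R) x v (a : R) :
  (forall s, `|s| <= `|a| -> derivable f (x + s *: v) v) ->
  exists2 s, `|s| <= `|a| & f (x + a *: v) - f x = a * 'D_v f (x + s *: v).
Proof.
move=> df; pose g s := f (x + s *: v).
have dg s : `|s| <= `|a| -> derivable g s 1 by move=> /df; apply: (derivable_line f x v s).2.
have g0 : f x = g 0 by rewrite /g scale0r addr0.
rewrite g0 -/(g a).
have cont (b c : R) : (forall s, s \in `[b, c]%R -> `|s| <= `|a|) ->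
    {within `[b, c], continuous g}.
  move=> bc; apply: derivable_within_continuous => s /bc; exact: dg.
have [a0|a0] := leP 0 a.
  have h s : s \in `[0, a]%R -> `|s| <= `|a|.
    by rewrite in_itv/= => /andP[s0 sa]; rewrite !ger0_norm.
  have [] := @MVT_segment R g ('D_1 g) 0 a a0; last 1 first.
  - move=> c ca ->; exists c; first exact: h.
    by rewrite /g derive_line subr0 mulrC.
  - move=> s sa; apply: derivableP; apply: dg; apply: h.
    by move: sa; rewrite !in_itv/= => /andP[/ltW -> /ltW ->].
  - exact: cont.
have h s : s \in `[a, 0]%R -> `|s| <= `|a|.
  by rewrite in_itv/= => /andP[s0 sa]; rewrite !ler0_norm ?lerN2// ltW.
have [] := @MVT_segment R g ('D_1 g) a 0 (ltW a0); last 1 first.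
- move=> c ca e; exists c; first exact: h.
  rewrite -opprB e /g derive_line sub0r; ring.
- move=> s sa; apply: derivableP; apply: dg; apply: h.
  by move: sa; rewrite !in_itv/= => /andP[/ltW -> /ltW ->].
- exact: cont.
Qed.

Lemma rV_norm_le (R : realType) m (x : 'rV[R]_m) (a : R) :
  0 <= a -> (forall i, `|x 0 i| <= a) -> `|x| <= a.
Proof.
move=> a0 h; rewrite /Num.Def.normr/= mx_normrE bigmax_le// => -[i j] _ /=.
by rewrite ord1.
Qed.

Lemma rV_coord_le (R : realType) m (x : 'rV[R]_m) i : `|x 0 i| <= `|x|.
Proof.
rewrite [leRHS]/Num.Def.normr/= mx_normrE.
exact: (le_bigmax _ (fun p => `|x p.1 p.2|) (0, i)).
Qed.

(* Go from [y] to [y + h] along the edges of a box and use the one-dimensional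
   mean value theorem on each edge. *)
Lemma mean_value (R : realType) m (f : 'rV[R]_m -> R) (y h : 'rV[R]_m) :
  (forall z, `|z - y| <= `|h| -> forall i, derivable f z (delta_mx 0 i)) ->
  exists xi : 'I_m -> 'rV[R]_m, (forall i, `|xi i - y| <= `|h|) /\
    f (y + h) - f y = \sum_i h 0 i * partial i f (xi i).
Proof.
move=> df.
pose P k : 'rV[R]_m := \row_j (if (j < k)%N then (y + h) 0 j else y 0 j).
have PS (i : 'I_m) : P i.+1 = P i + h 0 i *: delta_mx 0 i.
  apply/rowP => j; rewrite !mxE ltnS eqxx/=.
  have [->|ji] := eqVneq j i; first by rewrite leqnn ltnn mulr1.
  by rewrite mulr0 addr0 leq_eqVlt (inj_eq val_inj) (negbTE ji).
have Py (i : 'I_m) s : `|s| <= `|h 0 i| ->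
    `|P i + s *: delta_mx 0 i - y| <= `|h|.
  move=> sh; apply: rV_norm_le => // j; rewrite !mxE eqxx/=.
  have [->|ji] := eqVneq j i.
    by rewrite ltnn mulr1 addrC addKr (le_trans sh)// rV_coord_le.
  case: ifP => _; rewrite mulr0 addr0.
    by rewrite addrAC subrr add0r rV_coord_le.
  by rewrite subrr normr0.
have H (i : 'I_m) : exists s, `|s| <= `|h 0 i| /\ f (P i.+1) - f (P i) =
    h 0 i * partial i f (P i + s *: delta_mx 0 i).
  rewrite PS; have [|s sh e] := @mean_value_line R m f (P i) (delta_mx 0 i) (h 0 i).
    by move=> s sh; apply: df; apply: Py.
  by exists s.
have [s sP] := choice H.
exists (fun i : 'I_m => P i + s i *: delta_mx 0 i); split.
  by move=> i; apply: Py; have [] := sP i.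
have P0 : P 0%N = y by apply/rowP => j; rewrite mxE.
have Pm : P m = y + h by apply/rowP => j; rewrite mxE ltn_ord.
have -> : f (y + h) - f y = \sum_(0 <= k < m) (f (P k.+1) - f (P k)).
  by rewrite (telescope_sumr (f \o P))//= P0 Pm.
rewrite big_mkord; by apply: eq_bigr => i _; have [_ ->] := sP i.
Qed.

Lemma differentiable_from_linear (R : realType) (V W : normedModType R) (f : V -> W)
    (L : {linear V -> W}) y : continuous L ->
  (forall e : R, 0 < e -> \forall h \near 0, `|f (h + y) - (f y + L h)| <= e * `|h|) ->
  differentiable f y.
Proof.
move=> Lc fL.
have fE : f \o shift y = cst (f y) + L +o_ 0 id.
  by apply/eqaddoP => _/posnumP[e]; apply: fL.
have dL : 'd f y = L :> (_ -> _) by apply: diff_unique.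
by apply/diff_locallyP; rewrite dL.
Qed.

(** By [mean_value], the error of the linear approximation is a sum of terms
    [h_i * (d_i f (xi_i) - d_i f y)] with [xi_i] no farther from [y] than [|h|], and continuity of
    the partial derivatives at [y] makes the brackets small. *)
Lemma partial_differentiable (R : realType) m (f : 'rV[R]_m -> R) (V : set 'rV[R]_m) y :
  open V -> V y -> (forall z i, V z -> derivable f z (delta_mx 0 i)) ->
  (forall i, {for y, continuous (partial i f)}) -> differentiable f y.
Proof.
move=> oV Vy df cf.
pose L0 h := \sum_i (h : 'rV[R]_m) 0 i * partial i f y : R.
have L0lin : linear L0.
  move=> a u v; rewrite /L0 scaler_sumr -big_split/=; apply: eq_bigr => i _.
  by rewrite !mxE mulrDl -mulrA.
pose L0m := GRing.isLinear.Build _ _ _ _ L0 L0lin.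
pose L : {linear 'rV[R]_m -> R} := HB.pack L0 L0m.
have LE h : L h = \sum_i h 0 i * partial i f y by [].
have Lc : continuous L.
  rewrite (_ : (L : _ -> _) = \sum_i (fun h : 'rV[R]_m => h 0 i * partial i f y)); last first.
    by apply/funext => h; rewrite LE fct_sumE.
  move=> x; apply: (@differentiable_continuous _ _ _ x).
  apply: differentiable_sum => i; apply: differentiableM; last exact: differentiable_cst.
  exact: differentiable_coord.
apply: (@differentiable_from_linear R _ (R^o : normedModType R) f L y Lc) => e e0.
(* The divisor is [m.+1] because [m] may be 0. *)
have e1 : 0 < e / m.+1%:R by rewrite divr_gt0.
have : \forall z \near y, V z /\ forall i, `|partial i f y - partial i f z| < e / m.+1%:R.
  apply: filterI; first exact: open_nbhs_nbhs.
  have H i : \forall z \near y, `|partial i f y - partial i f z| < e / m.+1%:R.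
    by move/cvgrPdist_lt : (cf i) => /(_ _ e1).
  exact: filter_forall H.
move=> /nbhs_ballP[r/= r0 rP].
near=> h.
have hr : `|h| < r by near: h; apply/nbhs_ballP; exists r => // z; rewrite -ball_normE/= sub0r normrN.
have [z zh i|xi [xiP fe]] := @mean_value R m f y h.
  apply: df; suff /rP[] : ball y r z by [].
  by rewrite -ball_normE/= distrC (le_lt_trans zh).
rewrite opprD addrA (addrC h).
rewrite [X in `|X|](_ : _ = \sum_i h 0 i * (partial i f (xi i) - partial i f y)); last first.
  under eq_bigr do rewrite mulrBr; by rewrite sumrB -fe.
apply: le_trans (ler_norm_sum _ _ _) _.
apply: (@le_trans _ _ (\sum_(i < m) `|h| * (e / m.+1%:R))).
  apply: ler_sum => i _; rewrite normrM ler_pM// ?rV_coord_le//.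
  rewrite distrC ltW//; suff /rP[_ ] : ball y r (xi i) by apply.
  by rewrite -ball_normE/= distrC (le_lt_trans (xiP i)).
rewrite sumr_const card_ord -[_ *+ m]mulr_natr -mulrA [leLHS]mulrC ler_wpM2r//.
by rewrite -mulrA ler_piMr ?(ltW e0)// mulrC ler_pdivrMr// mul1r ler_nat.
Unshelve. all: by end_near. Qed.

(** Closure under products and composition goes by induction on the order, with the innermost
    derivative peeled off. [smooth_on] quantifies over all sequences of derivatives at once and does
    not offer this induction directly. *)
Fixpoint Ck (R : realType) m n (V : set 'rV[R]_m) (f : 'rV[R]_m -> R) : Prop :=
  (forall y, V y -> {for y, continuous f}) /\
  if n is n'.+1 then
    (forall y i, V y -> derivable f y (delta_mx 0 i)) /\
    (forall i, Ck n' V (partial i f))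
  else True.

Lemma partials_rcons (R : realType) m s i (f : 'rV[R]_m -> R) :
  partials (rcons s i) f = partials s (partial i f).
Proof. by rewrite /partials -cats1 foldr_cat. Qed.

Section smooth_functions.
Context {R : realType} {m : nat}.
Implicit Types (V : set 'rV[R]_m) (f g : 'rV[R]_m -> R).

Lemma CkW n V f : Ck n.+1 V f -> Ck n V f.
Proof.
elim: n f => [|n IH] f [cf [df pf]]; split => //; split => // i.
exact/IH/pf.
Qed.

Lemma smooth_onP V f : smooth_on V f <-> forall n, Ck n V f.
Proof.
split=> [sf n|h s y Vy].
  have : forall s y, V y -> {for y, continuous (partials s f)} /\
    forall i, derivable (partials s f) y (delta_mx 0 i) by [].
  clear sf; elim: n f => [|n IH] f sf; split.
  - by move=> y /(sf [::])[].
  - by [].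
  - by move=> y /(sf [::])[].
  - split=> [y i /(sf [::])[_]|i]; first exact.
    by apply: IH => s y Vy; rewrite -partials_rcons; apply: sf.
elim/last_ind: s f h => [|s i IH] f h.
  have [cf [df _]] := h 1%N; split; first exact: cf.
  by move=> i; apply: df.
by rewrite partials_rcons; apply: IH => n; have [_ [_]] := h n.+1; apply.
Qed.

Lemma smooth_on_sub V W f : V `<=` W -> smooth_on W f -> smooth_on V f.
Proof. by move=> VW sf s y /VW; exact: sf. Qed.

Lemma smooth_on_partial V f i : smooth_on V f -> smooth_on V (partial i f).
Proof. by move=> sf s y Vy; rewrite -partials_rcons; exact: sf. Qed.

Lemma smooth_on_partials V f s : smooth_on V f -> smooth_on V (partials s f).
Proof.
by elim/last_ind: s f => [|s i IH] f sf; [exact: sf|rewrite partials_rcons; exact/IH/smooth_on_partial].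
Qed.

Lemma smooth_on_cont V f y : smooth_on V f -> V y -> {for y, continuous f}.
Proof. by move=> sf /(sf [::])[]. Qed.

Lemma smooth_on_derivable V f y i : smooth_on V f -> V y ->
  derivable f y (delta_mx 0 i).
Proof. by move=> sf /(sf [::])[]. Qed.

Lemma smooth_on_local V f :
  (forall y, V y -> exists2 W, W y & smooth_on W f) -> smooth_on V f.
Proof. by move=> h s y /h[W Wy]; exact. Qed.

Lemma partial_congr V f g i y : open V -> V y -> (forall z, V z -> f z = g z) ->
  partial i f y = partial i g y.
Proof.
move=> oV Vy fg; apply: near_eq_derive; near=> z; apply: fg; near: z.
exact: open_nbhs_nbhs.
Unshelve. all: by end_near. Qed.

Lemma partials_congr V f g s : open V -> (forall z, V z -> f z = g z) ->
  forall y, V y -> partials s f y = partials s g y.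
Proof.
move=> oV fg; elim: s => [|i s IH] y Vy /=; first exact: fg.
exact: (@partial_congr V).
Qed.

Lemma cont_congr V f g y : open V -> V y -> (forall z, V z -> f z = g z) ->
  {for y, continuous f} -> {for y, continuous g}.
Proof.
move=> oV Vy fg cf; change (g @ y --> g y); rewrite -(fg y Vy).
have E : {near y, f =1 g} by near=> z; apply: fg; near: z; exact: open_nbhs_nbhs.
exact: cvg_trans (near_eq_cvg E) cf.
Unshelve. all: by end_near. Qed.

Lemma Ck_congr n V f g : open V -> (forall z, V z -> f z = g z) ->
  Ck n V f -> Ck n V g.
Proof.
move=> oV; elim: n f g => [|n IH] f g fg [cf].
  by move=> _; split=> // y Vy; exact: (cont_congr oV Vy fg (cf y Vy)).
move=> [df pf]; split=> [y Vy|]; first exact: (cont_congr oV Vy fg (cf y Vy)).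
split=> [y i Vy|i].
  apply: near_eq_derivable (df y i Vy); near=> z; apply: fg; near: z.
  exact: open_nbhs_nbhs.
by apply: IH (pf i) => z Vz; apply: (@partial_congr V).
Unshelve. all: by end_near. Qed.

Lemma smooth_on_congr V f g : open V -> (forall z, V z -> f z = g z) ->
  smooth_on V f -> smooth_on V g.
Proof.
move=> oV fg /smooth_onP sf; apply/smooth_onP => n.
exact: (Ck_congr oV fg (sf n)).
Qed.

Lemma Ck_cst n V (a : R) : Ck n V (fun=> a).
Proof.
elim: n a => [|n IH] a; (split; first by move=> y _; exact: cst_continuous) => //.
split=> [y i _|i]; first exact: derivable_cst.
rewrite (_ : partial i _ = fun=> 0); first exact: IH.
by apply/funext => y; rewrite /partial derive_cst.
Qed.

Lemma smooth_on_cst V (a : R) : smooth_on V (fun=> a).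
Proof. by apply/smooth_onP => n; exact: Ck_cst. Qed.

Lemma coordE i (y v : 'rV[R]_m) : is_derive y v (fun z : 'rV[R]_m => z 0 i) (v 0 i).
Proof.
have dc := @differentiable_coord R 1 m y 0 i.
apply: DeriveDef; first exact: diff_derivable.
rewrite /derive; apply: cvg_lim => //.
apply: (@cvg_trans _ ((fun=> v 0 i) @ (0^' : set_system R))); last exact: cvg_cst.
apply: near_eq_cvg; near=> h; rewrite /= !mxE addrK scalerA mulVf ?scale1r//.
by near: h; exact: nbhs_dnbhs_neq.
Unshelve. all: by end_near. Qed.

Lemma partial_coord i j y : partial i (fun z : 'rV[R]_m => z 0 j) y = (j == i)%:R.
Proof. by rewrite /partial (@derive_val _ _ _ _ _ _ _ (coordE j y _)) mxE eqxx. Qed.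

Lemma Ck_coord n V j : Ck n V (fun z => z 0 j).
Proof.
case: n => [|n]; (split; first by move=> y _; exact: coord_continuous) => //.
split=> [y i _|i]; first exact: (@ex_derive _ _ _ _ _ _ _ (coordE j y _)).
rewrite (_ : partial i _ = fun=> (j == i)%:R); first exact: Ck_cst.
by apply/funext => y; rewrite partial_coord.
Qed.

Lemma smooth_on_coord V j : smooth_on V (fun z => z 0 j).
Proof. by apply/smooth_onP => n; exact: Ck_coord. Qed.

Lemma partialD f g y i : derivable f y (delta_mx 0 i) ->
  derivable g y (delta_mx 0 i) ->
  partial i (fun z => f z + g z) y = partial i f y + partial i g y.
Proof. by move=> df dg; rewrite /partial -deriveD. Qed.

Lemma partialM f g y i : derivable f y (delta_mx 0 i) ->
  derivable g y (delta_mx 0 i) ->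
  partial i (fun z => f z * g z) y = partial i f y * g y + f y * partial i g y.
Proof.
move=> df dg; rewrite /partial (@deriveM _ _ f g y (delta_mx 0 i) df dg) addrC.
by rewrite /GRing.scale/= mulrC.
Qed.

Lemma CkD n V f g : open V -> Ck n V f -> Ck n V g -> Ck n V (fun z => f z + g z).
Proof.
move=> oV; elim: n f g => [|n IH] f g [cf sf] [cg sg].
  by split=> // y Vy; exact: (continuousD (cf y Vy) (cg y Vy)).
split=> [y Vy|]; first by exact: (continuousD (cf y Vy) (cg y Vy)).
case: sf sg => df sf [dg sg]; split=> [y i Vy|i].
  by apply: derivableD; [exact: df|exact: dg].
apply: (Ck_congr oV _ (IH _ _ (sf i) (sg i))) => // y Vy.
by rewrite partialD//; [exact: df|exact: dg].
Qed.

Lemma CkM n V f g : open V -> Ck n V f -> Ck n V g -> Ck n V (fun z => f z * g z).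
Proof.
move=> oV; elim: n f g => [|n IH] f g.
  by move=> [cf sf] [cg sg]; split=> // y Vy; exact: (continuousM (cf y Vy) (cg y Vy)).
move=> hf hg; have [cf [df sf]] := hf; have [cg [dg sg]] := hg.
split=> [y Vy|]; first by exact: (continuousM (cf y Vy) (cg y Vy)).
split=> [y i Vy|i].
  by apply: derivableM; [exact: df|exact: dg].
apply: (Ck_congr oV _ (CkD oV (IH _ _ (sf i) (CkW hg)) (IH _ _ (CkW hf) (sg i)))) => // y Vy.
by rewrite partialM//; [exact: df|exact: dg].
Qed.

Lemma smooth_onD V f g : open V -> smooth_on V f -> smooth_on V g ->
  smooth_on V (fun z => f z + g z).
Proof.
by move=> oV /smooth_onP hf /smooth_onP hg; apply/smooth_onP => n; exact: CkD.
Qed.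

Lemma smooth_onM V f g : open V -> smooth_on V f -> smooth_on V g ->
  smooth_on V (fun z => f z * g z).
Proof.
by move=> oV /smooth_onP hf /smooth_onP hg; apply/smooth_onP => n; exact: CkM.
Qed.

Lemma smooth_onZ V f (a : R) : open V -> smooth_on V f -> smooth_on V (fun z => a * f z).
Proof. by move=> oV sf; exact: (smooth_onM oV (smooth_on_cst a) sf). Qed.

Lemma smooth_onN V f : open V -> smooth_on V f -> smooth_on V (fun z => - f z).
Proof.
move=> oV /(smooth_onZ (-1) oV); apply: smooth_on_congr => // z _.
by rewrite mulN1r.
Qed.

Lemma smooth_onB V f g : open V -> smooth_on V f -> smooth_on V g ->
  smooth_on V (fun z => f z - g z).
Proof. by move=> oV sf sg; exact: (smooth_onD oV sf (smooth_onN oV sg)). Qed.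

Lemma smooth_on_sum V I (r : seq I) (F : I -> 'rV[R]_m -> R) : open V ->
  (forall i, smooth_on V (F i)) -> smooth_on V (fun z => \sum_(i <- r) F i z).
Proof.
move=> oV sF; elim: r => [|i r IH].
  by apply: (smooth_on_congr oV _ (smooth_on_cst 0)) => // z _; rewrite big_nil.
apply: (smooth_on_congr oV _ (smooth_onD oV (sF i) IH)) => // z _.
by rewrite big_cons.
Qed.

Lemma smooth_on_prod V I (r : seq I) (F : I -> 'rV[R]_m -> R) : open V ->
  (forall i, smooth_on V (F i)) -> smooth_on V (fun z => \prod_(i <- r) F i z).
Proof.
move=> oV sF; elim: r => [|i r IH].
  by apply: (smooth_on_congr oV _ (smooth_on_cst 1)) => // z _; rewrite big_nil.
apply: (smooth_on_congr oV _ (smooth_onM oV (sF i) IH)) => // z _.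
by rewrite big_cons.
Qed.

Lemma smooth_onX V f n : open V -> smooth_on V f -> smooth_on V (fun z => f z ^+ n).
Proof.
move=> oV sf; elim: n => [|n IH]; first exact: smooth_on_cst.
by apply: (smooth_on_congr oV _ (smooth_onM oV sf IH)) => // z _; rewrite exprS.
Qed.

(** A function of one variable packaged with all its derivatives, so that composing it with a smooth
    function of several variables only asks for the chain rule. *)
Definition derivative_seq (O : set R) (phi : nat -> R -> R) :=
  forall n t, O t -> is_derive t 1 (phi n) (phi n.+1 t).

Lemma is_derive_comp1 (phi phi' : R -> R) f y i :
  is_derive (f y) 1 phi (phi' (f y)) -> derivable f y (delta_mx 0 i) ->
  is_derive y (delta_mx 0 i) (fun z => phi (f z)) (phi' (f y) * partial i f y).
Proof.
move=> dphi df; pose g (s : R) := f (y + s *: delta_mx 0 i).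
have g0 : g 0 = f y by rewrite /g scale0r addr0.
have dg : derivable g 0 1 := (derivable_line0 f y _).2 df.
have dphi' : derivable phi (g 0) 1 by rewrite g0; exact: ex_derive.
have e : (fun s : R => phi (f (y + s *: delta_mx 0 i))) = phi \o g by [].
apply: DeriveDef.
  apply: (derivable_line0 (fun z => phi (f z)) _ _).1; rewrite e.
  apply/derivable1_diffP; apply: differentiable_comp; exact/derivable1_diffP.
rewrite -(derive_line0 (fun z => phi (f z))) e -derive1E (derive1_comp dg dphi').
by rewrite g0 !derive1E derive_line0 /partial derive_val.
Qed.

(** The derivative of [phi k] after [f] is [phi k.+1] after [f] times a derivative of [f], so the
    induction on the order must treat all [k] at once. *)
Lemma Ck_comp1 (O : set R) phi : derivative_seq O phi ->
  forall n k V f, open V -> (forall y, V y -> O (f y)) -> Ck n V f ->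
  Ck n V (fun y => phi k (f y)).
Proof.
move=> dphi; have cphi k t : O t -> {for t, continuous (phi k)}.
  move=> /(dphi k) h; apply: differentiable_continuous.
  by apply/derivable1_diffP; exact: ex_derive.
elim=> [|n IH] k V f oV VO hf; have [cf] := hf.
  by move=> _; split=> // y Vy; apply: continuous_comp; [exact: cf|exact/cphi/VO].
move=> [df sf]; split=> [y Vy|].
  by apply: continuous_comp; [exact: cf|exact/cphi/VO].
have D y i : V y -> is_derive y (delta_mx 0 i) (fun z => phi k (f z))
    (phi k.+1 (f y) * partial i f y).
  move=> Vy; apply: (@is_derive_comp1 (phi k) (phi k.+1)); last exact: df.
  exact/dphi/VO.
split=> [y i /(D y i) h|i]; first exact: ex_derive.
apply: (Ck_congr oV _ (CkM oV (IH k.+1 _ _ oV VO (CkW hf)) (sf i))) => y /(D y i) h.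
by rewrite /partial derive_val.
Qed.

Lemma smooth_on_comp1 (O : set R) phi k V f : derivative_seq O phi -> open V ->
  (forall y, V y -> O (f y)) -> smooth_on V f -> smooth_on V (fun y => phi k (f y)).
Proof.
move=> dphi oV VO /smooth_onP sf; apply/smooth_onP => n.
exact: (Ck_comp1 dphi).
Qed.

End smooth_functions.

Lemma smooth_on_differentiable (R : realType) m (V : set 'rV[R]_m) f y :
  open V -> V y -> smooth_on V f -> differentiable f y.
Proof.
move=> oV Vy sf; apply: (@partial_differentiable _ _ _ V) => // [z i Vz|i].
  exact: smooth_on_derivable Vz.
exact: smooth_on_cont (smooth_on_partial i sf) Vy.
Qed.

(** Restricting to the line in direction [i] turns the claim into the differential of [g] applied to
    the derivative of a curve, which is then expanded in the standard basis. *)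
Lemma chain_rule (R : realType) m p (F : 'rV[R]_m -> 'rV[R]_p) (g : 'rV[R]_p -> R) y i :
  differentiable g (F y) ->
  (forall j, derivable (fun z => F z 0 j) y (delta_mx 0 i)) ->
  is_derive y (delta_mx 0 i) (fun z => g (F z))
    (\sum_j partial j g (F y) * partial i (fun z => F z 0 j) y).
Proof.
move=> dg dF; pose G (s : R) := F (y + s *: delta_mx 0 i).
have G0 : G 0 = F y by rewrite /G scale0r addr0.
have dG : derivable G 0 1.
  apply/derivable_mxP => i' j; rewrite ord1.
  exact: (derivable_line0 (fun z => F z 0 j) y _).2.
have dgG : differentiable g (G 0) by rewrite G0.
have e : (fun s : R => g (F (y + s *: delta_mx 0 i))) = g \o G by [].
have dc : differentiable (g \o G) 0 by apply: differentiable_comp => //; exact/derivable1_diffP.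
apply: DeriveDef.
  by apply: (derivable_line0 (fun z => g (F z)) _ _).1; rewrite e; exact/derivable1_diffP.
rewrite -(derive_line0 (fun z => g (F z))) e deriveE//.
rewrite diff_comp//; last exact/derivable1_diffP.
rewrite /= -[X in 'd g _ X]deriveE; last exact/derivable1_diffP.
rewrite derive_mx// G0 [X in 'd g _ X]row_sum_delta linear_sum/=.
apply: eq_bigr => j _; rewrite linearZ/= mxE -deriveE//.
rewrite [RHS]mulrC; congr (_ * _).
by rewrite (derive_line0 (fun z => F z 0 j)).
Qed.

Section composition.
Context {R : realType} {m p : nat}.
Variables (V : set 'rV[R]_m) (W : set 'rV[R]_p) (F : 'rV[R]_m -> 'rV[R]_p).
Hypotheses (oV : open V) (oW : open W) (VW : forall y, V y -> W (F y)).
Hypothesis sF : forall j, smooth_on V (fun y => F y 0 j).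

Lemma smooth_map_cont y : V y -> {for y, continuous F}.
Proof.
move=> Vy; suff H : F @ nbhs y --> F y by [].
apply/cvgrPdist_lt => e e0.
have : \forall z \near y, forall j, `|F y 0 j - F z 0 j| < e.
  have H j : \forall z \near y, `|F y 0 j - F z 0 j| < e.
    by have /cvgrPdist_lt /(_ _ e0) := smooth_on_cont (sF j) Vy.
  exact: filter_forall H.
apply: filterS => z h.
rewrite [X in X < _]/Num.Def.normr/= mx_normrE bigmax_lt// => -[i j] _ /=.
by rewrite ord1 !mxE.
Qed.

Lemma partial_comp (g : 'rV[R]_p -> R) y i : V y -> smooth_on W g ->
  is_derive y (delta_mx 0 i) (fun z => g (F z))
    (\sum_j partial j g (F y) * partial i (fun z => F z 0 j) y).
Proof.
move=> Vy sg; apply: chain_rule => [|j]; last exact: smooth_on_derivable (sF j) Vy.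
exact: (smooth_on_differentiable oW (VW Vy)).
Qed.

Lemma smooth_on_comp (g : 'rV[R]_p -> R) : smooth_on W g -> smooth_on V (fun y => g (F y)).
Proof.
(* The induction is generalized over [g] because differentiating brings in [partial j g] composed
   with [F]. *)
move=> sg; apply/smooth_onP => n; elim: n g sg => [|n IH] g sg; split=> //.
- by move=> y Vy; apply: continuous_comp;
    [exact: smooth_map_cont|exact: smooth_on_cont (VW Vy)].
- by move=> y Vy; apply: continuous_comp;
    [exact: smooth_map_cont|exact: smooth_on_cont (VW Vy)].
split=> [y i Vy|i]; first by have h := partial_comp i Vy sg; exact: ex_derive.
apply: (@Ck_congr _ _ _ _ (fun y => \sum_j partial j g (F y) * partial i (fun z => F z 0 j) y)) => //.
  by move=> y Vy; have h := partial_comp i Vy sg; rewrite /partial derive_val.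
elim: index_enum => [|j r IHr].
  by apply: (Ck_congr oV _ (Ck_cst n V 0)) => // y _; rewrite big_nil.
apply: (Ck_congr oV _ (CkD oV (CkM oV (IH _ (smooth_on_partial j sg)) _) IHr)).
  by move=> y _; rewrite big_cons.
exact: (smooth_onP _ _).1 (smooth_on_partial i (sF j)) n.
Qed.

End composition.

(** * Complex-valued smooth functions and bounds on their derivatives *)

Notation normc := ComplexField.Normc.normc.

Section complex_norm.
Context {R : realType}.
Implicit Types x y : R[i].

Lemma ReD x y : complex.Re (x + y) = complex.Re x + complex.Re y.
Proof. by case: x; case: y. Qed.

Lemma ImD x y : complex.Im (x + y) = complex.Im x + complex.Im y.
Proof. by case: x; case: y. Qed.

Lemma ReM x y : complex.Re (x * y) = complex.Re x * complex.Re y - complex.Im x * complex.Im y.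
Proof. by case: x; case: y. Qed.

Lemma ImM x y : complex.Im (x * y) = complex.Re x * complex.Im y + complex.Im x * complex.Re y.
Proof. by case: x; case: y. Qed.

Lemma complex_ext x y : complex.Re x = complex.Re y -> complex.Im x = complex.Im y -> x = y.
Proof. by case: x => a b; case: y => c d /= -> ->. Qed.

Lemma normcE x : normc x = Num.sqrt (complex.Re x ^+ 2 + complex.Im x ^+ 2).
Proof. by case: x. Qed.

Lemma normc_ge0 x : 0 <= normc x.
Proof. by rewrite normcE sqrtr_ge0. Qed.

Lemma ler_normcD x y : normc (x + y) <= normc x + normc y.
Proof. exact: (@complex.le_normcD R x y). Qed.

Lemma normc_real (a : R) : normc a%:C = `|a|.
Proof. by rewrite normcE/= expr0n addr0 sqrtr_sqr. Qed.

Lemma ler_Re_normc x : `|complex.Re x| <= normc x.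
Proof. by rewrite normcE -sqrtr_sqr ler_sqrt ?lerDl ?sqr_ge0// addr_ge0// sqr_ge0. Qed.

Lemma ler_Im_normc x : `|complex.Im x| <= normc x.
Proof. by rewrite normcE -sqrtr_sqr ler_sqrt ?lerDr ?sqr_ge0// addr_ge0// sqr_ge0. Qed.

Lemma ler_normc_ReIm x : normc x <= `|complex.Re x| + `|complex.Im x|.
Proof.
rewrite normcE -[leRHS]ger0_norm ?addr_ge0// -sqrtr_sqr ler_sqrt ?sqr_ge0//.
by rewrite sqrrD !real_normK ?num_real// lerD2r lerDl mulrn_wge0// mulr_ge0.
Qed.

Lemma normcM x y : normc (x * y) = normc x * normc y.
Proof. exact: ComplexField.Normc.normcM. Qed.

Lemma normc0 : normc (0 : R[i]) = 0.
Proof. exact: ComplexField.Normc.normc0. Qed.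

Lemma normc_eq0 x : normc x <= 0 -> x = 0.
Proof.
move=> x0; apply: ComplexField.Normc.eq0_normc; apply/eqP.
by rewrite eq_le x0 normc_ge0.
Qed.

Lemma normcN x : normc (- x) = normc x.
Proof. by rewrite !normcE; case: x => a b /=; rewrite !sqrrN. Qed.

Lemma ler_normcB x y : normc (x - y) <= normc x + normc y.
Proof. by rewrite -(normcN y) ler_normcD. Qed.

Lemma ler_normc_sum I (r : seq I) (P : pred I) (F : I -> R[i]) :
  normc (\sum_(i <- r | P i) F i) <= \sum_(i <- r | P i) normc (F i).
Proof.
elim/big_ind2 : _ => [|a x b y ax yb|//]; first by rewrite normc0.
by rewrite (le_trans (ler_normcD _ _))// lerD.
Qed.

End complex_norm.

Definition partialC (R : realType) m (i : 'I_m) (f : 'rV[R]_m -> R[i]) : 'rV[R]_m -> R[i] :=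
  fun y => partial i (fun t => complex.Re (f t)) y +i* partial i (fun t => complex.Im (f t)) y.

Section complex_smooth.
Context {R : realType} {m : nat}.
Implicit Types (V : set 'rV[R]_m) (f g : 'rV[R]_m -> R[i]).

Lemma partialsC_cons i s f : partialsC (i :: s) f = partialC i (partialsC s f).
Proof. by []. Qed.

Lemma partialsC_rcons s i f : partialsC (rcons s i) f = partialsC s (partialC i f).
Proof. by apply/funext => y; rewrite /partialsC !partials_rcons. Qed.

Lemma partialsC_nil f : partialsC [::] f = f.
Proof. by apply/funext => y; rewrite /partialsC/=; case: (f y). Qed.

Lemma partialsC1 i f : partialsC [:: i] f = partialC i f.
Proof. by []. Qed.

Lemma partialsC_congr V f g s : open V -> (forall z, V z -> f z = g z) ->
  forall y, V y -> partialsC s f y = partialsC s g y.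
Proof.
move=> oV fg y Vy; rewrite /partialsC; congr (_ +i* _);
  by apply: (partials_congr _ oV _ Vy) => z /fg ->.
Qed.

Lemma partialC_congr V f g i y : open V -> V y -> (forall z, V z -> f z = g z) ->
  partialC i f y = partialC i g y.
Proof. by move=> oV Vy fg; rewrite -!partialsC1; exact: (partialsC_congr _ oV). Qed.

Lemma smoothC_on_congr V f g : open V -> (forall z, V z -> f z = g z) ->
  smoothC_on V f -> smoothC_on V g.
Proof.
by move=> oV fg [sr si]; split;
  [apply: (smooth_on_congr oV _ sr)|apply: (smooth_on_congr oV _ si)] => z /fg ->.
Qed.

Lemma smoothC_on_sub V W f : V `<=` W -> smoothC_on W f -> smoothC_on V f.
Proof. by move=> VW [sr si]; split; exact: smooth_on_sub VW _. Qed.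

Lemma smoothC_on_local V f :
  (forall y, V y -> exists2 W, W y & smoothC_on W f) -> smoothC_on V f.
Proof.
by move=> h; split; apply: smooth_on_local => y /h[W Wy [sr si]]; exists W.
Qed.

Lemma smoothC_on_partialC V f i : smoothC_on V f -> smoothC_on V (partialC i f).
Proof. by move=> [sr si]; split; exact: smooth_on_partial. Qed.

Lemma smoothC_on_partialsC V f s : smoothC_on V f -> smoothC_on V (partialsC s f).
Proof. by move=> [sr si]; split; exact: smooth_on_partials. Qed.

Lemma smoothC_on_cst V (a : R[i]) : smoothC_on V (fun=> a).
Proof. by split; exact: smooth_on_cst. Qed.

Lemma smoothC_on_real V (f : 'rV[R]_m -> R) : smooth_on V f -> smoothC_on V (fun y => (f y)%:C).
Proof. by move=> sf; split; [exact: sf|exact: smooth_on_cst]. Qed.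

Lemma smoothC_onD V f g : open V -> smoothC_on V f -> smoothC_on V g ->
  smoothC_on V (fun z => f z + g z).
Proof.
move=> oV [fr fi] [gr gi]; split.
  by apply: (smooth_on_congr oV _ (smooth_onD oV fr gr)) => z _; rewrite ReD.
by apply: (smooth_on_congr oV _ (smooth_onD oV fi gi)) => z _; rewrite ImD.
Qed.

Lemma smoothC_onM V f g : open V -> smoothC_on V f -> smoothC_on V g ->
  smoothC_on V (fun z => f z * g z).
Proof.
move=> oV [fr fi] [gr gi]; split.
  apply: (smooth_on_congr oV _ (smooth_onB oV (smooth_onM oV fr gr) (smooth_onM oV fi gi))).
  by move=> z _; rewrite ReM.
apply: (smooth_on_congr oV _ (smooth_onD oV (smooth_onM oV fr gi) (smooth_onM oV fi gr))).
by move=> z _; rewrite ImM.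
Qed.

Lemma smoothC_onZ V f (a : R[i]) : open V -> smoothC_on V f -> smoothC_on V (fun z => a * f z).
Proof. by move=> oV sf; exact: (smoothC_onM oV (smoothC_on_cst V a) sf). Qed.

Lemma smoothC_onB V f g : open V -> smoothC_on V f -> smoothC_on V g ->
  smoothC_on V (fun z => f z - g z).
Proof.
move=> oV sf sg.
apply: (smoothC_on_congr oV _ (smoothC_onD oV sf (smoothC_onZ (-1) oV sg))) => z _.
by rewrite mulN1r.
Qed.

Lemma smoothC_on_sum V I (r : seq I) (F : I -> 'rV[R]_m -> R[i]) : open V ->
  (forall i, smoothC_on V (F i)) -> smoothC_on V (fun z => \sum_(i <- r) F i z).
Proof.
move=> oV sF; elim: r => [|i r IH].
  by apply: (smoothC_on_congr oV _ (smoothC_on_cst V 0)) => // z _; rewrite big_nil.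
apply: (smoothC_on_congr oV _ (smoothC_onD oV (sF i) IH)) => // z _.
by rewrite big_cons.
Qed.

Lemma smoothC_onX V f n : open V -> smoothC_on V f -> smoothC_on V (fun z => f z ^+ n).
Proof.
move=> oV sf; elim: n => [|n IH]; first exact: smoothC_on_cst.
by apply: (smoothC_on_congr oV _ (smoothC_onM oV sf IH)) => // z _; rewrite exprS.
Qed.

Lemma partialC_cst (i : 'I_m) (a : R[i]) y : partialC i (fun=> a) y = 0.
Proof. by rewrite /partialC /partial !derive_cst. Qed.

Lemma partialC_real i (f : 'rV[R]_m -> R) y : partialC i (fun z => (f z)%:C) y = (partial i f y)%:C.
Proof. by rewrite /partialC /= /partial derive_cst. Qed.

Lemma partialCD V f g i y : V y -> smoothC_on V f -> smoothC_on V g ->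
  partialC i (fun z => f z + g z) y = partialC i f y + partialC i g y.
Proof.
move=> Vy [fr fi] [gr gi]; rewrite /partialC.
under [X in partial i X]eq_fun do rewrite ReD.
under [X in _ +i* partial i X y]eq_fun do rewrite ImD.
by rewrite !partialD//; exact: smooth_on_derivable Vy.
Qed.

Lemma partialMDM (a b c d : 'rV[R]_m -> R) i y :
  derivable a y (delta_mx 0 i) -> derivable b y (delta_mx 0 i) ->
  derivable c y (delta_mx 0 i) -> derivable d y (delta_mx 0 i) ->
  partial i (fun z => a z * c z + b z * d z) y =
  partial i a y * c y + a y * partial i c y + (partial i b y * d y + b y * partial i d y).
Proof.
move=> da db dc dd.
rewrite (@partialD _ _ (fun z => a z * c z) (fun z => b z * d z)); last 2 first.
- exact: (derivableM da dc).
- exact: (derivableM db dd).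
by rewrite !partialM.
Qed.

Lemma partialCM V f g i y : V y -> smoothC_on V f -> smoothC_on V g ->
  partialC i (fun z => f z * g z) y = partialC i f y * g y + f y * partialC i g y.
Proof.
move=> Vy [fr fi] [gr gi]; rewrite /partialC.
under [X in partial i X]eq_fun do rewrite ReM -mulNr.
under [X in _ +i* partial i X y]eq_fun do rewrite ImM.
have dfr := smooth_on_derivable (i := i) fr Vy; have dfi := smooth_on_derivable (i := i) fi Vy.
have dgr := smooth_on_derivable (i := i) gr Vy; have dgi := smooth_on_derivable (i := i) gi Vy.
have dN : derivable (fun z => - complex.Im (f z)) y (delta_mx 0 i) by exact: derivableN.
have pN : partial i (fun z => - complex.Im (f z)) y = - partial i (fun z => complex.Im (f z)) y.
  exact: deriveN.
by rewrite !partialMDM// pN; apply: complex_ext; rewrite ?ReD ?ImD ?ReM ?ImM /=; ring.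
Qed.

Lemma partialCZ V f (a : R[i]) i y : V y -> smoothC_on V f ->
  partialC i (fun z => a * f z) y = a * partialC i f y.
Proof.
move=> Vy sf; rewrite (partialCM i Vy (smoothC_on_cst V a) sf) partialC_cst.
by rewrite mul0r add0r.
Qed.

Lemma partialsCD V f g s y : open V -> V y -> smoothC_on V f -> smoothC_on V g ->
  partialsC s (fun z => f z + g z) y = partialsC s f y + partialsC s g y.
Proof.
move=> oV + sf sg; elim: s y => [|i s IH] y Vy; first by rewrite !partialsC_nil.
rewrite !partialsC_cons (partialC_congr i oV Vy IH).
by apply: (partialCD i Vy); exact: smoothC_on_partialsC.
Qed.

Lemma partialsCZ V f (a : R[i]) s y : open V -> V y -> smoothC_on V f ->
  partialsC s (fun z => a * f z) y = a * partialsC s f y.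
Proof.
move=> oV + sf; elim: s y => [|i s IH] y Vy; first by rewrite !partialsC_nil.
rewrite !partialsC_cons (partialC_congr i oV Vy IH).
by apply: (partialCZ _ i Vy); exact: smoothC_on_partialsC.
Qed.

Lemma partialsC0 (s : seq 'I_m) : partialsC s (fun=> 0) = (fun=> 0) :> ('rV[R]_m -> R[i]).
Proof.
elim: s => [|i s IH]; first exact: partialsC_nil.
by rewrite partialsC_cons IH; apply/funext => y; exact: partialC_cst.
Qed.

Lemma partialsC_sum V I (r : seq I) (F : I -> 'rV[R]_m -> R[i]) s y : open V -> V y ->
  (forall i, smoothC_on V (F i)) ->
  partialsC s (fun z => \sum_(i <- r) F i z) y = \sum_(i <- r) partialsC s (F i) y.
Proof.
move=> oV Vy sF; elim: r => [|i r IH].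
  rewrite big_nil -[RHS](congr1 (@^~ y) (partialsC0 s)).
  by apply: (partialsC_congr _ oV) => // z _; rewrite big_nil.
rewrite big_cons -IH -(partialsCD _ oV Vy (sF i)); last exact: smoothC_on_sum.
by apply: (partialsC_congr _ oV) => // z _; rewrite big_cons.
Qed.

Lemma smoothC_on_cont V f y : smoothC_on V f -> V y -> {for y, continuous (fun z => normc (f z))}.
Proof.
move=> [fr fi] Vy; have cr := smooth_on_cont fr Vy; have ci := smooth_on_cont fi Vy.
have -> : (fun z => normc (f z)) = (Num.sqrt \o
  (fun z => complex.Re (f z) * complex.Re (f z) + complex.Im (f z) * complex.Im (f z))).
  by apply/funext => z; rewrite normcE/= !expr2.
apply: continuous_comp; last exact: sqrt_continuous.
exact: continuousD (continuousM cr cr) (continuousM ci ci).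
Qed.

End complex_smooth.

Section complex_composition.
Context {R : realType} {m p : nat}.
Variables (V : set 'rV[R]_m) (W : set 'rV[R]_p) (F : 'rV[R]_m -> 'rV[R]_p).
Hypotheses (oV : open V) (oW : open W) (VW : forall y, V y -> W (F y)).
Hypothesis sF : forall j, smooth_on V (fun y => F y 0 j).

Lemma smoothC_on_comp (g : 'rV[R]_p -> R[i]) : smoothC_on W g -> smoothC_on V (fun y => g (F y)).
Proof.
by move=> [gr gi]; split; [exact: (smooth_on_comp oV oW VW sF gr)|exact: (smooth_on_comp oV oW VW sF gi)].
Qed.

Lemma partialC_comp (g : 'rV[R]_p -> R[i]) y i : V y -> smoothC_on W g ->
  partialC i (fun z => g (F z)) y =
  \sum_j partialC j g (F y) * (partial i (fun z => F z 0 j) y)%:C.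
Proof.
move=> Vy [gr gi].
have [_ er] := partial_comp oW VW sF i Vy gr.
have [_ ei] := partial_comp oW VW sF i Vy gi.
apply: complex_ext => /=.
  rewrite /partial er; elim/big_ind2: _ => // [a1 a2 b1 b2 -> ->|j _]; first by rewrite ReD.
  by rewrite ReM/= mulr0 subr0.
rewrite /partial ei; elim/big_ind2: _ => // [a1 a2 b1 b2 -> ->|j _]; first by rewrite ImD.
by rewrite ImM/= mulr0 add0r.
Qed.

End complex_composition.

Lemma smoothC_bounded (R : realType) m (V L : set 'rV[R]_m) (f : 'rV[R]_m -> R[i]) :
  compact L -> L `<=` V -> smoothC_on V f ->
  exists2 C : R, 0 <= C & forall y, L y -> normc (f y) <= C.
Proof.
move=> cL LV sf.
have [->|L0] := eqVneq L set0; first by exists 0 => // y.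
have [||c cL' h] := @EVT_max_rV R m (fun y => normc (f y)) L _ cL.
- exact/set0P.
- apply: continuous_in_subspaceT => y /set_mem Ly.
  exact: smoothC_on_cont sf (LV _ Ly).
exists (normc (f c)) => [|y Ly]; first exact: normc_ge0.
by apply: h; exact: mem_set.
Qed.

(* By the chain rule and the product rule, the derivatives of [A * (h \o F)]
   are combinations of those of [h] whose coefficients do not depend on [h]. *)
Lemma comp_bound (R : realType) m p (V : set 'rV[R]_m) (W : set 'rV[R]_p)
    (F : 'rV[R]_m -> 'rV[R]_p) (L : set 'rV[R]_m) s (A : 'rV[R]_m -> R[i]) :
  open V -> open W -> (forall y, V y -> W (F y)) ->
  (forall j, smooth_on V (fun y => F y 0 j)) -> compact L -> L `<=` V ->
  smoothC_on V A ->
  exists2 C : R, 0 <= C & forall h, smoothC_on W h -> forall y t, L y -> 0 <= t ->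
    (forall s' : seq 'I_p, (size s' <= size s)%N -> normc (partialsC s' h (F y)) <= t) ->
    normc (partialsC s (fun z => A z * h (F z)) y) <= C * t.
Proof.
move=> oV oW VW sF cL LV; elim/last_ind: s A => [|s i IH] A sA.
  have [C C0 CP] := smoothC_bounded cL LV sA.
  exists C => // h sh y t Ly t0 ht; rewrite partialsC_nil normcM.
  rewrite ler_pM ?normc_ge0 ?CP//.
  by have := ht [::]; rewrite partialsC_nil; apply.
(* With [i] the innermost derivative, [A * (h \o F)] becomes [(d_i A) * (h \o F)] plus the sum over
   [j] of [(A * d_i F_j) * (d_j h \o F)]: the same shape with one derivative fewer outside. *)
have [C0 C00 C0P] := IH _ (smoothC_on_partialC i sA).
have sB j : smoothC_on V (fun z => A z * (partial i (fun z => F z 0 j) z)%:C).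
  exact: (smoothC_onM oV sA (smoothC_on_real (smooth_on_partial i (sF j)))).
have /choice [C CP] : forall j, exists C, 0 <= C /\ forall h, smoothC_on W h ->
    forall y t, L y -> 0 <= t ->
    (forall s' : seq 'I_p, (size s' <= size s)%N -> normc (partialsC s' h (F y)) <= t) ->
    normc (partialsC s (fun z => A z * (partial i (fun z => F z 0 j) z)%:C * h (F z)) y)
      <= C * t.
  by move=> j; have [C ? ?] := IH _ (sB j); exists C.
exists (C0 + \sum_j C j) => [|h sh y t Ly t0 ht].
  by rewrite addr_ge0// sumr_ge0// => j _; have [] := CP j.
rewrite partialsC_rcons.
have Vy := LV y Ly.
have shF g : smoothC_on W g -> smoothC_on V (fun z => g (F z)) by exact: smoothC_on_comp.
rewrite (@partialsC_congr _ _ V _ (fun z => partialC i A z * h (F z) +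
  \sum_j A z * (partial i (fun z => F z 0 j) z)%:C * partialC j h (F z)))//; last first.
  move=> z Vz; rewrite (partialCM _ Vz sA (shF _ sh)) (partialC_comp oW VW sF _ Vz sh).
  by rewrite mulr_sumr; congr (_ + _); apply: eq_bigr => j _; rewrite mulrAC mulrA.
have sT j : smoothC_on V (fun z => A z * (partial i (fun z => F z 0 j) z)%:C * partialC j h (F z)).
  exact: (smoothC_onM oV (sB j) (shF _ (smoothC_on_partialC j sh))).
rewrite (partialsCD _ oV Vy (smoothC_onM oV (smoothC_on_partialC i sA) (shF _ sh)) (smoothC_on_sum _ oV sT)).
rewrite (partialsC_sum _ _ oV Vy sT) (le_trans (ler_normcD _ _))// mulrDl lerD//.
  by apply: C0P => // s' ss'; apply: ht; rewrite size_rcons (leq_trans ss').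
rewrite (le_trans (ler_normc_sum _ _ _))// mulr_suml ler_sum// => j _.
apply: ((CP j).2 _ (smoothC_on_partialC j sh)) => // s' ss'.
by rewrite -partialsC_rcons; apply: ht; rewrite !size_rcons.
Qed.

Lemma mean_value_bound (R : realType) m (f : 'rV[R]_m -> R) (M : R) :
  smooth_on setT f -> (forall i y, `|partial i f y| <= M) ->
  forall x y, `|f x - f y| <= m%:R * M * `|x - y|.
Proof.
move=> sf fM x y.
have [z _ i|xi [_ e]] := @mean_value R m f y (x - y).
  exact: smooth_on_derivable sf _.
move: e; rewrite subrKC => ->; rewrite (le_trans (ler_norm_sum _ _ _))//.
apply: (@le_trans _ _ (\sum_(i < m) `|x - y| * M)).
  by apply: ler_sum => i _; rewrite normrM ler_pM// rV_coord_le.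
rewrite sumr_const card_ord -[_ *+ m]mulr_natr (_ : _ * m%:R = m%:R * M * `|x - y|)//; ring.
Qed.

(** The factor 2 comes from treating real and imaginary parts separately. *)
Lemma mean_value_boundC (R : realType) m (f : 'rV[R]_m -> R[i]) (M : R) :
  smoothC_on setT f -> (forall i y, normc (partialC i f y) <= M) ->
  forall x y, normc (f x - f y) <= 2 * m%:R * M * `|x - y|.
Proof.
move=> [sr si] fM x y.
rewrite (le_trans (ler_normc_ReIm _))//.
rewrite (_ : 2 * m%:R * M * `|x - y| = m%:R * M * `|x - y| + m%:R * M * `|x - y|); last by ring.
apply: lerD.
  have := @mean_value_bound R m (fun y => complex.Re (f y)) M sr _ x y.
  rewrite -raddfB/=; apply => i z; exact: le_trans (ler_Re_normc _) (fM i z).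
have := @mean_value_bound R m (fun y => complex.Im (f y)) M si _ x y.
rewrite -raddfB/=; apply => i z; exact: le_trans (ler_Im_normc _) (fM i z).
Qed.

(** * Iterated integrals and integration by parts *)

Section integral1.
Context {R : realType}.
Notation mu := (@lebesgue_measure R).
Implicit Types f g : R -> R.

(** All integrands are continuous and vanish off a segment; restricting the integral to that segment
    gives integrability. *)
Lemma Rintegral_itv f a b : (forall t, t < a \/ b < t -> f t = 0) ->
  Rintegral mu setT f = Rintegral mu `[a, b] f.
Proof.
move=> fab; rewrite [RHS]Rintegral_mkcond; congr Rintegral; apply/funext => t.
rewrite patchE; case: ifPn => // /negP; rewrite inE/= in_itv/= => tab.
apply: fab; have [ta|at_] := ltP t a; first by left.
by right; rewrite ltNge; apply/negP => tb; apply: tab; rewrite at_ tb.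
Qed.

Lemma itv_integrable f a b : continuous f -> mu.-integrable `[a, b] (EFin \o f).
Proof.
move=> cf; apply: continuous_compact_integrable; first exact: segment_compact.
exact: continuous_subspaceT.
Qed.

Lemma int1D f g a b : continuous f -> continuous g ->
  (forall t, t < a \/ b < t -> f t = 0) -> (forall t, t < a \/ b < t -> g t = 0) ->
  Rintegral mu setT (fun t => f t + g t) = Rintegral mu setT f + Rintegral mu setT g.
Proof.
move=> cf cg f0 g0; rewrite !(@Rintegral_itv _ a b)//; last first.
  by move=> t h; rewrite f0// g0// addr0.
by rewrite RintegralD//; exact: itv_integrable.
Qed.

Lemma int1Z f (r : R) a b : continuous f -> (forall t, t < a \/ b < t -> f t = 0) ->
  Rintegral mu setT (fun t => r * f t) = r * Rintegral mu setT f.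
Proof.
move=> cf f0; rewrite !(@Rintegral_itv _ a b)//; last by move=> t h; rewrite f0// mulr0.
by rewrite RintegralZl//; exact: itv_integrable.
Qed.

Lemma int1_bound f a b (M : R) : continuous f -> (forall t, t < a \/ b < t -> f t = 0) ->
  a <= b -> (forall t, `|f t| <= M) -> `|Rintegral mu setT f| <= M * (b - a).
Proof.
move=> cf f0 ab fM; rewrite (@Rintegral_itv _ a b)//.
have int_f := @itv_integrable f a b cf.
apply: (le_trans (le_normr_Rintegral _ int_f)) => //.
have cn : continuous (fun t => `|f t|).
  by move=> t; apply: (@cvg_norm _ _ _ (nbhs t) _ f); exact: cf.
have cM : continuous (fun _ : R => M) by exact: cst_continuous.
apply: (le_trans (le_Rintegral _ (itv_integrable a b cn) (itv_integrable a b cM) _)) => //.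
rewrite Rintegral_cst//.
suff -> : fine (mu `[a, b]%classic) = b - a by [].
rewrite lebesgue_measure_itv/= lte_fin.
by move: ab; rewrite le_eqVlt => /orP[/eqP ->|->]; rewrite ?ltxx ?subrr.
Qed.

Lemma int1_derive f g (a b : R) : a < b -> (forall t : R, is_derive t 1 f (g t)) -> continuous g ->
  (forall t, t < a \/ b < t -> g t = 0) -> Rintegral mu setT g = f b - f a.
Proof.
move=> ab df cg g0; rewrite (@Rintegral_itv _ a b)// /Rintegral.
have cf : continuous f.
  move=> t; apply: differentiable_continuous; apply/derivable1_diffP.
  exact: ex_derive.
rewrite (@continuous_FTC2 R g f a b)//; first exact: continuous_subspaceT.
- split; first by move=> t _; have h := df t; exact: ex_derive.
  + by apply: cvg_at_right_filter; exact: cf.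
  + by apply: cvg_at_left_filter; exact: cf.
- by move=> t _; rewrite derive1E; have h := df t; rewrite derive_val.
Qed.

(** After division by [s] the remainder is at most [C * |s|]. The criterion serves for
    differentiation under the integral sign and for flat functions at 0, where a quadratic estimate
    is directly available. *)
Lemma is_derive_quadratic f (t d C : R) :
  (forall s, `|f (t + s) - f t - s * d| <= C * s ^+ 2) -> is_derive t 1 f d.
Proof.
move=> h.
have H : (fun s : R => s^-1 *: ((f \o shift t) (s *: 1) - f t)) @ 0^' --> d.
  apply/cvgrPdist_le => e e0.
  have e1 : 0 < e / (`|C| + 1) by rewrite divr_gt0// ltr_wpDl.
  near=> s.
  have s0 : s != 0 by near: s; exact: nbhs_dnbhs_neq.
  rewrite distrC /= -[X in `|X|](mulKf s0) normrM normfV ler_pdivrMl ?normr_gt0//.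
  rewrite mulrBr [s *: 1]mulr1 [s^-1 *: _]/(s^-1 * _) mulVKf// addrC (addrC s).
  rewrite [- _ + _]addrC (le_trans (h s))//.
  have : `|s| <= e / (`|C| + 1).
    by apply: ltW; near: s; exact: dnbhs0_lt.
  rewrite ler_pdivlMr ?ltr_wpDl// => se.
  rewrite -[s ^+ 2]real_normK ?num_real// expr2 mulrA mulrC ler_wpM2l//.
  rewrite (le_trans (ler_wpM2r _ (ler_norm C)))// (le_trans _ se)// mulrC ler_wpM2l//.
  by rewrite lerDl.
apply: DeriveDef; first by apply/cvg_ex; exists d.
exact: cvg_lim H.
Unshelve. all: by end_near. Qed.

End integral1.

(** The norm of row vectors is the maximum norm, so the support lies in a closed cube about 0. The
    codomain is any [zmodType] so that real and complex functions are both covered. *)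
Definition bsupp (R : realType) m (T : zmodType) (a : R) (h : 'rV[R]_m -> T) :=
  forall y, a < `|y| -> h y = 0.

Lemma open_norm_gt (R : realType) m (a : R) : open [set y : 'rV[R]_m | a < `|y|].
Proof.
apply: (@open_comp _ _ (fun y : 'rV[R]_m => `|y|) [set t | a < t]).
  by move=> y _; exact: norm_continuous.
exact: open_gt.
Qed.

Lemma closed_ball_compact (R : realType) m (a : R) : compact [set y : 'rV[R]_m | `|y| <= a].
Proof.
apply: bounded_closed_compact.
  by exists a; split; [exact: num_real|move=> b ab y /= ya; rewrite (le_trans ya)// ltW].
rewrite (_ : [set _ | _] = ~` [set y : 'rV[R]_m | a < `|y|]).
  exact/open_closedC/open_norm_gt.
by apply/seteqP; split=> y /=; rewrite leNgt => /negP.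
Qed.

Section bounded_support.
Context {R : realType} {m : nat}.

Lemma bsuppW (T : zmodType) (a b : R) (h : 'rV[R]_m -> T) : a <= b -> bsupp a h -> bsupp b h.
Proof. by move=> ab ha y by_; apply: ha; exact: le_lt_trans by_. Qed.

Lemma bsupp_partial i (a : R) (h : 'rV[R]_m -> R) : bsupp a h -> bsupp a (partial i h).
Proof.
move=> ha y ay.
rewrite (@partial_congr _ _ [set y : 'rV[R]_m | a < `|y|] h (fun=> 0))//.
  by rewrite /partial derive_cst.
exact: open_norm_gt.
Qed.

Lemma bsupp_partialC i (a : R) (h : 'rV[R]_m -> R[i]) : bsupp a h -> bsupp a (partialC i h).
Proof.
move=> ha y ay.
rewrite (@partialC_congr _ _ [set y : 'rV[R]_m | a < `|y|] h (fun=> 0))//.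
  exact: partialC_cst.
exact: open_norm_gt.
Qed.

Lemma bsupp_partialsC s (a : R) (h : 'rV[R]_m -> R[i]) : bsupp a h -> bsupp a (partialsC s h).
Proof.
by move=> ha; elim: s => [|i s IH]; [rewrite partialsC_nil|rewrite partialsC_cons; exact: bsupp_partialC].
Qed.

Lemma bsuppC_bounded (a : R) (h : 'rV[R]_m -> R[i]) : smoothC_on setT h -> bsupp a h ->
  exists2 M : R, 0 <= M & forall y, normc (h y) <= M.
Proof.
move=> sh ha.
have [M M0 MP] := smoothC_bounded (@closed_ball_compact R m a) (@subsetT _ _) sh.
exists M => // y; have [ya|ay] := leP `|y| a; first exact: MP.
by rewrite ha// normc0.
Qed.

Lemma bsupp_bounded (a : R) (h : 'rV[R]_m -> R) : smooth_on setT h -> bsupp a h ->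
  exists2 M : R, 0 <= M & forall y, `|h y| <= M.
Proof.
move=> sh ha; have [||M M0 MP] := @bsuppC_bounded a (fun y => (h y)%:C).
- exact: smoothC_on_real.
- by move=> y /ha ->.
by exists M => // y; rewrite -normc_real.
Qed.

Lemma bsupp_partial_bounded (a : R) (h : 'rV[R]_m -> R) : smooth_on setT h -> bsupp a h ->
  exists2 M : R, 0 <= M & forall i y, `|partial i h y| <= M.
Proof.
move=> sh ha.
have /choice [M MP] : forall i, exists M : R, 0 <= M /\ forall y, `|partial i h y| <= M.
  move=> i; have [M ? ?] := bsupp_bounded (smooth_on_partial i sh) (bsupp_partial i ha).
  by exists M.
have M0 i : 0 <= M i by have [] := MP i.
exists (\sum_i M i) => [|i y]; first by rewrite sumr_ge0.
by rewrite (le_trans ((MP i).2 y))// (bigD1 i)//= lerDl sumr_ge0.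
Qed.

Lemma bsupp_lipschitz (a : R) (h : 'rV[R]_m -> R) : smooth_on setT h -> bsupp a h ->
  exists2 M : R, 0 <= M & forall x y, `|h x - h y| <= M * `|x - y|.
Proof.
move=> sh ha; have [M M0 MP] := bsupp_partial_bounded sh ha.
exists (m%:R * M) => [|x y]; first by rewrite mulr_ge0.
exact: mean_value_bound.
Qed.

End bounded_support.

Definition slice (R : realType) k (h : 'rV[R]_k.+1 -> R) (t : R) : 'rV[R]_k -> R :=
  fun y => h (@row_mx R 1 1 k (const_mx t) y).

Section slices.
Context {R : realType} {k : nat}.
Implicit Types (h : 'rV[R]_k.+1 -> R) (y : 'rV[R]_k) (t : R).

Lemma norm_row_mx_ger t y : `|y| <= `|@row_mx R 1 1 k (const_mx t) y|.
Proof.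
apply: rV_norm_le => // j.
by have := rV_coord_le (@row_mx R 1 1 k (const_mx t) y) (rshift 1 j); rewrite row_mxEr.
Qed.

Lemma norm_row_mx_gel t y : `|t| <= `|@row_mx R 1 1 k (const_mx t) y|.
Proof.
by have := rV_coord_le (@row_mx R 1 1 k (const_mx t) y) (lshift k 0); rewrite row_mxEl mxE.
Qed.

Lemma row_mx_addl t s y : @row_mx R 1 1 k (const_mx (t + s)) y =
  @row_mx R 1 1 k (const_mx t) y + s *: delta_mx 0 (lshift k 0).
Proof.
apply/rowP => j; rewrite !mxE eqxx /=; case: splitP => i ji; rewrite ?mxE.
  have -> : j = lshift k 0 by apply: val_inj; rewrite /= ji ord1.
  by rewrite eqxx mulr1.
have /negbTE -> : j != lshift k 0 by rewrite -val_eqE/= ji.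
by rewrite mulr0 addr0.
Qed.

Lemma row_mx_addr t s y (i : 'I_k) : @row_mx R 1 1 k (const_mx t) (y + s *: delta_mx 0 i) =
  @row_mx R 1 1 k (const_mx t) y + s *: delta_mx 0 (rshift 1 i).
Proof.
apply/rowP => j; rewrite !mxE eqxx /=; case: splitP => i' ji; rewrite ?mxE.
  have /negbTE -> : j != rshift 1 i.
    by rewrite -val_eqE/= ji (ltn_eqF _)// ltn_addr.
  by rewrite mulr0 addr0.
have -> : j = rshift 1 i' by apply: val_inj; rewrite /= ji.
by rewrite (inj_eq (@rshift_inj _ _)).
Qed.

Lemma slice_smooth h t : smooth_on setT h -> smooth_on setT (slice h t).
Proof.
move=> sh; apply: (@smooth_on_comp _ _ _ _ setT (fun y => @row_mx R 1 1 k (const_mx t) y));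
  try exact: openT.
- by [].
- move=> j; apply: (@smooth_on_congr _ _ _ (fun y : 'rV[R]_k =>
    match fintype.split j with inl _ => t | inr i => y 0 i end)); first exact: openT.
    by move=> z _; rewrite mxE; case: fintype.splitP => i _; rewrite ?mxE.
  by case: fintype.splitP => i _; [exact: smooth_on_cst|exact: smooth_on_coord].
- exact: sh.
Qed.

Lemma slice_bsupp a h t : bsupp a h -> bsupp a (slice h t).
Proof. by move=> ha y ay; apply: ha; exact: lt_le_trans ay (norm_row_mx_ger t y). Qed.

Lemma slice_partial h t (i : 'I_k) : slice (partial (rshift 1 i) h) t = partial i (slice h t).
Proof.
apply/funext => y; rewrite /slice /partial -!derive_line0.
by congr derive; apply/funext => s; rewrite row_mx_addr.
Qed.

End slices.

Section iterated_integral.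
Context {R : realType}.

Lemma lipschitz_continuous (f : R -> R) (C : R) :
  (forall x y, `|f x - f y| <= C * `|x - y|) -> continuous f.
Proof.
move=> h x; apply/cvgrPdist_le => e e0.
have C1 : 0 < `|C| + 1 by rewrite ltr_wpDl.
near=> y; rewrite (le_trans (h x y))//.
have : `|x - y| < e / (`|C| + 1).
  by near: y; apply: cvgr_dist_lt => //; exact: divr_gt0.
rewrite ltr_pdivlMr// => /ltW xy.
apply: le_trans xy; rewrite mulrC ler_wpM2l//.
by rewrite (le_trans (ler_norm C))// lerDl.
Unshelve. all: by end_near. Qed.

Let additive_on n := forall (f g : 'rV[R]_n -> R) a, smooth_on setT f -> smooth_on setT g ->
  bsupp a f -> bsupp a g ->
  iterated_integral (fun y => f y + g y) = iterated_integral f + iterated_integral g.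

Let homogeneous_on n := forall (f : 'rV[R]_n -> R) (r : R) a, smooth_on setT f ->
  bsupp a f -> iterated_integral (fun y => r * f y) = r * iterated_integral f.

(** The function lives in the cube of centre [p] and side [2 * r], of volume [(2 * r) ^+ n]. *)
Let bounded_on n := forall (f : 'rV[R]_n -> R) p (r M : R), smooth_on setT f -> 0 <= r ->
  (forall y, r < `|y - p| -> f y = 0) -> (forall y, `|f y| <= M) ->
  `|iterated_integral f| <= M * (2 * r) ^+ n.

Let sub_on n : additive_on n -> homogeneous_on n ->
  forall (f g : 'rV[R]_n -> R) a, smooth_on setT f -> smooth_on setT g ->
  bsupp a f -> bsupp a g ->
  iterated_integral (fun y => f y - g y) = iterated_integral f - iterated_integral g.
Proof.
move=> hD hZ f g a sf sg fa ga.
rewrite -[- iterated_integral g]mulN1r -(hZ _ _ a sg ga) -(hD _ _ a sf _ fa).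
- by congr iterated_integral; apply/funext => y; rewrite mulN1r.
- exact: (smooth_onZ _ openT sg).
- by move=> y /ga ->; rewrite mulr0.
Qed.

Let bound0 n : bounded_on n -> forall (f : 'rV[R]_n -> R) (a M : R), smooth_on setT f ->
  0 <= a -> bsupp a f -> (forall y, `|f y| <= M) ->
  `|iterated_integral f| <= M * (2 * a) ^+ n.
Proof. by move=> hB f a M sf a0 fa fM; apply: (hB f 0) => // y; rewrite subr0; exact: fa. Qed.

(** A Lipschitz estimate for [f] passes to the integrals of its slices by linearity and the bound,
    both in dimension [n]. *)
Let slice_continuous n : additive_on n -> homogeneous_on n -> bounded_on n ->
  forall (f : 'rV[R]_n.+1 -> R) a, smooth_on setT f -> bsupp a f ->
  continuous (fun t => iterated_integral (slice f t)).
Proof.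
move=> hD hZ hB f a sf fa.
have [M M0 MP] := bsupp_lipschitz sf fa.
have b0 : 0 <= `|a| by [].
have fb : bsupp `|a| f by exact: bsuppW (ler_norm a) fa.
apply: (@lipschitz_continuous _ (M * (2 * `|a|) ^+ n)) => t s.
rewrite -(sub_on hD hZ (slice_smooth t sf) (slice_smooth s sf) (slice_bsupp t fa) (slice_bsupp s fa)).
rewrite mulrAC; apply: (bound0 hB) => // [|y ay|y].
- by apply: smooth_onB; [exact: openT|exact: slice_smooth|exact: slice_smooth].
- by rewrite !(slice_bsupp _ fb)// subr0.
- rewrite (le_trans (MP _ _))// ler_wpM2l//.
  rewrite -{1}(subrKC s t) row_mx_addl addrAC subrr add0r.
  by apply: rV_norm_le => // j; rewrite !mxE; case: (_ && _); rewrite ?mulr1 ?mulr0 ?normr0.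
Qed.

(** The three properties need a joint induction: in dimension [n.+1] each of them integrates slice
    integrals over the line, these must be continuous in [t], and [slice_continuous] derives that
    from all three properties in dimension [n]. *)
Let props n : [/\ additive_on n, homogeneous_on n & bounded_on n].
Proof.
elim: n => [|n [hD hZ hB]].
  split=> // f p r M sf r0 _ fM; by rewrite expr0 mulr1 /=.
have int0 : iterated_integral (fun _ : 'rV[R]_n => 0) = 0.
  have := hZ (fun=> 0) 0 0 (smooth_on_cst 0) (fun=> fun=> erefl).
  by rewrite !mul0r.
have supp (f : 'rV[R]_n.+1 -> R) (a : R) : bsupp a f ->
    forall t, t < - a \/ a < t -> iterated_integral (slice f t) = 0.
  move=> fa t ta.
  rewrite (_ : slice f t = fun=> 0) ?int0//.
  apply/funext => y; apply: fa; apply: lt_le_trans (norm_row_mx_gel t y).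
  by rewrite lter_normr; case: ta => [|->//]; rewrite ltrNr => ->; rewrite orbT.
have cont := slice_continuous hD hZ hB.
split.
- move=> f g a sf sg fa ga /=.
  rewrite -(@int1D _ _ _ (- a) a); [|exact: cont sf fa|exact: cont sg ga|exact: supp|exact: supp].
  congr Rintegral; apply/funext => t.
  exact: hD (slice_smooth t sf) (slice_smooth t sg) (slice_bsupp t fa) (slice_bsupp t ga).
- move=> f r a sf fa /=.
  rewrite -(@int1Z _ _ r (- a) a); [|exact: cont sf fa|exact: supp].
  congr Rintegral; apply/funext => t.
  exact: hZ (slice_smooth t sf) (slice_bsupp t fa).
- move=> f p r M sf r0 fr fM /=.
  pose p0 := p 0 (lshift n 0 : 'I_(1 + n)).
  pose p1 : 'rV[R]_n := \row_j p 0 (rshift 1 j : 'I_(1 + n)).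
  have fb : bsupp (`|p| + r) f.
    move=> y hy; apply: fr; rewrite -ltrBrDl in hy.
    by apply: lt_le_trans hy _; rewrite lerB_dist.
  have fr1 t y : r < `|y - p1| -> slice f t y = 0.
    move=> hy; apply: fr; apply: lt_le_trans hy _; apply: rV_norm_le => // j.
    have := rV_coord_le (@row_mx R 1 1 n (const_mx t) y - p) (rshift 1 j).
    by rewrite mxE row_mxEr !mxE.
  have fr0 t y : r < `|t - p0| -> slice f t y = 0.
    move=> hy; apply: fr; apply: lt_le_trans hy _.
    have := rV_coord_le (@row_mx R 1 1 n (const_mx t) y - p) (lshift n 0).
    by rewrite mxE row_mxEl !mxE.
  have -> : M * (2 * r) ^+ n.+1 = M * (2 * r) ^+ n * ((p0 + r) - (p0 - r)).
    by rewrite exprSr; ring.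
  apply: int1_bound.
  + exact: cont sf fb.
  + move=> t ht; rewrite (_ : (fun _ => _) = fun=> 0) ?int0//.
    apply/funext => y; apply: fr0.
    by rewrite lter_normr; case: ht => h; apply/orP; [right|left]; lra.
  + lra.
  + by move=> t; apply: (hB _ p1) => //; [exact: slice_smooth|exact: fr1].
Qed.

Lemma iterated_integralD n (f g : 'rV[R]_n -> R) a : smooth_on setT f -> smooth_on setT g ->
  bsupp a f -> bsupp a g ->
  iterated_integral (fun y => f y + g y) = iterated_integral f + iterated_integral g.
Proof. by have [h _ _] := props n; exact: h. Qed.

Lemma iterated_integralZ n (f : 'rV[R]_n -> R) (r : R) a : smooth_on setT f ->
  bsupp a f -> iterated_integral (fun y => r * f y) = r * iterated_integral f.
Proof. by have [_ h _] := props n; exact: h. Qed.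

Lemma iterated_integral_bound n (f : 'rV[R]_n -> R) p (r M : R) : smooth_on setT f -> 0 <= r ->
  (forall y, r < `|y - p| -> f y = 0) -> (forall y, `|f y| <= M) ->
  `|iterated_integral f| <= M * (2 * r) ^+ n.
Proof. by have [_ _ h] := props n; exact: h. Qed.

Lemma iterated_integralB n (f g : 'rV[R]_n -> R) a : smooth_on setT f -> smooth_on setT g ->
  bsupp a f -> bsupp a g ->
  iterated_integral (fun y => f y - g y) = iterated_integral f - iterated_integral g.
Proof. by have [hD hZ _] := props n; exact: sub_on. Qed.

Lemma iterated_integral0 n : iterated_integral (fun _ : 'rV[R]_n => 0) = 0.
Proof.
have := @iterated_integralZ n (fun=> 0) 0 0 (smooth_on_cst 0) (fun=> fun=> erefl).
by rewrite !mul0r.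
Qed.

(** Differentiation under the integral: the mean value theorem and a Lipschitz constant [M] of the
    partial derivative bound the remainder of the slices by [M * s ^ 2], uniformly. The bound on
    integrals carries this over to [is_derive_quadratic]. *)
Lemma iterated_integral_slice_derive n (f : 'rV[R]_n.+1 -> R) a (t : R) :
  smooth_on setT f -> bsupp a f ->
  is_derive t 1 (fun t => iterated_integral (slice f t))
    (iterated_integral (slice (partial (lshift n 0 : 'I_(1 + n)) f) t)).
Proof.
move=> sf fa; pose g := partial (lshift n 0 : 'I_(1 + n)) f.
have sg : smooth_on setT g by exact: smooth_on_partial.
have ga : bsupp a g by exact: bsupp_partial.
have [M M0 MP] := bsupp_lipschitz sg ga.
have fb : bsupp `|a| f by exact: bsuppW (ler_norm a) fa.
have gb : bsupp `|a| g by exact: bsuppW (ler_norm a) ga.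
apply: (@is_derive_quadratic _ _ _ _ (M * (2 * `|a|) ^+ n)) => s.
have ss := slice_smooth (t + s) sf; have st := slice_smooth t sf.
have sgt := slice_smooth t sg.
have bs := slice_bsupp (t + s) fb; have bt := slice_bsupp t fb.
have bgt := slice_bsupp t gb.
rewrite -(iterated_integralB ss st bs bt) -(iterated_integralZ s sgt bgt).
have s1 : smooth_on setT (fun y => slice f (t + s) y - slice f t y).
  exact: (smooth_onB openT ss st).
have s2 : smooth_on setT (fun y => s * slice g t y).
  exact: (smooth_onZ _ openT sgt).
have b1 : bsupp `|a| (fun y => slice f (t + s) y - slice f t y).
  by move=> y ay; rewrite bs// bt// subr0.
have b2 : bsupp `|a| (fun y => s * slice g t y).
  by move=> y ay; rewrite bgt// mulr0.
rewrite -(iterated_integralB s1 s2 b1 b2) mulrAC.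
apply: (iterated_integral_bound (p := 0) (smooth_onB openT s1 s2) (normr_ge0 a)) => [y|y].
  by rewrite subr0 => ay; rewrite b1// b2// subr0.
rewrite /slice row_mx_addl.
have [|s' ss' ->] := @mean_value_line R (1 + n) f (@row_mx R 1 1 n (const_mx t) y)
    (delta_mx 0 (lshift n 0 : 'I_(1 + n))) s.
  by move=> s' _; exact: smooth_on_derivable sf _.
rewrite -mulrBr normrM -[s ^+ 2]real_normK ?num_real// expr2 mulrCA ler_wpM2l//.
rewrite (le_trans (MP _ _))// ler_wpM2l// addrAC subrr add0r (le_trans _ ss')//.
apply: rV_norm_le => // j; rewrite !mxE.
by case: (_ && _); rewrite ?mulr1 ?mulr0 ?normr0.
Qed.

Lemma iterated_integral_partial n (f : 'rV[R]_n -> R) a i :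
  smooth_on setT f -> bsupp a f -> iterated_integral (partial i f) = 0.
Proof.
elim: n f i => [|n IH] f i sf fa; first by case: i.
(* For the outermost variable the fundamental theorem of calculus applies between two points outside
   the support; for the other variables every slice integral vanishes by induction. *)
case: (@fintype.split_ordP 1 n i) => j ->; rewrite /=.
  have gb : bsupp `|a| (partial (lshift n 0 : 'I_(1 + n)) f).
    by apply: bsupp_partial; exact: bsuppW (ler_norm a) fa.
  have sg := smooth_on_partial (lshift n 0 : 'I_(1 + n)) sf.
  have dD (t : R) := iterated_integral_slice_derive t sf fa.
  (* One is added so that the interval is nondegenerate and its ends lie strictly outside the
     support. *)
  have ab : - (`|a| + 1) < `|a| + 1 by have := normr_ge0 a; lra.
  have [hD hZ hB] := props n.
  have cg := slice_continuous hD hZ hB sg gb.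
  rewrite [j]ord1.
  rewrite [LHS](int1_derive ab dD cg).
  - have z b : `|b| = `|a| + 1 -> iterated_integral (slice f b) = 0.
      move=> hb; rewrite (_ : slice f b = fun=> 0) ?iterated_integral0//.
      apply/funext => y; apply: fa; apply: lt_le_trans (norm_row_mx_gel b y).
      by rewrite hb (le_lt_trans (ler_norm a))// ltrDl.
    by rewrite !z ?subr0// ?normrN ger0_norm// addr_ge0.
  - move=> t ht; rewrite (_ : slice _ t = fun=> 0) ?iterated_integral0//.
    apply/funext => y; apply: gb; apply: lt_le_trans (norm_row_mx_gel t y).
    by rewrite lter_normr; case: ht => h; apply/orP; [right|left]; have := normr_ge0 a; lra.
rewrite (_ : (fun t => _) = fun=> 0); last first.
  apply/funext => t.
  have := IH (slice f t) j (slice_smooth t sf) (slice_bsupp t fa).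
  by rewrite -slice_partial.
by rewrite /Rintegral integral0.
Qed.

Lemma norm_gt_coord m (y : 'rV[R]_m) (a : R) : 0 <= a -> a < `|y| -> exists i, a < `|y 0 i|.
Proof.
move=> a0 ay; apply: contrapT => h; move: ay; rewrite ltNge => /negP; apply.
apply: rV_norm_le => // i; rewrite leNgt; apply/negP => hi; apply: h; by exists i.
Qed.

Lemma derivative_seq_continuous (phi : nat -> R -> R) k :
  derivative_seq setT phi -> continuous (phi k).
Proof.
move=> h t; apply: differentiable_continuous; apply/derivable1_diffP.
by have := h k t I => ?; exact: ex_derive.
Qed.

Lemma prod_smooth n (phi : 'I_n -> nat -> R -> R) V : open V ->
  (forall i, derivative_seq setT (phi i)) ->
  smooth_on V (fun y : 'rV[R]_n => \prod_i phi i 0%N (y 0 i)).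
Proof.
move=> oV dphi; apply: smooth_on_prod => // i.
by apply: (smooth_on_comp1 0 (dphi i)) => //; exact: smooth_on_coord.
Qed.

Lemma prod_bsupp n (phi : 'I_n -> R -> R) (a : R) : 0 <= a ->
  (forall i t, a < `|t| -> phi i t = 0) ->
  bsupp a (fun y : 'rV[R]_n => \prod_i phi i (y 0 i)).
Proof.
move=> a0 phi0 y ay; have [i ai] := norm_gt_coord a0 ay.
by rewrite (bigD1 i)//= phi0// mul0r.
Qed.

(** Only the first factor depends on the outer integration variable, so homogeneity in dimension [n]
    pulls it out of the inner integral. *)
Lemma iterated_integral_prod n (phi : 'I_n -> nat -> R -> R) (a : R) : 0 <= a ->
  (forall i, derivative_seq setT (phi i)) -> (forall i t, a < `|t| -> phi i 0%N t = 0) ->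
  iterated_integral (fun y => \prod_i phi i 0%N (y 0 i)) =
  \prod_i Rintegral (@lebesgue_measure R) setT (phi i 0%N).
Proof.
move=> a0; elim: n phi => [|n IH] phi dphi phi0; first by rewrite !big_ord0 /= big_ord0.
rewrite [RHS]big_ord_recl -(IH (fun i => phi (lift ord0 i)) (fun i => dphi _) (fun i => phi0 _)) [RHS]mulrC.
rewrite -(@int1Z _ _ _ (- a) a); last 2 first.
- exact: derivative_seq_continuous.
- move=> t ht; apply: phi0; rewrite lter_normr.
  by case: ht => [|->//]; rewrite ltrNr => ->; rewrite orbT.
rewrite [LHS]/=; congr Rintegral; apply/funext => t; rewrite [RHS]mulrC.
rewrite -(iterated_integralZ _ (prod_smooth openT (fun i => dphi (lift ord0 i)))
  (prod_bsupp a0 (fun i => phi0 (lift ord0 i)))).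
congr iterated_integral; apply/funext => y; rewrite big_ord_recl; congr (_ * _).
  congr (phi _ _ _); transitivity ((const_mx t : 'M[R]_1) 0 0); last by rewrite mxE.
  rewrite -(@row_mxEl R 1 1 n (const_mx t) y).
  by congr (row_mx _ _ _ _); exact: val_inj.
apply: eq_bigr => i _; congr (phi _ _ _); rewrite -(@row_mxEr R 1 1 n (const_mx t) y).
by congr (row_mx _ _ _ _); exact: val_inj.
Qed.

End iterated_integral.

Definition cintegral (R : realType) n (h : 'rV[R]_n -> R[i]) : R[i] :=
  iterated_integral (fun y => complex.Re (h y)) +i* iterated_integral (fun y => complex.Im (h y)).

Section complex_integral.
Context {R : realType} {n : nat}.
Implicit Types f g : 'rV[R]_n -> R[i].

Lemma bsupp_Re a f : bsupp a f -> bsupp a (fun y => complex.Re (f y)).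
Proof. by move=> fa y /fa ->. Qed.

Lemma bsupp_Im a f : bsupp a f -> bsupp a (fun y => complex.Im (f y)).
Proof. by move=> fa y /fa ->. Qed.

Lemma bsupp_mulr a f g : bsupp a g -> bsupp a (fun y => f y * g y).
Proof. by move=> ga y /ga ->; rewrite mulr0. Qed.

Lemma bsupp_mull a f g : bsupp a f -> bsupp a (fun y => f y * g y).
Proof. by move=> fa y /fa ->; rewrite mul0r. Qed.

Lemma cintegralD f g a : smoothC_on setT f -> smoothC_on setT g -> bsupp a f -> bsupp a g ->
  cintegral (fun y => f y + g y) = cintegral f + cintegral g.
Proof.
move=> [fr fi] [gr gi] fa ga; apply: complex_ext => /=.
  rewrite -(iterated_integralD fr gr (bsupp_Re fa) (bsupp_Re ga)).
  by congr iterated_integral; apply/funext => y; rewrite ReD.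
rewrite -(iterated_integralD fi gi (bsupp_Im fa) (bsupp_Im ga)).
by congr iterated_integral; apply/funext => y; rewrite ImD.
Qed.

Lemma cintegralZ f (r : R[i]) a : smoothC_on setT f -> bsupp a f ->
  cintegral (fun y => r * f y) = r * cintegral f.
Proof.
move=> [fr fi] fa; have far := bsupp_Re fa; have fai := bsupp_Im fa.
have Z (s : R) (h : 'rV[R]_n -> R) : smooth_on setT h -> bsupp a h ->
    smooth_on setT (fun y => s * h y) /\ bsupp a (fun y => s * h y).
  move=> sh ha; split; first exact: (smooth_onZ _ openT sh).
  by move=> y /ha ->; rewrite mulr0.
have [? ?] := Z (complex.Re r) _ fr far; have [? ?] := Z (complex.Im r) _ fr far.
have [? ?] := Z (complex.Re r) _ fi fai; have [? ?] := Z (complex.Im r) _ fi fai.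
apply: complex_ext; rewrite ?ReM ?ImM /=.
  rewrite -(iterated_integralZ _ fr far) -(iterated_integralZ _ fi fai).
  rewrite -(@iterated_integralB _ _ _ _ a)//.
  by congr iterated_integral; apply/funext => y; rewrite ReM.
rewrite -(iterated_integralZ _ fr far) -(iterated_integralZ _ fi fai).
rewrite -(@iterated_integralD _ _ _ _ a)//.
by congr iterated_integral; apply/funext => y; rewrite ImM.
Qed.

Lemma cintegral0 : cintegral (fun _ : 'rV[R]_n => 0) = 0.
Proof. by apply: complex_ext; exact: iterated_integral0. Qed.

Lemma cintegralB f g a : smoothC_on setT f -> smoothC_on setT g -> bsupp a f -> bsupp a g ->
  cintegral (fun y => f y - g y) = cintegral f - cintegral g.
Proof.
move=> sf sg fa ga; rewrite -[- cintegral g]mulN1r -(cintegralZ _ sg ga).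
rewrite -(cintegralD sf (smoothC_onZ (-1) openT sg) fa (bsupp_mulr _ ga)).
by congr cintegral; apply/funext => y; rewrite mulN1r.
Qed.

Lemma cintegral_sum I (r : seq I) (F : I -> 'rV[R]_n -> R[i]) a :
  (forall i, smoothC_on setT (F i)) -> (forall i, bsupp a (F i)) ->
  cintegral (fun y => \sum_(i <- r) F i y) = \sum_(i <- r) cintegral (F i).
Proof.
move=> sF Fa; elim: r => [|i r IH].
  rewrite big_nil -[RHS]cintegral0; congr cintegral.
  by apply/funext => y; rewrite big_nil.
rewrite big_cons -IH -(@cintegralD _ _ a)//.
- by congr cintegral; apply/funext => y; rewrite big_cons.
- exact: (smoothC_on_sum _ openT sF).
- by move=> y ay; rewrite big1// => j _; exact: Fa.
Qed.

Lemma cintegral_bound f p (r M : R) : smoothC_on setT f -> 0 <= r ->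
  (forall y, r < `|y - p| -> f y = 0) -> (forall y, normc (f y) <= M) ->
  normc (cintegral f) <= 2 * M * (2 * r) ^+ n.
Proof.
move=> [fr fi] r0 fp fM; rewrite (le_trans (ler_normc_ReIm _))//=.
rewrite (_ : 2 * M * _ = M * (2 * r) ^+ n + M * (2 * r) ^+ n); last by ring.
apply: lerD; apply: (iterated_integral_bound (p := p)) => //.
- by move=> y /fp ->.
- by move=> y; exact: le_trans (ler_Re_normc _) (fM y).
- by move=> y /fp ->.
- by move=> y; exact: le_trans (ler_Im_normc _) (fM y).
Qed.

Lemma cintegral_partialC f a i : smoothC_on setT f -> bsupp a f -> cintegral (partialC i f) = 0.
Proof.
move=> [fr fi] fa; rewrite /cintegral/partialC/=.
by rewrite (iterated_integral_partial _ fr (bsupp_Re fa)) (iterated_integral_partial _ fi (bsupp_Im fa)).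
Qed.

Lemma integration_by_parts_partialC f g a i : smoothC_on setT f -> smoothC_on setT g ->
  bsupp a g ->
  cintegral (fun y => partialC i f y * g y) = - cintegral (fun y => f y * partialC i g y).
Proof.
move=> sf sg ga; apply/eqP; rewrite -addr_eq0; apply/eqP.
have sf' := smoothC_on_partialC i sf; have sg' := smoothC_on_partialC i sg.
rewrite -(@cintegralD _ _ a).
- rewrite -[RHS](@cintegral_partialC (fun y => f y * g y) a i).
  + by congr cintegral; apply/funext => y; rewrite (partialCM _ (I : setT y) sf sg).
  + exact: (smoothC_onM openT sf sg).
  + exact: bsupp_mulr.
- exact: (smoothC_onM openT sf' sg).
- exact: (smoothC_onM openT sf sg').
- exact: bsupp_mulr.
- exact/bsupp_mulr/bsupp_partialC.
Qed.

(** Derivatives are taken from the outside of [f] and put on the inside of [g], hence the reversed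
    order. Boundary terms vanish because of the support of [g]. *)
Lemma integration_by_parts_partialsC f g a s : smoothC_on setT f -> smoothC_on setT g ->
  bsupp a g ->
  cintegral (fun y => partialsC s f y * g y) =
  (-1) ^+ size s * cintegral (fun y => f y * partialsC (rev s) g y).
Proof.
move=> sf + +; elim: s g => [|i s IH] g sg ga.
  rewrite mul1r; congr cintegral; apply/funext => y.
  by rewrite /rev /= !partialsC_nil.
have -> : (fun y => partialsC (i :: s) f y * g y) = (fun y => partialC i (partialsC s f) y * g y).
  by [].
rewrite (integration_by_parts_partialC i (smoothC_on_partialsC s sf) sg ga).
rewrite IH; [|exact: smoothC_on_partialC|exact: bsupp_partialC].
by rewrite -mulNr exprS mulN1r rev_cons partialsC_rcons.
Qed.

End complex_integral.

(** * Cutoff functions and mollifiers *)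

Section flat_functions.
Context {R : realType}.

(** The functions [p (1 / t) * exp (- 1 / t)], extended by 0. As [p] varies they are closed under
    differentiation: the derivative belongs to the polynomial [X ^ 2 * (p - p')], a rule that
    [flat_poly] iterates from 1. *)
Definition flat (p : {poly R}) (t : R) : R :=
  if 0 < t then p.[t^-1] * expR (- t^-1) else 0.

(** Each monomial is dominated through [1 + x ^ n / n! <= exp x]. *)
Lemma poly_expR_bound (p : {poly R}) :
  exists2 C : R, 0 <= C & forall x, 0 <= x -> `|p.[x]| * expR (- x) <= C.
Proof.
exists (\sum_(i < size p) `|p`_i| * (i`!%:R + 1)) => [|x x0].
  by rewrite sumr_ge0// => i _; rewrite mulr_ge0// addr_ge0.
rewrite horner_coef.
apply: (@le_trans _ _ ((\sum_(i < size p) `|p`_i * x ^+ i|) * expR (- x))).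
  by rewrite ler_wpM2r ?expR_ge0// ler_norm_sum.
rewrite mulr_suml ler_sum// => i _; rewrite normrM -mulrA ler_wpM2l//.
rewrite normrX (ger0_norm x0) expRN ler_pdivrMr ?expR_gt0//.
case: {i}(nat_of_ord i) => [|k].
  rewrite expr0 (le_trans _ (ler_peMr _ _))// ?lerDr// ?addr_ge0//.
  by rewrite -expR0 ler_expR.
have := expR_ge1Dxn k x0; rewrite -(ler_pM2l (x := (k.+1)`!%:R)) ?ltr0n ?fact_gt0//.
move=> h; apply: le_trans (le_trans h _).
  by rewrite mulrDr mulrCA mulfV ?mulr1 ?lerDr ?ler0n// pnatr_eq0 -lt0n fact_gt0.
by rewrite ler_wpM2r ?expR_ge0// lerDl.
Qed.

(** Bounding [p * X ^ 2] instead of [p] buys the factor [t ^ 2], which yields derivative 0 at the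
    origin through [is_derive_quadratic]. *)
Lemma flat_bound p : exists C, forall t, `|flat p t| <= C * t ^+ 2.
Proof.
have [C C0 CP] := poly_expR_bound (p * 'X^2).
exists C => t; rewrite /flat; case: ifPn => t0; last by rewrite normr0 mulr_ge0 ?sqr_ge0.
have ti : 0 <= t^-1 by rewrite invr_ge0 ltW.
have := CP _ ti; rewrite hornerM hornerXn !normrM (ger0_norm (expR_ge0 _)).
by rewrite (ger0_norm ti) -expr2 exprVn mulrAC ler_pdivrMr ?exprn_gt0.
Qed.

Lemma flat_derive p (t : R) : is_derive t 1 (flat p) (flat ('X^2 * (p - deriv p)) t).
Proof.
have [t0|t0|->] := ltgtP t 0.
- have E : \forall x \near t, 0 = flat p x.
    near=> x; rewrite /flat ifF//; apply/negbTE; rewrite -leNgt; apply: ltW.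
    by near: x; exact: lt_nbhsl.
  apply: (near_eq_is_derive E); rewrite /flat ltNge (ltW t0)/=.
  exact: is_derive_cst.
- have E : \forall x \near t, p.[x^-1] * expR (- x^-1) = flat p x.
    near=> x; rewrite /flat ifT//.
    by near: x; exact: lt_nbhsr.
  apply: (near_eq_is_derive E); rewrite /flat t0.
  have tn0 : t != 0 by rewrite gt_eqF.
  have dV : is_derive t 1 (fun x : R => x^-1) (- t ^- 2).
    apply: is_derive_eq (@is_deriveV R id t 1 1 tn0 _) _.
    by rewrite /GRing.scale/= mulr1.
  have d1 : is_derive t 1 (horner p \o (fun x : R => x^-1)) ((deriv p).[t^-1] * (- t ^- 2)).
    by apply: is_derive1_comp; exact: is_derive_poly.
  have dN : is_derive t 1 (fun x : R => - x^-1) (t ^- 2).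
    by apply: is_derive_eq (is_deriveN _) _; rewrite opprK.
  have d2 : is_derive t 1 (expR \o (fun x : R => - x^-1)) (expR (- t^-1) * t ^- 2).
    by apply: is_derive1_comp; exact: is_derive_expR.
  apply: is_derive_eq (is_deriveM _ _) _.
  rewrite hornerM hornerXn hornerD hornerN -!exprVn.
  rewrite -![_ *: _]/(_ * _).
  set a := t^-1; set b := p.[a]; set c := (deriv p).[a]; set d := expR _.
  clearbody b c d; ring.
have [C CP] := flat_bound p.
have f0 q : flat q 0 = 0 by rewrite /flat ltxx.
rewrite f0; apply: (@is_derive_quadratic _ _ _ _ C) => s.
by rewrite add0r f0 mulr0 !subr0.
Unshelve. all: by end_near. Qed.

Definition flat_poly (n : nat) : {poly R} := iter n (fun p => 'X^2 * (p - deriv p)) 1.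

Definition bump_seq (n : nat) : R -> R := flat (flat_poly n).

Lemma bump_derivative_seq : derivative_seq setT bump_seq.
Proof. by move=> n t _; exact: flat_derive. Qed.

Lemma bump_gt0 t : 0 < t -> 0 < bump_seq 0 t.
Proof. by move=> t0; rewrite /bump_seq /flat t0 hornerC mul1r expR_gt0. Qed.

Lemma bump_le0 t : t <= 0 -> bump_seq 0 t = 0.
Proof. by rewrite /bump_seq /flat ltNge => ->. Qed.

Lemma bump_ge0 t : 0 <= bump_seq 0 t.
Proof.
by have [/bump_le0 ->//|/bump_gt0/ltW] := leP t 0.
Qed.

End flat_functions.

Section smooth_inverse.
Context {R : realType} {m : nat}.
Implicit Types (V : set 'rV[R]_m).

Lemma smooth_onV V (f : 'rV[R]_m -> R) : open V -> (forall y, V y -> f y != 0) ->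
  smooth_on V f -> smooth_on V (fun y => (f y)^-1).
Proof.
move=> oV f0 /smooth_onP sf; apply/smooth_onP.
have dV y i : V y -> is_derive y (delta_mx 0 i) (fun z => (f z)^-1)
    (- 1 * (partial i f y * ((f y)^-1 * (f y)^-1))).
  move=> Vy; have [_ [df _]] := sf 1%N.
  have h : derivable f y (delta_mx 0 i) by exact: df.
  apply: DeriveDef; first exact: (derivableV (f0 y Vy) h).
  rewrite (deriveV (f0 y Vy) h) /GRing.scale/= /partial -exprVn.
  by rewrite mulN1r expr2 mulNr [in RHS]mulrC.
have cV y : V y -> {for y, continuous (fun z => (f z)^-1)}.
  move=> Vy; apply: (@continuous_comp _ _ _ f (fun t : R => t^-1)).
    by case: (sf 0%N) => cf _; exact: cf.
  exact: inv_continuous (f0 _ Vy).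
elim=> [|n IH]; split=> //; split=> [y i /(dV y i) h|i]; first exact: ex_derive.
apply: (@Ck_congr _ _ _ _ (fun y => - 1 * (partial i f y * ((f y)^-1 * (f y)^-1)))) => //.
  by move=> y /(dV y i) h; rewrite /partial derive_val.
apply: CkM => //; first exact: Ck_cst.
apply: CkM => //; last exact: CkM.
by have [_ [_]] := sf n.+1; exact.
Qed.

Lemma smoothC_onV V (f : 'rV[R]_m -> R[i]) : open V -> (forall y, V y -> f y != 0) ->
  smoothC_on V f -> smoothC_on V (fun y => (f y)^-1).
Proof.
move=> oV f0 [fr fi].
pose d y := complex.Re (f y) * complex.Re (f y) + complex.Im (f y) * complex.Im (f y).
have sd : smooth_on V d by exact: (smooth_onD oV (smooth_onM oV fr fr) (smooth_onM oV fi fi)).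
have d0 y : V y -> d y != 0.
  move=> Vy; apply: contra (f0 y Vy); rewrite /d -!expr2 paddr_eq0 ?sqr_ge0//.
  by rewrite !expf_eq0/=; case: (f y) => a b /=; rewrite eq_complex.
have sdi := smooth_onV oV d0 sd.
split.
  apply: (smooth_on_congr oV _ (smooth_onM oV fr sdi)) => y _.
  by rewrite /d; case: (f y) => a b /=; rewrite !expr2.
apply: (smooth_on_congr oV _ (smooth_onN oV (smooth_onM oV fi sdi))) => y _.
by rewrite /d; case: (f y) => a b /=; rewrite !expr2.
Qed.

End smooth_inverse.

Section step_function.
Context {R : realType}.

(** The quotient is smooth because [t] and [1 - t] are never both nonpositive, so the denominator is
    positive everywhere. *)
Definition step (t : R) : R := bump_seq 0 t / (bump_seq 0 t + bump_seq 0 (1 - t)).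

Lemma step_denominator_gt0 (t : R) : 0 < bump_seq 0 t + bump_seq 0 (1 - t).
Proof.
have [t0|t0] := ltP 0 t; first by rewrite ltr_wpDr ?bump_ge0// bump_gt0.
by rewrite ltr_wpDl ?bump_ge0// bump_gt0//; lra.
Qed.

Lemma step_le0 (t : R) : t <= 0 -> step t = 0.
Proof. by move=> t0; rewrite /step bump_le0// mul0r. Qed.

Lemma step_ge1 (t : R) : 1 <= t -> step t = 1.
Proof.
move=> t1; have := step_denominator_gt0 t.
rewrite /step [bump_seq 0 (1 - t)]bump_le0 ?addr0; last by lra.
by move=> h; rewrite divff// gt_eqF.
Qed.

Lemma step_ge0 (t : R) : 0 <= step t.
Proof. by rewrite divr_ge0 ?bump_ge0// ltW// step_denominator_gt0. Qed.

Lemma step_le1 (t : R) : step t <= 1.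
Proof. by rewrite ler_pdivrMr ?step_denominator_gt0// mul1r lerDl bump_ge0. Qed.

Lemma smooth_on_step m (V : set 'rV[R]_m) f : open V -> smooth_on V f ->
  smooth_on V (fun y => step (f y)).
Proof.
move=> oV sf.
have sb g : smooth_on V g -> smooth_on V (fun y => bump_seq 0 (g y)).
  by move=> sg; apply: (smooth_on_comp1 0 bump_derivative_seq).
have s1 : smooth_on V (fun y => bump_seq 0 (1 - f y)).
  exact: (sb _ (smooth_onB oV (smooth_on_cst 1) sf)).
have sd := smooth_onD oV (sb _ sf) s1.
apply: (smooth_onM oV (sb _ sf)); apply: (smooth_onV oV _ sd) => y _.
by rewrite gt_eqF// step_denominator_gt0.
Qed.

(** A function of one variable is viewed as a function on rows of length 1, so that the compactness
    bounds obtained for [partials] yield bounds on its derivatives. *)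
Definition derivatives (g : R -> R) (n : nat) (t : R) : R :=
  partials (nseq n ord0) (fun y : 'rV[R]_1 => g (y 0 0)) (const_mx t).

Lemma derivatives0 g t : derivatives g 0 t = g t.
Proof. by rewrite /derivatives /= mxE. Qed.

Lemma derivatives_seq g : smooth_on setT (fun y : 'rV[R]_1 => g (y 0 0)) ->
  derivative_seq setT (derivatives g).
Proof.
move=> sg n t _; pose h := partials (nseq n ord0) (fun y : 'rV[R]_1 => g (y 0 0)).
have sh : smooth_on setT h by exact: smooth_on_partials.
have e : derivatives g n = fun s => h (0 + s *: delta_mx 0 0).
  apply/funext => s; rewrite /derivatives; congr (h _).
  by apply/rowP => i; rewrite !mxE ord1 !eqxx add0r mulr1.
have e' : const_mx t = 0 + t *: delta_mx 0 0 :> 'rV[R]_1.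
  by apply/rowP => i; rewrite !mxE ord1 !eqxx add0r mulr1.
rewrite e; apply: DeriveDef.
  by apply/(derivable_line h 0 _ t); exact: smooth_on_derivable sh _.
by rewrite (derive_line h) /derivatives /= e'.
Qed.

Lemma derivatives_bounded g (a : R) n : smooth_on setT (fun y : 'rV[R]_1 => g (y 0 0)) ->
  (forall t, a < `|t| -> g t = 0) ->
  (exists2 C, 0 <= C & forall t, `|derivatives g n t| <= C) /\
  (forall t, a < `|t| -> derivatives g n t = 0).
Proof.
move=> sg ga.
have b0 : bsupp a (fun y : 'rV[R]_1 => g (y 0 0)).
  move=> y ay; apply: ga; apply: lt_le_trans ay _.
  by apply: rV_norm_le => // i; rewrite ord1.
have b : bsupp a (partials (nseq n ord0) (fun y : 'rV[R]_1 => g (y 0 0))).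
  by elim: n => //= n IH; exact: bsupp_partial.
split.
  have [C C0 CP] := bsupp_bounded (smooth_on_partials _ sg) b.
  by exists C => // t; exact: CP.
move=> t at_; apply: b; apply: lt_le_trans at_ _.
by have := rV_coord_le (const_mx t : 'rV[R]_1) 0; rewrite mxE.
Qed.

Lemma derivative_seq_scale (phi : nat -> R -> R) (c d : R) :
  derivative_seq setT phi -> derivative_seq setT (fun n t => c ^+ n * phi n (c * t + d)).
Proof.
move=> dphi n t _.
have h := dphi n (c * t + d) I.
have dl : is_derive t 1 (fun s : R => c * s + d) c.
  by apply: is_derive_eq (is_deriveD _ _) _; rewrite /= addr0 [_ *: _]mulr1.
have dc : is_derive t 1 (phi n \o (fun s : R => c * s + d)) (phi n.+1 (c * t + d) * c).
  exact: is_derive1_comp.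
have -> : (fun s => c ^+ n * phi n (c * s + d)) = (c ^+ n) \*: (phi n \o (fun s : R => c * s + d)) by [].
apply: is_derive_eq (is_deriveZ _ _) _; rewrite -[_ *: _]/(_ * _).
by rewrite exprSr; ring.
Qed.

End step_function.

Lemma is_derive_line0 (R : realType) m (f : 'rV[R]_m -> R) x v d :
  is_derive (0 : R) 1 (fun s : R => f (x + s *: v)) d -> is_derive x v f d.
Proof.
move=> [h1 h2]; apply: DeriveDef; first exact: (derivable_line0 f x v).1.
by rewrite -h2 derive_line0.
Qed.

Section mollifier.
Context {R : realType}.

(** As [step] goes from 0 to 1 over the unit interval, its derivative is supported there and has
    integral 1: a mollifier with an explicit primitive. *)
Definition step' : R -> R := derivatives (@step R) 1.

Let smooth_step1 : smooth_on setT (fun y : 'rV[R]_1 => step (y 0 0)).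
Proof. by apply: smooth_on_step; [exact: openT|exact: smooth_on_coord]. Qed.

Let step'E : (fun y : 'rV[R]_1 => step' (y 0 0)) = partial ord0 (fun y : 'rV[R]_1 => step (y 0 0)).
Proof.
apply/funext => y; rewrite /step' /derivatives /=; congr partial.
by apply/rowP => i; rewrite mxE ord1.
Qed.

Let smooth_step' : smooth_on setT (fun y : 'rV[R]_1 => step' (y 0 0)).
Proof. by rewrite step'E; exact: smooth_on_partial. Qed.

Lemma step_derive (t : R) : is_derive t 1 step (step' t).
Proof.
have : is_derive t 1 (derivatives step 0) (step' t) := derivatives_seq smooth_step1 0 I.
by rewrite (_ : derivatives step 0 = step)//; apply/funext => s; exact: derivatives0.
Qed.

Lemma step'_out (t : R) : t < 0 \/ 1 < t -> step' t = 0.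
Proof.
have h (V : set 'rV[R]_1) (a : R) : open V -> V (const_mx t) ->
    (forall y, V y -> step (y 0 0) = a) -> step' t = 0.
  move=> oV Vt e; rewrite /step' /derivatives /=.
  by rewrite (partial_congr _ oV Vt (g := fun=> a))// /partial derive_cst.
case=> ht.
  apply: (h [set y | y 0 0 < 0] 0); last by move=> y /= /ltW; exact: step_le0.
    apply: (@open_comp _ _ (fun y : 'rV[R]_1 => y 0 0) [set s | s < 0]); last exact: open_lt.
    by move=> y _; exact: coord_continuous.
  by rewrite /= mxE.
apply: (h [set y | 1 < y 0 0] 1); last by move=> y /= /ltW; exact: step_ge1.
  apply: (@open_comp _ _ (fun y : 'rV[R]_1 => y 0 0) [set s | 1 < s]); last exact: open_gt.
  by move=> y _; exact: coord_continuous.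
by rewrite /= mxE.
Qed.

Let step'_out1 (t : R) : 1 < `|t| -> step' t = 0.
Proof. by rewrite lter_normr => /orP[] h; apply: step'_out; [right|left; lra]. Qed.

(** The [n]-th derivative of the rescaled mollifier [c * step' (c * t)], which lives on the scale
    [c^-1]. *)
Definition kernel (c : R) (n : nat) (t : R) : R := c ^+ n.+1 * derivatives step' n (c * t).

Lemma kernel_seq c : derivative_seq setT (kernel c).
Proof.
move=> n t _; have h : is_derive t 1 (fun t => c ^+ n * derivatives step' n (c * t + 0))
    (c ^+ n.+1 * derivatives step' n.+1 (c * t + 0)).
  exact: (derivative_seq_scale c 0 (derivatives_seq smooth_step') n I).
have -> : kernel c n = c \*: (fun t => c ^+ n * derivatives step' n (c * t + 0)).
  by apply/funext => s /=; rewrite -[_ *: _]/(_ * _) mulrA -exprS addr0.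
apply: is_derive_eq (is_deriveZ _ _) _.
by rewrite -[_ *: _]/(_ * _) mulrA -exprS addr0.
Qed.

Lemma kernel_bound c n : exists2 C, 0 <= C & forall t, `|kernel c n t| <= C.
Proof.
have [[C C0 CP] _] := @derivatives_bounded _ step' 1 n smooth_step' step'_out1.
exists (`|c| ^+ n.+1 * C) => [|t]; first by rewrite mulr_ge0.
by rewrite /kernel normrM normrX ler_wpM2l.
Qed.

Lemma kernel0_bound : exists2 S : R, 0 <= S & forall c t, 0 <= c -> `|kernel c 0 t| <= c * S.
Proof.
have [[C C0 CP] _] := @derivatives_bounded _ step' 1 0 smooth_step' step'_out1.
exists C => // c t c0; rewrite /kernel expr1 normrM (ger0_norm c0) ler_wpM2l//.
Qed.

Lemma kernel_out c n t : 0 < c -> c^-1 < `|t| -> kernel c n t = 0.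
Proof.
move=> c0 ct.
have [_ h] := @derivatives_bounded _ step' 1 n smooth_step' step'_out1.
rewrite /kernel h ?mulr0// normrM gtr0_norm//.
by rewrite -(ltr_pM2l (x := c)) ?divff ?gt_eqF// in ct.
Qed.

(** The function [- step (c * (x - t))] is a primitive of the integrand and rises from -1 to 0
    across the support. *)
Lemma int_kernel (c x : R) : 0 < c ->
  Rintegral (@lebesgue_measure R) setT (fun t => kernel c 0 (x - t)) = 1.
Proof.
move=> c0; have ci : 0 < c^-1 by rewrite invr_gt0.
have dl (t : R) : is_derive t 1 (fun s : R => c * (x - s)) (- c).
  have h : is_derive t 1 (fun s : R => x - s) (-1).
    by apply: is_derive_eq (is_deriveB _ _) _; rewrite sub0r.
  by apply: is_derive_eq (is_deriveZ _ _) _; rewrite -[_ *: _]/(_ * _) mulrN1.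
pose f (t : R) := - step (c * (x - t)).
have df (t : R) : is_derive t 1 f (kernel c 0 (x - t)).
  have h : is_derive t 1 (step \o (fun s : R => c * (x - s))) (step' (c * (x - t)) * - c).
    by apply: is_derive1_comp; exact: step_derive.
  by apply: is_derive_eq (is_deriveN _) _; rewrite /kernel derivatives0; ring.
have cg : continuous (fun t : R => kernel c 0 (x - t)).
  move=> t; apply: (@continuous_comp _ _ _ (fun t : R => x - t) (kernel c 0)).
    by apply: continuousB; [exact: cst_continuous|exact: cvg_id].
  exact: derivative_seq_continuous (kernel_seq c) _.
rewrite (@int1_derive _ f _ (x - c^-1) x).
- by rewrite /f subrr mulr0 step_le0// subKr divff ?gt_eqF// step_ge1// oppr0 sub0r opprK.
- by rewrite gtrBl.
- exact: cg.
- move=> t ht; rewrite /kernel derivatives0 step'_out ?mulr0//.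
  case: ht => ht; [right|left].
    by rewrite -(ltr_pM2l (x := c^-1))// mulKf ?gt_eqF// mulr1; lra.
  by rewrite pmulr_rlt0//; lra.
Qed.

Context {m : nat}.
Implicit Types (nu : 'I_m -> nat).

(** With [nu] as a multi-index this is the [nu]-th partial derivative of the product mollifier;
    [nu = 0] is the mollifier itself. *)
Definition kernel_prod c nu (y : 'rV[R]_m) : R := \prod_i kernel c (nu i) (y 0 i).

Lemma is_derive_prod (f : 'I_m -> R -> R) (y : 'rV[R]_m) i d :
  is_derive (y 0 i) 1 (f i) d ->
  is_derive y (delta_mx 0 i) (fun z => \prod_j f j (z 0 j))
    (d * \prod_(j | j != i) f j (y 0 j)).
Proof.
move=> df.
have e : (fun s : R => \prod_j f j ((y + s *: delta_mx 0 i) 0 j)) =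
    (\prod_(j | j != i) f j (y 0 j)) \*: (f i \o (fun s : R => y 0 i + s)).
  apply/funext => s; rewrite (bigD1 i)//= mulrC.
  rewrite [RHS](_ : _ = (\prod_(j | j != i) f j (y 0 j)) * f i (y 0 i + s))//; congr (_ * _).
    apply: eq_bigr => j ji; rewrite !mxE eqxx (negbTE ji) /=.
    by rewrite mulr0 addr0.
  by rewrite !mxE !eqxx mulr1.
have ds : is_derive (0 : R) 1 (fun s : R => y 0 i + s) 1.
  by apply: is_derive_eq (is_deriveD _ _) _; rewrite add0r.
have dfs : is_derive (0 : R) 1 (f i \o (fun s : R => y 0 i + s)) (d * 1).
  by apply: is_derive1_comp; rewrite addr0.
have h : is_derive (0 : R) 1 (fun s : R => \prod_j f j ((y + s *: delta_mx 0 i) 0 j))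
    (d * \prod_(j | j != i) f j (y 0 j)).
  rewrite e; apply: is_derive_eq (is_deriveZ _ _) _.
  by rewrite -[_ *: _]/(_ * _) mulr1 mulrC.
exact: (@is_derive_line0 _ _ (fun z => \prod_j f j (z 0 j)) y _ _ h).
Qed.

Definition incr nu i : 'I_m -> nat := fun j => ((j == i) + nu j)%N.

Lemma kernel_prod_incr c nu i y :
  kernel_prod c (incr nu i) y =
  kernel c (nu i).+1 (y 0 i) * \prod_(j | j != i) kernel c (nu j) (y 0 j).
Proof.
rewrite /kernel_prod (bigD1 i)//= /incr eqxx; congr (_ * _).
by apply: eq_bigr => j /negbTE ->.
Qed.

Lemma kernel_prod_shift_partial c nu (p : 'rV[R]_m) i y :
  is_derive y (delta_mx 0 i) (fun z => kernel_prod c nu (z - p)) (kernel_prod c (incr nu i) (y - p)).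
Proof.
rewrite kernel_prod_incr.
have -> : (fun z => kernel_prod c nu (z - p)) =
    (fun z => \prod_j (fun t => kernel c (nu j) (t - p 0 j)) (z 0 j)).
  by apply/funext => z; apply: eq_bigr => j _; rewrite !mxE.
apply: is_derive_eq (@is_derive_prod (fun j t => kernel c (nu j) (t - p 0 j)) y i
    (kernel c (nu i).+1 ((y - p) 0 i)) _) _; last first.
  by rewrite !mxE; congr (_ * _); apply: eq_bigr => j _; rewrite !mxE.
have dk : is_derive (y 0 i - p 0 i) 1 (kernel c (nu i)) (kernel c (nu i).+1 (y 0 i - p 0 i)) := kernel_seq c (nu i) I.
have ds : is_derive (y 0 i) 1 (fun s : R => s - p 0 i) 1.
  by apply: is_derive_eq (is_deriveB _ _) _; rewrite subr0.
have := @is_derive1_comp R _ (fun s => s - p 0 i) _ _ _ dk ds.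
by rewrite mulr1 !mxE.
Qed.

Lemma kernel_prod_reflect_partial c nu (x : 'rV[R]_m) i y :
  is_derive y (delta_mx 0 i) (fun z => kernel_prod c nu (x - z)) (- kernel_prod c (incr nu i) (x - y)).
Proof.
rewrite kernel_prod_incr.
have -> : (fun z => kernel_prod c nu (x - z)) =
    (fun z => \prod_j (fun t => kernel c (nu j) (x 0 j - t)) (z 0 j)).
  by apply/funext => z; apply: eq_bigr => j _; rewrite !mxE.
apply: is_derive_eq (@is_derive_prod (fun j t => kernel c (nu j) (x 0 j - t)) y i
    (- kernel c (nu i).+1 ((x - y) 0 i)) _) _; last first.
  by rewrite !mxE mulNr; congr (- (_ * _)); apply: eq_bigr => j _; rewrite !mxE.
have dk : is_derive (x 0 i - y 0 i) 1 (kernel c (nu i)) (kernel c (nu i).+1 (x 0 i - y 0 i)) := kernel_seq c (nu i) I.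
have ds : is_derive (y 0 i) 1 (fun s : R => x 0 i - s) (-1).
  by apply: is_derive_eq (is_deriveB _ _) _; rewrite sub0r.
have := @is_derive1_comp R _ (fun s => x 0 i - s) _ _ _ dk ds.
by rewrite mulrN1 !mxE.
Qed.

Lemma kernel_prod_smooth c nu : smooth_on setT (kernel_prod c nu).
Proof.
apply: smooth_on_prod; first exact: openT.
move=> i; exact: (smooth_on_comp1 (nu i) (kernel_seq c) openT (fun _ _ => I) (smooth_on_coord i)).
Qed.

Lemma kernel_prod_bound c N : exists2 B : R, 0 <= B &
  forall nu, (forall i, (nu i <= N)%N) -> forall y, `|kernel_prod c nu y| <= B.
Proof.
have /choice [C CP] : forall n, exists C, 0 <= C /\ forall t, `|kernel c n t| <= C.
  by move=> n; have [C ? ?] := kernel_bound c n; exists C.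
pose B := 1 + \sum_(k < N.+1) C k.
have B0 : 0 <= B by rewrite addr_ge0// sumr_ge0// => k _; exact: (CP k).1.
exists (B ^+ m) => [|nu nuN y]; first exact: exprn_ge0.
rewrite /kernel_prod normr_prod -[X in B ^+ X]card_ord -prodr_const.
apply: ler_prod => i _; rewrite normr_ge0/= (le_trans ((CP _).2 _))//.
have ni : (nu i < N.+1)%N by rewrite ltnS.
rewrite /B (bigD1 (Ordinal ni))//= addrCA lerDl addr_ge0// sumr_ge0// => k _.
exact: (CP k).1.
Qed.

Lemma kernel_prod_out c nu y : 0 < c -> c^-1 < `|y| -> kernel_prod c nu y = 0.
Proof.
move=> c0 cy; have ci : 0 <= c^-1 by rewrite invr_ge0 ltW.
have [i hi] := norm_gt_coord ci cy.
by rewrite /kernel_prod (bigD1 i)//= kernel_out// mul0r.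
Qed.

Lemma kernel_prod_integral c (x : 'rV[R]_m) : 0 < c ->
  iterated_integral (fun y => kernel_prod c (fun=> 0%N) (x - y)) = 1.
Proof.
move=> c0; have ci : 0 <= c^-1 by rewrite invr_ge0 ltW.
pose phi (i : 'I_m) (n : nat) (t : R) : R := (-1) ^+ n * kernel c n (-1 * t + x 0 i).
have -> : (fun y => kernel_prod c (fun=> 0%N) (x - y)) = (fun y => \prod_i phi i 0%N (y 0 i)).
  apply/funext => y; apply: eq_bigr => i _.
  by rewrite /phi expr0 mul1r !mxE addrC mulN1r.
rewrite (@iterated_integral_prod _ _ _ (`|x| + c^-1)); [|by rewrite addr_ge0| |].
- rewrite big1// => i _; rewrite -[RHS](int_kernel (x 0 i) c0).
  by congr Rintegral; apply/funext => t; rewrite /phi expr0 mul1r mulN1r addrC.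
- by move=> i; exact: derivative_seq_scale (kernel_seq c).
- move=> i t ht; rewrite /phi kernel_out ?mulr0//.
  rewrite mulN1r addrC distrC (lt_le_trans _ (lerB_dist _ _))//.
  by rewrite ltrBrDl (le_lt_trans _ ht)// lerD2r rV_coord_le.
Qed.

(** Mixed derivatives of the product kernel depend only on how often each direction occurs. *)
Definition counts (s : seq 'I_m) : 'I_m -> nat := fun i => count_mem i s.

Lemma counts_cons i s : counts (i :: s) = incr (counts s) i.
Proof. by apply/funext => j; rewrite /counts /incr /= eq_sym. Qed.

Lemma kernel_prod_partials c (p : 'rV[R]_m) s y :
  partials s (fun z => kernel_prod c (fun=> 0%N) (z - p)) y = kernel_prod c (counts s) (y - p).
Proof.
elim: s y => [|i s IH] y //.
have -> : partials (i :: s) (fun z => kernel_prod c (fun=> 0%N) (z - p)) =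
    partial i (fun z => kernel_prod c (counts s) (z - p)).
  by rewrite /=; congr partial; apply/funext.
by have h := kernel_prod_shift_partial c (counts s) p i y; rewrite counts_cons /partial derive_val.
Qed.

Lemma smooth_shift (f : 'rV[R]_m -> R) p : smooth_on setT f -> smooth_on setT (fun y => f (y - p)).
Proof.
move=> sf; apply: (@smooth_on_comp _ _ _ _ setT (fun y => y - p)) sf; try exact: openT.
  by [].
move=> j; apply: (smooth_on_congr openT _
  (smooth_onB openT (smooth_on_coord j) (smooth_on_cst (p 0 j)))) => z _.
by rewrite !mxE.
Qed.

Lemma smooth_reflect (f : 'rV[R]_m -> R) x : smooth_on setT f -> smooth_on setT (fun y => f (x - y)).
Proof.
move=> sf; apply: (@smooth_on_comp _ _ _ _ setT (fun y => x - y)) sf; try exact: openT.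
  by [].
move=> j; apply: (smooth_on_congr openT _
  (smooth_onB openT (smooth_on_cst (x 0 j)) (smooth_on_coord j))) => z _.
by rewrite !mxE.
Qed.

(* [ (D^s h) * rho = h * (D^s rho) ] for the convolution with a product kernel. *)
Lemma kernel_prod_by_parts c x (h : 'rV[R]_m -> R[i]) a nu s : smoothC_on setT h -> bsupp a h ->
  cintegral (fun y => partialsC s h y * (kernel_prod c nu (x - y))%:C) =
  cintegral (fun y => h y * (kernel_prod c (fun i => counts s i + nu i)%N (x - y))%:C).
Proof.
move=> sh ha; elim: s nu => [|i s IH] nu; first by rewrite partialsC_nil.
have sk nu' : smoothC_on setT (fun y => (kernel_prod c nu' (x - y))%:C).
  by apply: smoothC_on_real; apply: smooth_reflect; exact: kernel_prod_smooth.
(* The sign of integration by parts cancels the sign that comes from the reflected argument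
   [x - y]. *)
transitivity (cintegral (fun y => partialsC s h y * (kernel_prod c (incr nu i) (x - y))%:C)).
  have := integration_by_parts_partialC i (sk nu) (smoothC_on_partialsC s sh) (bsupp_partialsC s ha).
  have e1 y : partialC i (fun y => (kernel_prod c nu (x - y))%:C) y * partialsC s h y =
      - 1 * (partialsC s h y * (kernel_prod c (incr nu i) (x - y))%:C).
    rewrite partialC_real; have hd := kernel_prod_reflect_partial c nu x i y.
    by rewrite /partial derive_val rmorphN/=; ring.
  rewrite (eq_fun e1) (@cintegralZ _ _ _ _ a); last 2 first.
  - by apply: smoothC_onM; [exact: openT|exact: smoothC_on_partialsC|exact: sk].
  - by apply: bsupp_mull; exact: bsupp_partialsC.
  rewrite mulN1r => /eqP; rewrite eqr_opp => /eqP ->.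
  by congr cintegral; apply/funext => y; rewrite mulrC.
rewrite IH; congr cintegral; apply/funext => y; congr (_ * (kernel_prod _ _ _)%:C).
by apply/funext => j; rewrite counts_cons /incr; lia.
Qed.

End mollifier.

(** * Compactness arguments, partitions of unity and cutoff functions *)

Lemma compact_induction (T : topologicalType) (K : set T) (P : set T -> Prop) :
  compact K -> P set0 -> (forall A B, P A -> P B -> P (A `|` B)) ->
  (forall A B, A `<=` B -> P B -> P A) ->
  (forall x, K x -> exists2 N, nbhs x N & P N) -> P K.
Proof.
move=> cK P0 PU PS PN; apply: contrapT => nPK.
(* If [P K] failed, the sets [A] for which [P] holds of [K] minus [A] would form a proper filter
   containing [K]. At a cluster point, the complement of a good neighbourhood [N] belongs to this
   filter, which is absurd. *)
pose F : set_system T := [set A | P (K `\` A)].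
have FF : ProperFilter F.
  split; first by rewrite /F /= setD0.
  split; first by rewrite /F /= setDT.
  - by move=> A B FA FB; rewrite /F /= setDIr; exact: PU.
  - by move=> A B AB; apply: PS; exact: setDS.
have FK : F K by rewrite /F /= setDv.
have [x [Kx clx]] := cK F FF FK.
have [N nN PNN] := PN x Kx.
have FN : F (~` N) by rewrite /F /= setDE setCK; apply: PS PNN => y [].
by have [y []] := clx _ _ FN nN.
Qed.

(** [S] is the class of admissible functions and [Q i] a local requirement stable under
    multiplication by [S], such as a support condition. This form serves both for small cubes in R^m
    and for chart domains in a manifold. *)
Lemma partition_of_unity (R : realType) (T : topologicalType) (I : Type)
    (S : (T -> R) -> Prop) (Q : I -> (T -> R) -> Prop) (K : set T) :
  compact K -> S (fun=> 0) -> (forall u, S u -> S (fun y => 1 - u y)) ->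
  (forall u v, S u -> S v -> S (fun y => u y * v y)) ->
  (forall i u v, S u -> Q i v -> Q i (fun y => u y * v y)) ->
  (forall x, K x -> exists i w G, [/\ S w, Q i w, forall y, 0 <= w y <= 1,
     open G /\ G x & forall y, G y -> w y = 1]) ->
  exists n (w : 'I_n -> T -> R) (p : 'I_n -> I),
    [/\ forall k, S (w k) /\ Q (p k) (w k), forall k y, 0 <= w k y,
        forall y, \sum_k w k y <= 1 &
        exists O, [/\ open O, K `<=` O & forall y, O y -> \sum_k w k y = 1]].
Proof.
move=> cK S0 SB SM QM loc.
(* Membership of the sum in [S] is part of the induction statement because, when two families are
   joined, the second is multiplied by 1 minus the sum of the first. *)
pose P A := exists n (w : 'I_n -> T -> R) (p : 'I_n -> I),
    [/\ forall k, S (w k) /\ Q (p k) (w k), forall k y, 0 <= w k y,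
        forall y, \sum_k w k y <= 1, S (fun y => \sum_k w k y) &
        exists O, [/\ open O, A `<=` O & forall y, O y -> \sum_k w k y = 1]].
suff [n [w [p [h1 h2 h3 _ h4]]]] : P K by exists n, w, p.
apply: (compact_induction cK).
- exists 0%N, (fun=> fun=> 0), (fun k : 'I_0 => match notF (ltn_ord k) with end).
  split=> //; first by case.
  + by move=> y; rewrite big_ord0.
  + by under eq_fun do rewrite big_ord0.
  + by exists set0; split=> //; exact: open0.
- move=> A B [n1 [w1 [p1 [q1 pos1 le1 S1 [Ga [oGa AGa e1]]]]]].
  move=> [n2 [w2 [p2 [q2 pos2 le2 S2 [Gb [oGb BGb e2]]]]]].
  pose s1 y := \sum_k w1 k y; pose s2 y := \sum_k w2 k y.
  pose w k := match fintype.split k with inl i => w1 i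
    | inr j => fun y => (1 - s1 y) * w2 j y end.
  pose p k := match fintype.split k with inl i => p1 i | inr j => p2 j end.
  have sw y : \sum_k w k y = 1 - (1 - s1 y) * (1 - s2 y).
    rewrite big_split_ord /= (eq_bigr (fun k => w1 k y)); last first.
      by move=> i _; rewrite /w (unsplitK (inl i)).
    rewrite [X in _ + X](eq_bigr (fun k => (1 - s1 y) * w2 k y)); last first.
      by move=> i _; rewrite /w (unsplitK (inr i)).
    rewrite -mulr_sumr -/(s1 y) -/(s2 y); ring.
  have b1 y : 0 <= 1 - s1 y by rewrite subr_ge0; exact: le1.
  have b2 y : 0 <= 1 - s2 y by rewrite subr_ge0; exact: le2.
  exists (n1 + n2)%N, w, p; split.
  + move=> k; rewrite /w /p; case: (fintype.split k) => i; first exact: q1.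
    by have [? ?] := q2 i; split; [apply: SM => //; exact: SB|apply: QM => //; exact: SB].
  + move=> k y; rewrite /w; case: (fintype.split k) => i; first exact: pos1.
    by rewrite mulr_ge0.
  + by move=> y; rewrite sw gerBl mulr_ge0.
  + have -> : (fun y => \sum_k w k y) = (fun y => 1 - (1 - s1 y) * (1 - s2 y)).
      by apply/funext => y; exact: sw.
    by apply: (SB (fun y => (1 - s1 y) * (1 - s2 y))); apply: SM; exact: SB.
  + exists (Ga `|` Gb); split; first exact: openU.
      by move=> y [/AGa|/BGb]; [left|right].
    move=> y [/e1 e|/e2 e]; rewrite sw.
      by rewrite /s1 e subrr mul0r subr0.
    by rewrite /s2 e subrr mulr0 subr0.
- move=> A B AB [n [w [p [h1 h2 h3 h4 [G [oO BO e]]]]]].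
  exists n, w, p; split=> //; exists G; split=> //; exact: subset_trans BO.
- move=> x /loc [i [w [G [Sw Qw w01 [oG Gx] GP]]]].
  exists G; first exact: open_nbhs_nbhs.
  exists 1%N, (fun=> w), (fun=> i); split=> //.
  + by move=> _ y; have /andP[] := w01 y.
  + by move=> y; rewrite big_ord1; have /andP[] := w01 y.
  + by under eq_fun do rewrite big_ord1.
  + by exists G; split=> // y /GP; rewrite big_ord1.
Qed.

Section cutoffs.
Context {R : realType} {m : nat}.
Implicit Types (p y : 'rV[R]_m).

Lemma cube_cutoff p (d : R) : 0 < d -> exists w : 'rV[R]_m -> R,
  [/\ smooth_on setT w, forall y, 0 <= w y <= 1, forall y, `|y - p| <= d / 2 -> w y = 1 &
      forall y, d < `|y - p| -> w y = 0].
Proof.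
move=> d0; pose c := 2 / d; have c0 : 0 < c by rewrite divr_gt0.
(* With [c = 2 / d] the argument is at least 1 for [|y_i - p_i| <= d / 2] and negative beyond [d];
   the square keeps it smooth. *)
pose f i y := step (2 - (c * (y 0 i - p 0 i)) ^+ 2).
exists (fun y => \prod_i f i y); split.
- apply: smooth_on_prod; first exact: openT.
  move=> i; apply: smooth_on_step; first exact: openT.
  apply: smooth_onB; [exact: openT|exact: smooth_on_cst|].
  apply: smooth_onX; first exact: openT.
  apply: smooth_onZ; first exact: openT.
  by apply: smooth_onB; [exact: openT|exact: smooth_on_coord|exact: smooth_on_cst].
- move=> y; rewrite prodr_ge0 => [|i _]; last exact: step_ge0.
  have : \prod_i f i y <= \prod_(i < m) 1.
    by apply: ler_prod => i _; rewrite step_ge0 step_le1.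
  by rewrite prodr_const expr1n.
- move=> y yd; rewrite big1// => i _; apply: step_ge1.
  rewrite -[_ ^+ 2]real_normK ?num_real// lerBrDr -lerBrDl (_ : 2 - 1 = 1 ^+ 2); last by ring.
  rewrite ler_sqr ?nnegrE// normrM gtr0_norm// mulrC -ler_pdivlMr//.
  have := rV_coord_le (y - p) i; rewrite !mxE => /le_trans; apply.
  by rewrite (le_trans yd)// /c div1r invf_div.
- move=> y dy; have [i hi] := norm_gt_coord (ltW d0) dy; rewrite !mxE in hi.
  rewrite (bigD1 i)//= /f step_le0 ?mul0r// subr_le0.
  rewrite -[_ ^+ 2]real_normK ?num_real// normrM gtr0_norm//.
  have h : 2 <= c * `|y 0 i - p 0 i|.
    have <- : c * d = 2 by rewrite /c divfK// gt_eqF.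
    by rewrite ler_wpM2l// ltW.
  rewrite (le_trans h)// expr2 ler_peMr// (le_trans _ h)//; lra.
Qed.

(** For the points within [r / 4] of [x], the closed cube of radius [r / 2] about [x] works with
    margin [r / 4]; compactness makes the margin uniform. *)
Lemma compact_thickening (K W : set 'rV[R]_m) : compact K -> K `<=` W -> open W ->
  exists2 L, compact L /\ L `<=` W & exists2 e : R, 0 < e &
    forall y x, K y -> `|x - y| <= e -> L x.
Proof.
move=> cK KW oW.
pose P (A : set 'rV[R]_m) := exists L, (compact L /\ L `<=` W) /\ exists2 e : R, 0 < e &
    forall y x, (A `&` K) y -> `|x - y| <= e -> L x.
suff [L [h [e e0 eP]]] : P K by exists L => //; exists e => // y x Ky; apply: eP.
apply: (compact_induction cK).
- by exists set0; split; [split => //; exact: compact0|exists 1 => // y x []].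
- move=> A B [L1 [[c1 s1] [e1 e10 h1]]] [L2 [[c2 s2] [e2 e20 h2]]].
  exists (L1 `|` L2); split.
    by split; [exact: compactU|move=> y [/s1|/s2]].
  exists (Num.min e1 e2); first by rewrite lt_min e10.
  move=> y x [[Ay|By] Ky]; rewrite le_min => /andP[x1 x2].
    by left; apply: (h1 y).
  by right; apply: (h2 y).
- move=> A B AB [L [hL [e e0 h]]]; exists L; split=> //; exists e => // y x [Ay Ky].
  by apply: h; split=> //; exact: AB.
- move=> x Kx; have : nbhs x W by apply: open_nbhs_nbhs; split=> //; exact: KW.
  move=> /nbhs_ballP[r/= r0 rW].
  pose L := [set y | `|y - x| <= r / 2].
  have r2 : 0 < r / 2 by rewrite divr_gt0.
  have r4 : 0 < r / 4 by rewrite divr_gt0.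
  exists (ball x (r / 4)); first exact: nbhsx_ballx.
  exists L; split; first split.
  + have -> : L = (fun y => y + x) @` [set y | `|y| <= r / 2].
      apply/seteqP; split=> [y Ly|y [z hz <-]]; last by rewrite /L /= addrK.
      by exists (y - x) => //; rewrite subrK.
    apply: continuous_compact; last exact: closed_ball_compact.
    apply: continuous_subspaceT => y.
    by apply: continuousD; [exact: cvg_id|exact: cst_continuous].
  + move=> y Ly; apply: rW; rewrite -ball_normE /= distrC (le_lt_trans Ly)//.
    by rewrite ltr_pdivrMr// ltr_pMr// ltr1n.
  + exists (r / 4) => // y z [+ _] zy; rewrite -ball_normE /= => xy.
    have h : `|z - x| <= `|z - y| + `|y - x| by exact: ler_distD.
    rewrite distrC in xy; rewrite /L /=; lra.
Qed.

End cutoffs.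

(** * Distributions on open sets of R^m *)

Definition test_fun (R : realType) m (K : set 'rV[R]_m) (h : 'rV[R]_m -> R[i]) : Prop :=
  smoothC_on setT h /\ forall y, ~ K y -> h y = 0.

Definition is_distribution (R : realType) m (W : set 'rV[R]_m)
    (F : ('rV[R]_m -> R[i]) -> R[i]) : Prop :=
  (forall K a h h', compact K -> K `<=` W -> test_fun K h -> test_fun K h' ->
     F (fun y => a * h y + h' y) = a * F h + F h') /\
  (forall K, compact K -> K `<=` W -> exists (C : R) N, 0 <= C /\
     forall h t, test_fun K h -> 0 <= t ->
       (forall s y, (size s <= N)%N -> normc (partialsC s h y) <= t) ->
       normc (F h) <= C * t).

Section test_functions.
Context {R : realType} {m : nat}.
Implicit Types (K W : set 'rV[R]_m) (h : 'rV[R]_m -> R[i]).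

Lemma test_funW K L h : K `<=` L -> test_fun K h -> test_fun L h.
Proof. by move=> KL [sh hK]; split=> // y Ly; apply: hK => /KL. Qed.

Lemma test_fun0 K : test_fun K (fun=> 0).
Proof. by split=> //; exact: smoothC_on_cst. Qed.

Lemma test_funD K h h' : test_fun K h -> test_fun K h' -> test_fun K (fun y => h y + h' y).
Proof.
move=> [sh hK] [sh' hK']; split; first exact: (smoothC_onD openT sh sh').
by move=> y Ky; rewrite hK// hK'// addr0.
Qed.

Lemma test_funM K u h : smoothC_on setT u -> test_fun K h -> test_fun K (fun y => u y * h y).
Proof.
move=> su [sh hK]; split; first exact: (smoothC_onM openT su sh).
by move=> y Ky; rewrite hK// mulr0.
Qed.

Lemma test_funZ K (a : R[i]) h : test_fun K h -> test_fun K (fun y => a * h y).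
Proof. by apply: test_funM; exact: smoothC_on_cst. Qed.

Lemma test_funB K h h' : test_fun K h -> test_fun K h' -> test_fun K (fun y => h y - h' y).
Proof.
move=> th th'; have := test_funD th (test_funZ (-1) th').
by congr test_fun; apply/funext => y; rewrite mulN1r.
Qed.

Lemma test_fun_sum K I (r : seq I) (F : I -> 'rV[R]_m -> R[i]) :
  (forall i, test_fun K (F i)) -> test_fun K (fun y => \sum_(i <- r) F i y).
Proof.
move=> hF; split; first by apply: smoothC_on_sum; [exact: openT|move=> i; exact: (hF i).1].
by move=> y Ky; rewrite big1// => i _; exact: (hF i).2.
Qed.

(** [u] is smooth on [W] only. The product is smooth on [W] and vanishes on the open complement of
    [K], and these two sets cover everything. *)
Lemma test_fun_mul_local K W (u : 'rV[R]_m -> R[i]) h : compact K -> open W -> K `<=` W ->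
  smoothC_on W u -> test_fun K h -> test_fun K (fun y => u y * h y).
Proof.
move=> cK oW KW su [sh hK]; split; last by move=> y Ky; rewrite hK// mulr0.
apply: smoothC_on_local => y _; have [Ky|Ky] := pselect (K y).
  exists W; first exact: KW.
  exact: (smoothC_onM oW su (smoothC_on_sub (@subsetT _ _) sh)).
exists (~` K) => //.
have oK : open (~` K) by apply: closed_openC; apply: compact_closed cK; exact: norm_hausdorff.
apply: (smoothC_on_congr oK _ (smoothC_on_cst (~` K) 0)) => z Kz.
by rewrite hK// mulr0.
Qed.

Lemma test_fun_partialC K h i : compact K -> test_fun K h -> test_fun K (partialC i h).
Proof.
move=> cK [sh hK]; split; first exact: smoothC_on_partialC.
have oK : open (~` K) by apply: closed_openC; apply: compact_closed cK; exact: norm_hausdorff.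
by move=> y Ky; rewrite (@partialC_congr _ _ (~` K) _ (fun=> 0))// partialC_cst.
Qed.

Lemma test_fun_partialsC K h s : compact K -> test_fun K h -> test_fun K (partialsC s h).
Proof.
move=> cK th; elim: s => [|i s IH]; first by rewrite partialsC_nil.
by rewrite partialsC_cons; exact: test_fun_partialC.
Qed.

Lemma compact_norm_bound K : compact K -> exists2 a : R, 0 <= a & forall y, K y -> `|y| <= a.
Proof.
move=> /compact_bounded [a [_ aP]]; exists (`|a| + 1); first by rewrite addr_ge0.
by apply: aP; rewrite (le_lt_trans (ler_norm a))// ltrDl.
Qed.

Lemma test_fun_bsupp K h : compact K -> test_fun K h ->
  exists2 a : R, 0 <= a & bsupp a h.
Proof.
move=> cK [_ hK]; have [a a0 aP] := compact_norm_bound cK.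
by exists a => // y ay; apply: hK => /aP; rewrite leNgt ay.
Qed.

End test_functions.

Section mollification.
Context {R : realType} {m : nat}.

Lemma partialsC_real s (f : 'rV[R]_m -> R) y : partialsC s (fun z => (f z)%:C) y = (partials s f y)%:C.
Proof.
elim: s y => [|i s IH] y; first by rewrite partialsC_nil.
by rewrite partialsC_cons (_ : partialsC s _ = fun z => (partials s f z)%:C) ?partialC_real//; apply/funext.
Qed.

(** The kernel has integral 1, so the error is the integral of [(h x - h y) * kernel]. On the cube
    of side [2 / c] that carries the kernel, [h x - h y] is of size [M / c] and the kernel is at
    most [(c * S) ^ m], so the volume cancels the powers of [c]. *)
Lemma mollification_bound : exists2 S : R, 0 <= S & forall c (h : 'rV[R]_m -> R[i]) a M x,
  0 < c -> 0 <= M -> smoothC_on setT h -> bsupp a h ->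
  (forall i y, normc (partialC i h y) <= M) ->
  normc (h x - cintegral (fun y => h y * (kernel_prod c (fun=> 0%N) (x - y))%:C)) <= S * M * c^-1.
Proof.
have [S S0 SP] := @kernel0_bound R.
exists (2 * (2 * m%:R) * (2 * S) ^+ m) => [|c h a M x c0 M0 sh ha hM].
  by rewrite !mulr_ge0// exprn_ge0// mulr_ge0.
have ci : 0 <= c^-1 by rewrite invr_ge0 ltW.
pose k y := (kernel_prod c (fun=> 0%N) (x - y))%:C.
have sk : smoothC_on setT k.
  by apply: smoothC_on_real; apply: smooth_reflect; exact: kernel_prod_smooth.
have kx y : c^-1 < `|y - x| -> k y = 0.
  by move=> hy; rewrite /k kernel_prod_out// distrC.
have kb : bsupp (`|x| + c^-1) k.
  move=> y hy; apply: kx; rewrite -ltrBrDl in hy.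
  by apply: lt_le_trans hy _; rewrite lerB_dist.
have k1 : cintegral k = 1.
  by apply: complex_ext; rewrite /= ?kernel_prod_integral// iterated_integral0.
pose b := Num.max a (`|x| + c^-1).
have hb : bsupp b h by apply: bsuppW ha; rewrite le_max lexx.
have kbb : bsupp b k by apply: bsuppW kb; rewrite le_max lexx orbT.
have -> : (fun y => h y * (kernel_prod c (fun=> 0%N) (x - y))%:C) = (fun y => h y * k y) by [].
rewrite -[h x]mulr1 -k1 -(cintegralZ _ sk kbb) -(@cintegralB _ _ _ _ b).
- apply: le_trans (cintegral_bound (p := x) (r := c^-1)
    (M := 2 * m%:R * M * c^-1 * (c * S) ^+ m) _ ci _ _) _.
  + apply: smoothC_onB; first exact: openT.
      exact: (smoothC_onZ _ openT sk).
    exact: (smoothC_onM openT sh sk).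
  + by move=> y /kx ->; rewrite !mulr0 subr0.
  + move=> y; have M1 : 0 <= 2 * m%:R * M by rewrite !mulr_ge0.
    have [xy|xy] := leP `|y - x| c^-1; last first.
      rewrite kx// !mulr0 subr0 normc0; apply: mulr_ge0; first exact: mulr_ge0.
      by apply: exprn_ge0; apply: mulr_ge0 => //; exact: ltW.
    rewrite -mulrBl normcM ler_pM ?normc_ge0//.
      rewrite (le_trans (mean_value_boundC sh hM x y))// distrC ler_wpM2l//.
    rewrite normc_real /kernel_prod normr_prod -[X in _ ^+ X]card_ord -prodr_const.
    by apply: ler_prod => i _; rewrite normr_ge0/= SP// ltW.
  + have -> : 2 * S = (c * S) * (2 * c^-1) by rewrite mulrACA [c * 2]mulrC -mulrA mulrCA; field; rewrite gt_eqF.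
    rewrite [in leRHS]exprMn le_eqVlt; apply/orP; left; apply/eqP; ring.
- exact: (smoothC_onZ _ openT sk).
- exact: (smoothC_onM openT sh sk).
- exact: bsupp_mulr.
- exact: bsupp_mulr.
Qed.

(** A Riemann sum with weights from a partition of unity: where [w k] is nonzero, [g y] may be
    replaced by [g (p k)] at the cost of [L * d]. *)
Lemma discretization_bound n (w : 'I_n -> 'rV[R]_m -> R) (p : 'I_n -> 'rV[R]_m)
    (h : 'rV[R]_m -> R[i]) (g : 'rV[R]_m -> R) (a d L M : R) :
  (forall k, smooth_on setT (w k)) -> (forall k y, 0 <= w k y) ->
  (forall k y, w k y != 0 -> `|y - p k| <= d) -> (forall y, \sum_k w k y <= 1) ->
  (forall y, h y != 0 -> \sum_k w k y = 1) ->
  smoothC_on setT h -> 0 <= a -> bsupp a h -> (forall y, normc (h y) <= M) ->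
  smooth_on setT g -> 0 <= L -> 0 <= d -> (forall x y, `|g x - g y| <= L * `|x - y|) ->
  normc (cintegral (fun y => h y * (g y)%:C) -
    \sum_k cintegral (fun y => (w k y)%:C * h y) * (g (p k))%:C) <= 2 * (M * (L * d)) * (2 * a) ^+ m.
Proof.
move=> sw w0 wd w1 wh sh a0 ha hM sg L0 d0 gL.
have M0 : 0 <= M := le_trans (normc_ge0 _) (hM 0).
have swC k : smoothC_on setT (fun y => (w k y)%:C) by exact: smoothC_on_real.
have swh k : smoothC_on setT (fun y => (w k y)%:C * h y).
  exact: (smoothC_onM openT (swC k) sh).
have bwh k : bsupp a (fun y => (w k y)%:C * h y) by exact: bsupp_mulr.
pose T k y := (g (p k))%:C * ((w k y)%:C * h y).
have sT k : smoothC_on setT (T k) by exact: (smoothC_onZ _ openT (swh k)).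
have bT k : bsupp a (T k) by exact: bsupp_mulr.
have -> : \sum_k cintegral (fun y => (w k y)%:C * h y) * (g (p k))%:C =
    cintegral (fun y => \sum_k T k y).
  rewrite (@cintegral_sum _ _ _ _ _ a)//; apply: eq_bigr => k _.
  by rewrite mulrC -(cintegralZ _ (swh k) (bwh k)).
have sgh : smoothC_on setT (fun y => h y * (g y)%:C).
  exact: (smoothC_onM openT sh (smoothC_on_real sg)).
have sTs : smoothC_on setT (fun y => \sum_k T k y) by exact: (smoothC_on_sum _ openT sT).
have bgh : bsupp a (fun y => h y * (g y)%:C) by exact: bsupp_mull.
have bTs : bsupp a (fun y => \sum_k T k y) by move=> y ay; rewrite big1// => k _; exact: bT.
rewrite -(cintegralB sgh sTs bgh bTs).
apply: (cintegral_bound (p := 0) (smoothC_onB openT sgh sTs) a0).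
- by move=> y; rewrite subr0 => ay; rewrite bgh// bTs// subr0.
- move=> y; have [hy|hy] := eqVneq (h y) 0.
    rewrite hy mul0r big1 ?subr0 ?normc0 ?mulr_ge0// => k _.
    by rewrite /T hy !mulr0.
  (* Where [h] is nonzero the weights add up to 1, so the difference can be distributed over the
     cells. *)
  have -> : h y * (g y)%:C - \sum_k T k y = h y * (\sum_k w k y * (g y - g (p k)))%:C.
    rewrite rmorph_sum/= mulr_sumr -[in LHS](mulr1 (h y)).
    have -> : (1 : R[i]) = \sum_k (w k y)%:C by rewrite -rmorph_sum/= wh.
    rewrite mulr_sumr mulr_suml -sumrB; apply: eq_bigr => k _.
    by rewrite /T rmorphM rmorphB/=; ring.
  rewrite normcM ler_pM ?normc_ge0// normc_real (le_trans (ler_norm_sum _ _ _))//.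
  apply: (@le_trans _ _ (\sum_k w k y * (L * d))).
    apply: ler_sum => k _; rewrite normrM (ger0_norm (w0 k y)).
    have [->|wk] := eqVneq (w k y) 0; first by rewrite !mul0r.
    by rewrite ler_wpM2l// (le_trans (gL _ _))// ler_wpM2l// wd.
  by rewrite -mulr_suml ler_piMl ?w1// mulr_ge0.
Qed.

End mollification.

Section distributions.
Context {R : realType} {m : nat} {W : set 'rV[R]_m} {F : ('rV[R]_m -> R[i]) -> R[i]}.
Hypothesis dF : is_distribution W F.

Lemma distributionD K h h' : compact K -> K `<=` W -> test_fun K h -> test_fun K h' ->
  F (fun y => h y + h' y) = F h + F h'.
Proof.
move=> cK KW th th'; have := dF.1 K 1 h h' cK KW th th'.
rewrite mul1r => <-; congr F; apply/funext => y; by rewrite mul1r.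
Qed.

Lemma distribution0 : F (fun=> 0) = 0.
Proof.
have t0 := test_fun0 (@set0 'rV[R]_m).
have := distributionD (@compact0 _) (@sub0set _ _) t0 t0.
by rewrite addr0 => /eqP; rewrite eq_sym -subr_eq0 addrK => /eqP.
Qed.

Lemma distributionZ K (a : R[i]) h : compact K -> K `<=` W -> test_fun K h ->
  F (fun y => a * h y) = a * F h.
Proof.
move=> cK KW th; have := dF.1 K a h _ cK KW th (test_fun0 K).
rewrite distribution0 addr0 => <-; congr F; apply/funext => y; by rewrite addr0.
Qed.

Lemma distributionB K h h' : compact K -> K `<=` W -> test_fun K h -> test_fun K h' ->
  F (fun y => h y - h' y) = F h - F h'.
Proof.
move=> cK KW th th'; rewrite -[- F h']mulN1r -(distributionZ _ cK KW th').
rewrite -(distributionD cK KW th (test_funZ _ th')).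
by congr F; apply/funext => y; rewrite mulN1r.
Qed.

Lemma distribution_sum K I (r : seq I) (h : I -> 'rV[R]_m -> R[i]) : compact K -> K `<=` W ->
  (forall i, test_fun K (h i)) -> F (fun y => \sum_(i <- r) h i y) = \sum_(i <- r) F (h i).
Proof.
move=> cK KW th; elim: r => [|i r IH].
  by rewrite big_nil -[RHS]distribution0; congr F; apply/funext => y; rewrite big_nil.
rewrite big_cons -IH -(distributionD cK KW (th i) (test_fun_sum r th)).
by congr F; apply/funext => y; rewrite big_cons.
Qed.


(** Mollifying [h] and discretizing the convolution gives [h ~ sum_k q_k * rho (. - p_k)], with
    [q_k] the integral of [w_k * h], in all derivatives up to the order of [F] on [L]. Applying [F]
    gives [sum_k kappa_k * q_k] with [kappa_k = F (rho (. - p_k))]. As [kappa] and [w] do not depend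
    on [h], this is integration of [h] against the smooth function [sum_k kappa_k * w_k]. *)
Lemma distribution_approximation K (M : nat -> R) (e : R) :
  open W -> compact K -> K `<=` W -> 0 < e ->
  exists n (w : 'I_n -> 'rV[R]_m -> R) (kappa : 'I_n -> R[i]),
    (forall k, smooth_on setT (w k)) /\
    forall h, test_fun K h -> (forall s y, normc (partialsC s h y) <= M (size s)) ->
      normc (F h - \sum_k kappa k * cintegral (fun y => (w k y)%:C * h y)) <= e.
Proof.
move=> oW cK KW e0.
have [L [cL LW] [e1 e10 LP]] := compact_thickening cK KW oW.
have KL : K `<=` L by move=> y Ky; apply: (LP y) => //; rewrite subrr normr0 ltW.
have [a a0 aP] := compact_norm_bound cK.
have [C [N [C0 CP]]] := dF.2 L cL LW.
(* The accuracy [t] is asked of every derivative up to order [N], which gives [C * t <= e]; 1 is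
   added because [C] may be 0. *)
pose t := e / (C + 1); have t0 : 0 < t by rewrite divr_gt0// ltr_wpDl.
(* Orders up to [N + 1] enter because mollifying a derivative of order [N] costs one further
   derivative. *)
pose Mx := \sum_(k < N.+2) `|M k|.
have Mx0 : 0 <= Mx by rewrite sumr_ge0.
have MxP k : (k < N.+2)%N -> M k <= Mx.
  move=> kN; rewrite (le_trans (ler_norm _))// /Mx (bigD1 (Ordinal kN))//=.
  by rewrite lerDl sumr_ge0.
have [S S0 SP] := @mollification_bound R m.
(* [c] is so large that kernels centred in [K] stay inside [L], which needs [c^-1 <= e1], and that
   the mollification error is at most [t / 2]. *)
pose c := e1^-1 + 2 * S * Mx / t + 1.
have g0 : 0 <= 2 * S * Mx / t.
  by apply: divr_ge0 (ltW t0); apply: mulr_ge0 => //; exact: mulr_ge0.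
have ei : 0 < e1^-1 by rewrite invr_gt0.
have c0 : 0 < c by rewrite /c; lra.
have ce1 : c^-1 <= e1 by rewrite invf_ple ?posrE// /c; lra.
have ct : S * Mx * c^-1 <= t / 2.
  rewrite ler_pdivrMr//.
  have -> : t / 2 * c = t / 2 * (e1^-1 + 1) + S * Mx by rewrite /c; field; rewrite !gt_eqF.
  by rewrite lerDr mulr_ge0//; lra.
have [B B0 BP] := @kernel_prod_bound R m c N.+1.
(* [m * B] is a Lipschitz constant for the derivatives of the kernel of order up to [N], so cells of
   radius [d] cost [A * d]; the choice of [d] makes this at most [t / 2]. *)
pose A := 2 * (Mx * (m%:R * B)) * (2 * a) ^+ m.
have A0 : 0 <= A by rewrite !mulr_ge0// exprn_ge0// mulr_ge0.
pose d := t / (2 * (A + 1)); have d0 : 0 < d by rewrite divr_gt0// mulr_gt0// ltr_wpDl.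
have [|||||n [w [p [wP w0 w1 [G [oG KG wG]]]]]] := @partition_of_unity R 'rV[R]_m 'rV[R]_m
  (smooth_on setT) (fun p w => K p /\ forall y, w y != 0 -> `|y - p| <= d) K cK.
- exact: smooth_on_cst.
- by move=> u su; exact: (smooth_onB openT (smooth_on_cst 1) su).
- by move=> u v su sv; exact: (smooth_onM openT su sv).
- move=> q u v su [Kq hv]; split=> // y; rewrite mulf_eq0 negb_or => /andP[_].
  exact: hv.
- move=> x Kx; have [u [su u01 u1 u0]] := cube_cutoff x d0.
  exists x, u, (ball x (d / 2)); split=> //.
  + split=> // y; apply: contraNT; rewrite -ltNge => /u0 ->.
    by rewrite eqxx.
  + by split; [exact: ball_open|apply: ballxx; rewrite divr_gt0].
  + by move=> y; rewrite -ball_normE/= distrC => /ltW; exact: u1.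
pose ker (q y : 'rV[R]_m) := (kernel_prod c (fun=> 0%N) (y - q))%:C : R[i].
have tker k : test_fun L (ker (p k)).
  split; first by apply: smoothC_on_real; apply: smooth_shift; exact: kernel_prod_smooth.
  move=> y Ly; rewrite /ker kernel_prod_out// ltNge; apply/negP => h; apply: Ly.
  by apply: (LP (p k)); [have [_ []] := wP k|exact: le_trans ce1].
exists n, w, (fun k => F (ker (p k))); split; first by move=> k; have [] := wP k.
move=> h th hM; have [sh hK] := th.
have ha : bsupp a h by move=> y ay; apply: hK => /aP; rewrite leNgt ay.
pose q k := cintegral (fun y => (w k y)%:C * h y).
have tL : test_fun L h := test_funW KL th.
have tq k : test_fun L (fun y => q k * ker (p k) y) by exact: test_funZ.
rewrite (eq_bigr (fun k => F (fun y => q k * ker (p k) y))); last first.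
  by move=> k _; rewrite (distributionZ _ cL LW (tker k)) mulrC.
rewrite -(distribution_sum _ cL LW tq) -(distributionB cL LW tL (test_fun_sum _ tq)).
apply: le_trans (CP _ t _ (ltW t0) _) _.
- by apply: test_funB => //; exact: test_fun_sum.
- move=> s x sN.
  have sker : smoothC_on setT (fun y => \sum_k q k * ker (p k) y) by have [] := test_fun_sum (index_enum 'I_n) tq.
  have -> : partialsC s (fun y => h y - \sum_k q k * ker (p k) y) x =
      partialsC s h x - \sum_k q k * (kernel_prod c (counts s) (x - p k))%:C.
    rewrite (@partialsC_congr _ _ setT _ (fun y => h y + (-1) * \sum_k q k * ker (p k) y))//; try exact: openT; last first.
      by move=> z _; rewrite mulN1r.
    have sq k : smoothC_on setT (fun y => q k * ker (p k) y) := (tq k).1.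
    rewrite (partialsCD _ openT (I : setT x) sh (smoothC_onZ (-1) openT sker)).
    rewrite (partialsCZ _ _ openT (I : setT x) sker) (partialsC_sum _ _ openT (I : setT x) sq).
    rewrite mulN1r; congr (_ - _); apply: eq_bigr => k _.
    rewrite (partialsCZ _ _ openT (I : setT x) (tker k).1).
    by rewrite /ker partialsC_real kernel_prod_partials.
  (* [T] is the mollified derivative, written with the derivatives on the kernel. It splits the
     error into the mollification part and the discretization part. *)
  pose T := cintegral (fun y => h y * (kernel_prod c (counts s) (x - y))%:C).
  rewrite -(subrKA T) (le_trans (ler_normcD _ _))// (splitr t) lerD//.
    have := kernel_prod_by_parts c x (fun=> 0%N) s sh ha.
    have -> : (fun i => counts s i + 0)%N = counts s by apply/funext => i; rewrite addn0.
    rewrite -/T => <-; apply: le_trans ct.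
    apply: (SP c _ a Mx x c0 Mx0 (smoothC_on_partialsC s sh) (bsupp_partialsC s ha)) => i y.
     rewrite -partialsC_cons (le_trans (hM _ _))// MxP//.
  apply: le_trans (discretization_bound (a := a) (d := d) (L := m%:R * B) (M := Mx)
      (g := fun y => kernel_prod c (counts s) (x - y)) _ _ _ _ _ _ _ _ _ _ _ _ _) _ => //.
  + by move=> k; have [] := wP k.
  + by move=> k y; have [_ [_]] := wP k; apply.
  + by move=> y hy; apply: wG; apply: KG; apply: contrapT => /hK; apply/eqP.
  + move=> y; have := hM [::] y; rewrite partialsC_nil => /le_trans; apply; exact: MxP.
  + by apply: smooth_reflect; exact: kernel_prod_smooth.
  + exact: mulr_ge0.
  + exact: ltW.
  + move=> y z; have := mean_value_bound (kernel_prod_smooth c (counts s)) (M := B) _ (x - y) (x - z).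
    rewrite (_ : x - y - (x - z) = z - y); last by apply/rowP => j; rewrite !mxE; ring.
    rewrite [`|z - y|]distrC; apply => i u.
    have := kernel_prod_shift_partial c (counts s) 0 i u.
    rewrite (_ : (fun v => kernel_prod c (counts s) (v - 0)) = kernel_prod c (counts s)); last first.
      by apply/funext => v; rewrite subr0.
    move=> hd; rewrite /partial derive_val; apply: BP => j.
    have cs : (counts s j <= N)%N := leq_trans (count_size _ _) sN.
    by rewrite /incr; case: (j == i); rewrite ?add1n ?add0n ?ltnS// leqW.
  + rewrite (_ : 2 * _ * _ = A * d); last by rewrite /A; ring.
    apply: (@le_trans _ _ ((A + 1) * d)); first by rewrite ler_wpM2r ?(ltW d0)// lerDl.
    by rewrite /d le_eqVlt; apply/orP; left; apply/eqP; field; rewrite gt_eqF// ltr_wpDl.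
- have C1 : 0 < C + 1 by rewrite ltr_wpDl.
  by rewrite /t mulrCA ler_piMr ?(ltW e0)// ler_pdivrMr// mul1r lerDl.
Qed.

End distributions.

(** * Vanishing of distributions supported in a noncharacteristic hyperplane *)

Definition transpose_op (R : realType) m n (a : seq 'I_m -> 'rV[R]_m -> R[i])
    (h : 'rV[R]_m -> R[i]) : 'rV[R]_m -> R[i] :=
  fun y => \sum_(j < n.+1) \sum_(s : j.-tuple 'I_m)
    (-1) ^+ j * partialsC (rev s) (fun z => a s z * h z) y.

Lemma seq_bound (R : realType) m (f : seq 'I_m -> R) N : (forall s, 0 <= f s) ->
  exists2 C : R, 0 <= C & forall s, (size s <= N)%N -> f s <= C.
Proof.
move=> f0; exists (\sum_(j < N.+1) \sum_(s : j.-tuple 'I_m) f s) => [|s sN].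
  by rewrite sumr_ge0// => j _; rewrite sumr_ge0.
have sN' : (size s < N.+1)%N by [].
rewrite (bigD1 (Ordinal sN'))//= (bigD1 (in_tuple s))//= -addrA lerDl addr_ge0//.
  by rewrite sumr_ge0.
by rewrite sumr_ge0// => j _; rewrite sumr_ge0.
Qed.

Lemma derivatives_unique (R : realType) (phi : nat -> R -> R) k t :
  derivative_seq setT phi -> derivatives (phi 0%N) k t = phi k t.
Proof.
move=> dphi; elim: k t => [|k IH] t; first exact: derivatives0.
rewrite /derivatives /=.
have -> : partials (nseq k ord0) (fun y : 'rV[R]_1 => phi 0%N (y 0 0)) = fun y => phi k (y 0 0).
  apply/funext => y; rewrite -IH /derivatives; congr partials.
  by apply/rowP => i; rewrite mxE ord1.
rewrite /partial -[const_mx t]addr0 -[X in _ + X](scale0r (delta_mx 0 ord0 : 'rV[R]_1)).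
rewrite -(derive_line (fun y : 'rV[R]_1 => phi k (y 0 0)) (const_mx t) (delta_mx 0 ord0) 0).
have -> : (fun s : R => phi k ((const_mx t + s *: delta_mx 0 ord0 : 'rV[R]_1) 0 0)) =
    phi k \o (fun s => t + s).
  by apply/funext => s; rewrite !mxE !eqxx mulr1.
have ds : is_derive (0 : R) 1 (fun s : R => t + s) 1.
  by apply: is_derive_eq (is_deriveD _ _) _; rewrite add0r.
have dk : is_derive (t + 0) 1 (phi k) (phi k.+1 (t + 0)) by exact: dphi.
have h := @is_derive1_comp R _ (fun s => t + s) _ _ _ dk ds.
by rewrite derive_val mulr1 addr0.
Qed.

(* The functions [e^n gamma (t / e)], where [gamma t = t^n] near [0], agree with [t^n]
   near [0] and tend to [0] with all derivatives of order less than [n]. *)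
Lemma flat_power_cutoff (R : realType) n : exists2 C : R, 0 <= C & forall e : R, 0 < e <= 1 ->
  exists g : R -> R, [/\ smooth_on setT (fun y : 'rV[R]_1 => g (y 0 0)),
    forall t, `|t| < e -> g t = t ^+ n &
    forall k t, (k < n)%N -> `|derivatives g k t| <= C * e].
Proof.
(* [gam] equals [t ^ n] for [|t| <= 1]. Rescaling by [e] multiplies its [k]-th derivative by
   [e ^ (n - k)], which is at most [e] when [k < n] and [e <= 1]. *)
pose gam (t : R) := step (2 - t ^+ 2) * t ^+ n.
have sgam : smooth_on setT (fun y : 'rV[R]_1 => gam (y 0 0)).
  apply: smooth_onM; first exact: openT.
    apply: smooth_on_step; first exact: openT.
    apply: smooth_onB; [exact: openT|exact: smooth_on_cst|].
    by apply: smooth_onX; [exact: openT|exact: smooth_on_coord].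
  by apply: smooth_onX; [exact: openT|exact: smooth_on_coord].
have gam0 t : 2 < `|t| -> gam t = 0.
  move=> t2; rewrite /gam step_le0 ?mul0r// subr_le0 -[_ ^+ 2]real_normK ?num_real//.
  by rewrite expr2 (le_trans (ltW t2))// ler_peMr//; lra.
have /choice [C CP] : forall k, exists C : R, 0 <= C /\ forall t, `|derivatives gam k t| <= C.
  by move=> k; have [[C ? ?] _] := derivatives_bounded k sgam gam0; exists C.
exists (\sum_(k < n) C k) => [|e /andP[e0 e1]].
  by rewrite sumr_ge0// => k _; have [] := CP k.
have en0 : e != 0 by rewrite gt_eqF.
pose phi k t := e ^+ n * (e^-1 ^+ k * derivatives gam k (e^-1 * t + 0)).
have dphi : derivative_seq setT phi.
  move=> k t _.
  have h : is_derive t 1 (fun t => e^-1 ^+ k * derivatives gam k (e^-1 * t + 0))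
      (e^-1 ^+ k.+1 * derivatives gam k.+1 (e^-1 * t + 0)).
    exact: (derivative_seq_scale e^-1 0 (derivatives_seq sgam) k I).
  rewrite (_ : phi k = e ^+ n \*: (fun t => e^-1 ^+ k * derivatives gam k (e^-1 * t + 0)))//.
  exact: is_derive_eq (is_deriveZ _ _) _.
exists (phi 0%N); split.
- by apply: (smooth_on_comp1 0 dphi) => //; [exact: openT|exact: smooth_on_coord].
- move=> t te; rewrite /phi expr0 mul1r addr0 derivatives0 /gam step_ge1; last first.
    rewrite lerBrDl -lerBrDr (_ : 2 - 1 = 1 ^+ 2); last by ring.
    rewrite -[X in X <= _]real_normK ?num_real// ler_sqr ?nnegrE// normrM normfV.
    by rewrite (gtr0_norm e0) mulrC ler_pdivrMr// mul1r ltW.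
  by rewrite mul1r exprMn mulrA -exprMn divff// expr1n mul1r.
- move=> k t kn; rewrite (derivatives_unique _ _ dphi) /phi addr0 mulrA normrM mulrC.
  have -> : e ^+ n * e^-1 ^+ k = e ^+ (n - k).
    by rewrite exprVn -expfB_cond ?(negbTE en0)// ltnW.
  have e0' := ltW e0.
  rewrite [X in _ * X]ger0_norm ?exprn_ge0//.
  apply: ler_pM => //; first exact: exprn_ge0.
    by rewrite (le_trans ((CP k).2 _))// (bigD1 (Ordinal kn))//= lerDl sumr_ge0// => j _; exact: (CP j).1.
  have [j ->] : exists j, (n - k = j.+1)%N by exists (n - k).-1; rewrite prednK// subn_gt0.
  by rewrite exprS ler_piMr// exprn_ile1.
Qed.

Section local_vanishing.
Context {R : realType} {m : nat}.
Variables (W : set 'rV[R]_m) (F : ('rV[R]_m -> R[i]) -> R[i]) (xi : 'rV[R]_m).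
Variable a : seq 'I_m -> 'rV[R]_m -> R[i].
Hypotheses (oW : open W) (dF : is_distribution W F) (sa : forall s, smoothC_on W (a s)).

Definition linear_form (y : 'rV[R]_m) : R := \sum_i y 0 i * xi 0 i.

(** Vanishing on a whole strip about the hyperplane is what cutting off in terms of [linear_form]
    produces, so the support condition is used in this form. *)
Hypothesis F_support : forall K h (d : R), compact K -> K `<=` W -> test_fun K h -> 0 < d ->
  (forall y, `|linear_form y| < d -> h y = 0) -> F h = 0.
Hypothesis F_solution : forall K h, compact K -> K `<=` W -> test_fun K h ->
  F (transpose_op 2 a h) = 0.
Hypothesis noncharacteristic : forall y, W y ->
  \sum_(s : 2.-tuple 'I_m) a s y * \prod_(i <- s) (xi 0 i)%:C != 0.

Lemma smooth_linear_form : smooth_on setT linear_form.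
Proof.
apply: smooth_on_sum; first exact: openT.
move=> i; apply: smooth_onM; [exact: openT|exact: smooth_on_coord|exact: smooth_on_cst].
Qed.

Lemma partial_linear_form i y : partial i linear_form y = xi 0 i.
Proof.
have h := @partialsC_sum R m setT 'I_m (index_enum 'I_m) (fun j z => (z 0 j * xi 0 j)%:C) [:: i] y openT I.
apply: (@complexI R); rewrite -partialC_real -partialsC1.
rewrite (_ : (fun z => (linear_form z)%:C) = fun z => \sum_j (z 0 j * xi 0 j)%:C); last first.
  by apply/funext => z; rewrite rmorph_sum.
rewrite h => [|j]; last first.
  apply: smoothC_on_real; apply: smooth_onM; [exact: openT|exact: smooth_on_coord|exact: smooth_on_cst].
rewrite (bigD1 i)//= big1 ?addr0 => [|j ji].
  rewrite partialsC1 partialC_real partialM; [|exact: smooth_on_derivable (smooth_on_coord i) (I : setT y)|exact: derivable_cst].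
  by rewrite partial_coord eqxx mul1r /partial derive_cst mulr0 addr0.
rewrite partialsC1 partialC_real partialM; [|exact: smooth_on_derivable (smooth_on_coord j) (I : setT y)|exact: derivable_cst].
by rewrite partial_coord (negbTE ji) mul0r /partial derive_cst mulr0 addr0.
Qed.

Let lf (y : 'rV[R]_m) : R[i] := (linear_form y)%:C.

Let slf n : smoothC_on setT (fun y => lf y ^+ n).
Proof. by apply: smoothC_onX; [exact: openT|apply: smoothC_on_real; exact: smooth_linear_form]. Qed.

Let test_lf K n h : test_fun K h -> test_fun K (fun y => lf y ^+ n * h y).
Proof. exact: test_funM. Qed.

(** One derivative lowers the power of the linear form by at most one, and the term in which it does
    so carries a component of [xi]. *)
Let partialC_lf K n g i : test_fun K g -> partialC i (fun y => lf y ^+ n.+1 * g y) =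
  (fun y => n.+1%:R * (xi 0 i)%:C * (lf y ^+ n * g y) + lf y ^+ n.+1 * partialC i g y).
Proof.
move=> [sg _]; have p k y : partialC i (fun y => lf y ^+ k.+1) y = k.+1%:R * (xi 0 i)%:C * lf y ^+ k.
  elim: k => [|k IH].
    rewrite expr0 mulr1 mul1r -(partial_linear_form i y) -partialC_real.
    by congr partialC; apply/funext => z; rewrite expr1.
  have -> : (fun y => lf y ^+ k.+2) = (fun y => lf y ^+ 1 * lf y ^+ k.+1).
    by apply/funext => z; rewrite -exprD.
  rewrite (@partialCM _ _ setT)// IH.
  have -> : partialC i (fun z => lf z ^+ 1) y = (xi 0 i)%:C.
    rewrite -(partial_linear_form i y) -partialC_real.
    by congr partialC; apply/funext => z; rewrite expr1.
  by rewrite -[k.+2]addn1 natrD exprS; ring.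
apply/funext => y; rewrite (@partialCM _ _ setT)// p; ring.
Qed.

(** Near the hyperplane, [l ^ n] may be replaced by [g (l)] with [g] from [flat_power_cutoff]. Since
    [F] has order [N < n] on [K], the value is then bounded by a constant times [e] for every small
    [e], hence 0. *)
Let finite_order K : compact K -> K `<=` W ->
  exists N, forall n psi, (N < n)%N -> test_fun K psi -> F (fun y => lf y ^+ n * psi y) = 0.
Proof.
move=> cK KW; have [C [N [C0 CP]]] := dF.2 K cK KW.
exists N => n psi Nn tpsi; have [spsi _] := tpsi.
have [G G0 GP] := flat_power_cutoff R n.
have /choice [B BP] : forall s : seq 'I_m, exists B : R, 0 <= B /\
    forall h, smoothC_on setT h -> forall y t, K y -> 0 <= t ->
    (forall s' : seq 'I_1, (size s' <= size s)%N -> normc (partialsC s' h (const_mx (linear_form y))) <= t) ->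
    normc (partialsC s (fun z => psi z * h (const_mx (linear_form z))) y) <= B * t.
  move=> s.
  have [||B B0 BP] := @comp_bound R m 1 setT setT (fun y => const_mx (linear_form y)) K s psi
    openT openT _ _ cK (@subsetT _ _) spsi => //.
    move=> j; apply: smooth_on_congr smooth_linear_form; first exact: openT.
    by move=> z _; rewrite mxE.
  by exists B.
have [D D0 DP] := seq_bound N (fun s => (BP s).1).
apply: normc_eq0.
have main e : 0 < e <= 1 -> normc (F (fun y => lf y ^+ n * psi y)) <= C * (D * (G * e)).
  move=> e01; have [g [sg gn gG]] := GP e e01; have /andP[e0 _] := e01.
  pose h (y : 'rV[R]_1) := (g (y 0 0))%:C.
  have sh : smoothC_on setT h by exact: smoothC_on_real.
  pose h1 y := psi y * h (const_mx (linear_form y)).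
  have sgl : smoothC_on setT (fun y => h (const_mx (linear_form y))).
    apply: (@smoothC_on_comp _ _ _ setT setT (fun y => const_mx (linear_form y))) => //; try exact: openT.
    move=> j; apply: smooth_on_congr smooth_linear_form; first exact: openT.
    by move=> z _; rewrite mxE.
  have th1 : test_fun K h1.
    have := test_funM sgl tpsi; congr test_fun; apply/funext => y; exact: mulrC.
  (* The two functions agree on the strip [|l| < e], so the support hypothesis applies to their
     difference. *)
  have -> : F (fun y => lf y ^+ n * psi y) = F h1.
    apply/eqP; rewrite -subr_eq0 -(distributionB dF cK KW (test_lf n tpsi) th1).
    apply/eqP; apply: (F_support cK KW (test_funB (test_lf n tpsi) th1) e0) => y ye.
    by rewrite /h1 /h mxE gn// rmorphXn/= mulrC subrr.
  have GE : 0 <= G * e by rewrite mulr_ge0// ltW.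
  apply: CP => // [|s y sN]; first exact: mulr_ge0.
  have [Ky|Ky] := pselect (K y); last first.
    by rewrite (test_fun_partialsC s cK th1).2// normc0 mulr_ge0.
  apply: (@le_trans _ _ (B s * (G * e))); last by rewrite ler_wpM2r// DP.
  apply: (BP s).2 => // s' ss'.
  (* In dimension 1 a sequence of directions is determined by its length. *)
  have -> : s' = nseq (size s') ord0 by elim: {ss'} s' => //= j s' <-; rewrite (ord1 j).
  rewrite /h partialsC_real normc_real; apply: gG.
  exact: leq_ltn_trans (leq_trans ss' sN) Nn.
apply/ler_addgt0Pr => e e0; rewrite add0r.
pose A := C * (D * G); have A0 : 0 <= A by rewrite !mulr_ge0.
pose e' := Num.min 1 (e / (A + 1)).
have e'0 : 0 < e' by rewrite lt_min ltr01 divr_gt0// ltr_wpDl.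
apply: (le_trans (main e' _)); first by rewrite e'0 ge_min lexx.
rewrite !mulrA -/A (_ : C * D * G = A); last by rewrite /A; ring.
apply: (@le_trans _ _ (A * (e / (A + 1)))); first by rewrite ler_wpM2l// ge_min lexx orbT.
have A1 : 0 < A + 1 by rewrite ltr_wpDl.
by rewrite mulrCA ler_piMr ?(ltW e0)// ler_pdivrMr// mul1r lerDl.
Qed.

Lemma local_vanishing K h : compact K -> K `<=` W -> test_fun K h -> F h = 0.
Proof.
move=> cK KW th; have [N NP] := finite_order cK KW.
suff H k psi : test_fun K psi -> F (fun y => lf y ^+ k * psi y) = 0.
  by rewrite -(H 0%N h th); congr F; apply/funext => y; rewrite expr0 mul1r.
(* Descending induction on [k], started by [finite_order] for [k > N]. *)
have [j] := ubnP (N.+1 - k); elim: j k psi => // j IH k psi kj tpsi.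
have [Nk|kN] := ltnP N k; first exact: NP.
have kill n g : (k < n)%N -> test_fun K g -> F (fun y => lf y ^+ n * g y) = 0.
  by move=> kn tg; apply: IH => //; lia.
pose Q y := \sum_(s : 2.-tuple 'I_m) a s y * \prod_(i <- s) (xi 0 i)%:C.
have sQ : smoothC_on W Q.
  by apply: smoothC_on_sum => // s; apply: smoothC_onM => //; exact: smoothC_on_cst.
(* [phi] undoes the symbol [Q] and the factor [(k + 2) * (k + 1)] of a double derivative of
   [l ^ (k + 2)]. The transposed operator then sends [l ^ (k + 2) * phi] to [l ^ k * psi] up to
   terms with a factor [l ^ (k + 1)]. *)
pose b : R[i] := (k.+2%:R * k.+1%:R)^-1.
pose phi y := b * ((Q y)^-1 * psi y).
have tphi : test_fun K phi.
  by apply: test_funZ; apply: (test_fun_mul_local cK oW KW (smoothC_onV oW noncharacteristic sQ)).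
have tas s g : test_fun K g -> test_fun K (fun y => a s y * g y).
  by move=> tg; exact: test_fun_mul_local cK oW KW (sa s) tg.
pose g s y := a s y * phi y.
have tg s : test_fun K (g s) by exact: tas.
have tgk s n : test_fun K (fun y => lf y ^+ n * g s y) by exact: test_lf.
have sol := F_solution cK KW (test_lf k.+2 tphi).
have e1 s : (fun z => a s z * (lf z ^+ k.+2 * phi z)) = (fun z => lf z ^+ k.+2 * g s z).
  by apply/funext => z; rewrite /g mulrCA.
(* At most one derivative leaves a factor [l ^ (k + 1)], which the induction hypothesis kills. *)
have low (s : seq 'I_m) : (size s < 2)%N -> F (partialsC (rev s) (fun z => lf z ^+ k.+2 * g s z)) = 0.
  case: s => [|i [|//]] _; first by rewrite partialsC_nil kill.
  rewrite partialsC1 (partialC_lf k.+1 i (tg _)).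
  rewrite (distributionD dF cK KW); [|exact/test_funZ/test_lf|exact/test_lf/test_fun_partialC].
  rewrite (distributionZ dF _ cK KW (test_lf _ (tg _))) !kill ?mulr0 ?addr0//.
  exact: test_fun_partialC.
have top (s : 2.-tuple 'I_m) : F (partialsC (rev s) (fun z => lf z ^+ k.+2 * g s z)) =
    F (fun y => lf y ^+ k * ((k.+2%:R * k.+1%:R) * (\prod_(i <- s) (xi 0 i)%:C * g s y))).
  case: s => -[|i [|i' [|]]]//= hs; set s := [:: i; i'].
  rewrite (_ : rev s = rcons [:: i'] i)// partialsC_rcons partialsC1.
  rewrite (partialC_lf k.+1 i (tg _)).
  have td : test_fun K (partialC i (g s)) by exact: test_fun_partialC.
  have t1 : test_fun K (fun y => k.+2%:R * (xi 0 i)%:C * (lf y ^+ k.+1 * g s y)).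
    exact/test_funZ/test_lf.
  have t2 : test_fun K (fun y => lf y ^+ k.+2 * partialC i (g s) y) by exact: test_lf.
  (* [G] gathers the terms in which at least one of the two derivatives falls on [g s]; they share
     the factor [l ^ (k + 1)]. *)
  pose G y := k.+2%:R * (xi 0 i)%:C * partialC i' (g s) y +
    (k.+2%:R * (xi 0 i')%:C * partialC i (g s) y + lf y ^+ 1 * partialC i' (partialC i (g s)) y).
  have tG : test_fun K G.
    apply: test_funD; first exact/test_funZ/test_fun_partialC.
    by apply: test_funD; [exact: test_funZ|exact/test_lf/test_fun_partialC].
  pose c : R[i] := k.+2%:R * k.+1%:R.
  have tpg : test_fun K (fun y => c * (\prod_(j <- s) (xi 0 j)%:C * g s y)).
    by apply: test_funZ; exact: test_funZ.
  have -> : partialC i' (fun y => k.+2%:R * (xi 0 i)%:C * (lf y ^+ k.+1 * g s y) +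
        lf y ^+ k.+2 * partialC i (g s) y) =
      (fun y => lf y ^+ k * (c * (\prod_(j <- s) (xi 0 j)%:C * g s y)) + lf y ^+ k.+1 * G y).
    apply/funext => y; rewrite (@partialCD _ _ setT)//; [|exact: t1.1|exact: t2.1].
    rewrite (@partialCZ _ _ setT)//; last exact: (test_lf _ (tg _)).1.
    rewrite (partialC_lf k i' (tg _)) (partialC_lf k.+1 i' td).
    by rewrite !big_cons big_nil /G /c !exprS expr0; ring.
  by rewrite (distributionD dF cK KW (test_lf k tpg) (test_lf k.+1 tG)) (kill k.+1 G)// addr0.
have -> : F (fun y => lf y ^+ k * psi y) = F (transpose_op 2 a (fun y => lf y ^+ k.+2 * phi y)) => //.
have tt l (s : l.-tuple 'I_m) : test_fun K (fun y => (-1) ^+ l *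
    partialsC (rev s) (fun z => a s z * (lf z ^+ k.+2 * phi z)) y).
  by apply: test_funZ; apply: test_fun_partialsC => //; rewrite e1.
rewrite (distribution_sum dF _ cK KW) => [|j']; last exact: test_fun_sum.
rewrite big_ord_recr /= big1 ?add0r => [|j' _]; last first.
  rewrite (distribution_sum dF _ cK KW)// big1// => s _.
  rewrite (distributionZ dF _ cK KW); last by apply: test_fun_partialsC => //; rewrite e1.
  by rewrite e1 low ?mulr0// size_tuple; exact: ltn_ord.
rewrite (distribution_sum dF _ cK KW) => [|s]; last exact: (tt 2).
pose u (s : 2.-tuple 'I_m) y := lf y ^+ k * ((k.+2%:R * k.+1%:R) * (\prod_(i <- s) (xi 0 i)%:C * g s y)).
have tu s : test_fun K (u s) by apply: test_lf; apply: test_funZ; exact: test_funZ.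
rewrite (eq_bigr (fun s => F (u s))) => [|s _]; last first.
  rewrite -top -e1; congr F; apply/funext => y.
  by rewrite expr2 mulN1r opprK mul1r.
rewrite -(distribution_sum dF _ cK KW tu).
congr F; apply/funext => y; rewrite /u -mulr_sumr -mulr_sumr.
have [Ky|Ky] := pselect (K y); last first.
  rewrite (tpsi.2 y Ky) big1 ?mulr0// => s _.
  by rewrite (tg s).2// mulr0.
congr (_ * _); rewrite (_ : \sum_s _ = Q y * phi y); last first.
  by rewrite /Q mulr_suml; apply: eq_bigr => s _; rewrite /g; ring.
have Q0 : Q y != 0 by apply: noncharacteristic; exact: KW.
rewrite /phi /b; field.
by rewrite Q0 -(natrD _ 1 k) -(natrD _ 2 k) !pnatr_eq0.
Qed.

End local_vanishing.

(** * Smooth functions and densities on manifolds *)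

Section charts.
Context {R : realType} {m : nat} {M : manifold R m}.
Implicit Types (c : chart R m M) (x : M) (y : 'rV[R]_m).

Lemma cinvK c y : (c @` cdom c) y -> c (cinv c y) = y.
Proof. by move=> [x cx <-]; rewrite cmapK. Qed.

Lemma cinv_cdom c y : (c @` cdom c) y -> cdom c (cinv c y).
Proof. by move=> [x cx <-]; rewrite cmapK. Qed.

Lemma cimageE c (W : set M) : c @` (cdom c `&` W) = (c @` cdom c) `&` (cinv c @^-1` W).
Proof.
apply/seteqP; split=> [_ [x [cx Wx] <-]|y [[x cx <-]]] /=.
  by split; [exists x|rewrite /= cmapK].
by rewrite /= cmapK// => Wx; exists x.
Qed.

Lemma cimage_sub c (W : set M) : c @` (cdom c `&` W) `<=` c @` cdom c.
Proof. by move=> _ [x [cx _] <-]; exists x. Qed.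

Lemma continuous_preimage_open (T T' : topologicalType) (g : T -> T') (V : set T) (O : set T') :
  open V -> (forall z, V z -> {for z, continuous g}) -> open O -> open (V `&` g @^-1` O).
Proof.
move=> oV cg oO; rewrite openE => z [Vz Oz].
apply: filterI; first by apply: open_nbhs_nbhs; split.
by apply: (cg z Vz); apply: open_nbhs_nbhs; split.
Qed.

Lemma open_cimage c (W : set M) : open W -> open (c @` (cdom c `&` W)).
Proof.
move=> oW; rewrite cimageE; apply: continuous_preimage_open => //.
  exact: cimage_open.
exact: cinv_continuous.
Qed.

Lemma open_cpreimage c (V : set 'rV[R]_m) : open V -> open (cdom c `&` c @^-1` V).
Proof.
by apply: continuous_preimage_open; [exact: cdom_open|exact: cmap_continuous].
Qed.

Lemma continuous_on_compact (T T' : topologicalType) (g : T -> T') (K : set T) :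
  (forall z, K z -> {for z, continuous g}) -> compact K -> compact (g @` K).
Proof.
move=> cg cK; apply: continuous_compact => //.
by apply: continuous_in_subspaceT => z /set_mem; exact: cg.
Qed.

Lemma compact_cimage c (K : set M) : compact K -> K `<=` cdom c -> compact (c @` K).
Proof.
by move=> cK Kc; apply: continuous_on_compact => // z /Kc; exact: cmap_continuous.
Qed.

Lemma compact_cinv c (L : set 'rV[R]_m) : compact L -> L `<=` c @` cdom c ->
  compact (cinv c @` L).
Proof.
by move=> cL Lc; apply: continuous_on_compact => // z /Lc; exact: cinv_continuous.
Qed.

Lemma compact_closed_manifold (K : set M) : compact K -> closed K.
Proof. exact: compact_closed (@carrier_hausdorff R m M). Qed.

Lemma transition_smooth c c' (W : set M) : atlas c -> atlas c' -> W `<=` cdom c' ->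
  forall j, smooth_on (c @` (cdom c `&` W)) (fun y => c' (cinv c y) 0 j).
Proof.
move=> ac ac' Wc' j; have [h _] := atlas_compatible ac ac'.
by apply: smooth_on_sub (h j) => _ [x [cx /Wc' c'x] <-]; exists x.
Qed.

(** Transition maps are smooth, so one chart about each point is enough. *)
Lemma smooth_fun_local (g : M -> R[i]) :
  (forall x, exists c W, [/\ atlas c, open W, W x, W `<=` cdom c &
     smoothC_on (c @` W) (g \o cinv c)]) -> smooth_fun setT g.
Proof.
move=> loc c' ac'; apply: smoothC_on_local => _ [x [c'x _] <-].
have [c [W [ac oW Wx Wc sg]]] := loc x.
exists (c' @` (cdom c' `&` W)); first by exists x.
have oV : open (c' @` (cdom c' `&` W)) by exact: open_cimage.
have oV' : open (c @` W).
  by rewrite -[W](setIidr Wc); exact: open_cimage.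
have h := smoothC_on_comp oV oV' _ (transition_smooth ac' ac Wc) sg.
apply: (smoothC_on_congr oV _ (h _)) => [_ [z [c'z Wz] <-]|_ [z [c'z Wz] <-]].
  by rewrite /= cmapK// cmapK//; exact: Wc.
by exists z => //; rewrite cmapK.
Qed.

Lemma smooth_fun_on c (g : M -> R[i]) : smooth_fun setT g -> atlas c ->
  smoothC_on (c @` cdom c) (g \o cinv c).
Proof. by move=> sg ac; have := sg c ac; rewrite setIT. Qed.

Lemma smooth_funP (g : M -> R[i]) :
  (forall c, atlas c -> smoothC_on (c @` cdom c) (g \o cinv c)) <-> smooth_fun setT g.
Proof.
split=> [h c ac|sg c]; last exact: smooth_fun_on.
by rewrite setIT; exact: h.
Qed.

Lemma smooth_funD (g h : M -> R[i]) : smooth_fun setT g -> smooth_fun setT h ->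
  smooth_fun setT (fun x => g x + h x).
Proof.
move=> sg sh; apply/smooth_funP => c ac.
exact: (smoothC_onD (@cimage_open _ _ _ c) (smooth_fun_on sg ac) (smooth_fun_on sh ac)).
Qed.

Lemma smooth_funM (g h : M -> R[i]) : smooth_fun setT g -> smooth_fun setT h ->
  smooth_fun setT (fun x => g x * h x).
Proof.
move=> sg sh; apply/smooth_funP => c ac.
exact: (smoothC_onM (@cimage_open _ _ _ c) (smooth_fun_on sg ac) (smooth_fun_on sh ac)).
Qed.

Lemma smooth_fun_cst (a : R[i]) : smooth_fun [set: M] (fun=> a).
Proof. by move=> c _; exact: smoothC_on_cst. Qed.

Lemma smooth_fun_sum I (r : seq I) (g : I -> M -> R[i]) : (forall i, smooth_fun setT (g i)) ->
  smooth_fun setT (fun x => \sum_(i <- r) g i x).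
Proof.
move=> sg; apply/smooth_funP => c ac.
exact: (smoothC_on_sum r (@cimage_open _ _ _ c) (fun i => smooth_fun_on (sg i) ac)).
Qed.

Definition lift (c : chart R m M) (T : zmodType) (b : 'rV[R]_m -> T) (x : M) : T :=
  if x \in cdom c then b (c x) else 0.

Lemma lift_in c (T : zmodType) (b : 'rV[R]_m -> T) x : cdom c x -> lift c b x = b (c x).
Proof. by move=> cx; rewrite /lift mem_set. Qed.

Lemma lift_out c (T : zmodType) L (b : 'rV[R]_m -> T) x :
  (forall y, ~ L y -> b y = 0) -> L `<=` c @` cdom c -> ~ (cinv c @` L) x -> lift c b x = 0.
Proof.
move=> bL Lc Lx; rewrite /lift; case: ifPn => // /set_mem cx.
by apply: bL => Lcx; apply: Lx; exists (c x) => //; rewrite cmapK.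
Qed.

(** Outside the chart domain, the extension vanishes on the complement of the compact image of [L],
    which is open because the manifold is Hausdorff. *)
Lemma lift_smooth c L (b : 'rV[R]_m -> R[i]) : atlas c -> compact L -> L `<=` c @` cdom c ->
  test_fun L b -> smooth_fun setT (lift c b).
Proof.
move=> ac cL Lc [sb bL]; apply: smooth_fun_local => x.
have [cx|cx] := pselect (cdom c x).
  exists c, (cdom c); split=> //; first exact: cdom_open.
  apply: (smoothC_on_congr (@cimage_open _ _ _ c) _ (smoothC_on_sub (@subsetT _ _) sb)) => y cy.
  by rewrite /= lift_in ?cinvK//; exact: cinv_cdom.
have [ac' c'x] := chart_atP x; set c' := chart_at x in ac' c'x.
pose K := cinv c @` L.
have oK : open (~` K) by apply: closed_openC; apply: compact_closed_manifold; exact: compact_cinv.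
exists c', (cdom c' `&` ~` K); split=> //.
- by apply: openI; [exact: cdom_open|exact: oK].
- by split=> // -[y Ly e]; apply: cx; rewrite -e; apply: cinv_cdom; exact: Lc.
- have oV : open (c' @` (cdom c' `&` ~` K)) by exact: open_cimage oK.
  apply: (smoothC_on_congr oV _ (smoothC_on_cst _ 0)) => _ [z [c'z Kz] <-].
  by rewrite /= cmapK// (lift_out bL Lc).
Qed.

End charts.

(** The sign of [f] is locally constant. This is meant for the absolute values of Jacobian
    determinants. *)
Lemma smooth_on_norm (R : realType) n (V : set 'rV[R]_n) (f : 'rV[R]_n -> R) : open V ->
  (forall y, V y -> f y != 0) -> smooth_on V f -> smooth_on V (fun y => `|f y|).
Proof.
move=> oV f0 sf; apply: smooth_on_local => y Vy.
have cf z : V z -> {for z, continuous f} by exact: smooth_on_cont.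
have [fy|fy] := ltP 0 (f y).
  have oW : open (V `&` f @^-1` [set t | 0 < t]).
    by apply: continuous_preimage_open => //; exact: open_gt.
  exists (V `&` f @^-1` [set t | 0 < t]) => //.
  apply: (smooth_on_congr oW _ (smooth_on_sub _ sf)) => [z [_ /= fz]|z []//].
  by rewrite gtr0_norm.
have fy' : f y < 0 by rewrite lt_neqAle fy f0.
have oW : open (V `&` f @^-1` [set t | t < 0]).
  by apply: continuous_preimage_open => //; exact: open_lt.
exists (V `&` f @^-1` [set t | t < 0]) => //.
apply: (smooth_on_congr oW _ (smooth_onN oW (smooth_on_sub _ sf))) => [z [_ /= fz]|z []//].
by rewrite ltr0_norm.
Qed.

Section jacobians.
Context {R : realType} {m : nat} {M : manifold R m}.
Implicit Types (c : chart R m M) (x : M) (y : 'rV[R]_m).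

Lemma jac_comp c c' c'' x : atlas c -> atlas c' -> atlas c'' ->
  cdom c x -> cdom c' x -> cdom c'' x -> jac c c'' x = jac c c' x *m jac c' c'' x.
Proof.
move=> ac ac' ac'' cx c'x c''x; apply/matrixP => i j; rewrite !mxE.
pose V := c @` (cdom c `&` (cdom c' `&` cdom c'')).
pose W := c' @` (cdom c' `&` cdom c'').
have oV : open V by apply: open_cimage; apply: openI; exact: cdom_open.
have oW : open W by apply: open_cimage; exact: cdom_open.
have Vx : V (c x) by exists x.
have VW y : V y -> W (c' (cinv c y)) by move=> [z [cz [c'z c''z]] <-]; rewrite cmapK//; exists z.
have sF k : smooth_on V (fun y => c' (cinv c y) 0 k).
  by apply: transition_smooth => // z [].
have sg : smooth_on W (fun y => c'' (cinv c' y) 0 j) by exact: transition_smooth.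
rewrite (@partial_congr _ _ V _ (fun y => c'' (cinv c' (c' (cinv c y))) 0 j))//; last first.
  by move=> _ [z [cz [c'z c''z]] <-]; rewrite cmapK// cmapK.
have h := partial_comp oW VW sF i Vx sg.
rewrite /partial derive_val; apply: eq_bigr => k _.
by rewrite !mxE cmapK// mulrC.
Qed.

Lemma jac_id c x : atlas c -> cdom c x -> jac c c x = 1%:M.
Proof.
move=> ac cx; apply/matrixP => i j; rewrite !mxE.
rewrite (@partial_congr _ _ (c @` cdom c) _ (fun y => y 0 j)).
- by rewrite partial_coord eq_sym.
- exact: cimage_open.
- by exists x.
- by move=> y cy; rewrite cinvK.
Qed.

Lemma det_jac_neq0 c c' x : atlas c -> atlas c' -> cdom c x -> cdom c' x -> \det (jac c c' x) != 0.
Proof.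
move=> ac ac' cx c'x; apply/eqP => d0.
have := congr1 determinant (jac_comp ac ac' ac cx c'x cx).
rewrite jac_id// det1 det_mulmx d0 mul0r => /eqP; by rewrite oner_eq0.
Qed.

Lemma det_jac_smooth c c' : atlas c -> atlas c' ->
  smooth_on (c @` (cdom c `&` cdom c')) (fun y => `|\det (jac c c' (cinv c y))|).
Proof.
move=> ac ac'; have oV : open (c @` (cdom c `&` cdom c')) by apply: open_cimage; exact: cdom_open.
apply: smooth_on_norm => //.
  by move=> _ [x [cx c'x] <-]; rewrite cmapK//; exact: det_jac_neq0.
apply: smooth_on_sum => // s; apply: smooth_onM => //; first exact: smooth_on_cst.
apply: smooth_on_prod => // i.
have sj j : smooth_on (c @` (cdom c `&` cdom c')) (fun z => jac c c' (cinv c z) i j).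
  have := smooth_on_partial i (transition_smooth ac ac' (@subset_refl _ (cdom c')) j).
  apply: smooth_on_congr => // _ [x [cx c'x] <-].
  by rewrite mxE cmapK.
exact: sj.
Qed.

End jacobians.

Section densities.
Context {R : realType} {m : nat} {M : manifold R m}.
Implicit Types (c : chart R m M) (x : M) (y : 'rV[R]_m) (r : density M) (K U : set M).

(** The density with coefficient [b] in [c], extended by 0 and transported to the other charts by
    the Jacobian. On densities supported in the chart domain, [pull] is its inverse. *)
Definition dlift (c : chart R m M) (b : 'rV[R]_m -> R[i]) : density M :=
  fun c' x => lift c (fun y => `|\det (jac c' c (cinv c y))|%:C * b y) x.

Definition pull (c : chart R m M) (r : density M) : 'rV[R]_m -> R[i] :=
  fun y => if y \in c @` cdom c then r c (cinv c y) else 0.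

Lemma pull_in c r x : cdom c x -> pull c r (c x) = r c x.
Proof. by move=> cx; rewrite /pull mem_set ?cmapK//; exists x. Qed.

Lemma dlift_in c b c' x : cdom c x -> dlift c b c' x = `|\det (jac c' c x)|%:C * b (c x).
Proof. by move=> cx; rewrite /dlift lift_in// cmapK. Qed.

Lemma dlift_out c L b c' x : (forall y, ~ L y -> b y = 0) -> L `<=` c @` cdom c ->
  ~ (cinv c @` L) x -> dlift c b c' x = 0.
Proof. by move=> bL Lc; apply: lift_out => // y /bL ->; rewrite mulr0. Qed.

Lemma dlift_supported c L b : atlas c -> compact L -> L `<=` c @` cdom c ->
  test_fun L b -> supported_density (cinv c @` L) (dlift c b).
Proof.
move=> ac cL Lc [sb bL]; split; last by move=> c' x _ _; exact: dlift_out.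
split=> [c' ac'|c' c'' x ac' ac'' c'x c''x]; last first.
  have [cx|cx] := pselect (cdom c x).
    rewrite !dlift_in// (jac_comp ac' ac'' ac c'x c''x cx) det_mulmx normrM rmorphM.
    by rewrite -mulrA.
  by rewrite /dlift /lift !memNset// mulr0.
apply: smoothC_on_local => _ [x c'x <-].
have [cx|cx] := pselect (cdom c x).
  have oV : open (c' @` (cdom c' `&` cdom c)) by apply: open_cimage; exact: cdom_open.
  exists (c' @` (cdom c' `&` cdom c)); first by exists x.
  have sF := transition_smooth ac' ac (@subset_refl _ (cdom c)).
  have sbF : smoothC_on (c' @` (cdom c' `&` cdom c)) (fun y => b (c (cinv c' y))).
    by apply: (@smoothC_on_comp _ _ _ _ setT (fun y => c (cinv c' y))) => //; exact: openT.
  apply: (smoothC_on_congr oV _ (smoothC_onM oV (smoothC_on_real (det_jac_smooth ac' ac)) sbF)).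
  by move=> _ [z [c'z cz] <-]; rewrite /= cmapK// dlift_in.
have oK : open (~` (cinv c @` L)).
  by apply: closed_openC; apply: compact_closed_manifold; exact: compact_cinv.
have oV : open (c' @` (cdom c' `&` ~` (cinv c @` L))) by exact: open_cimage.
exists (c' @` (cdom c' `&` ~` (cinv c @` L))).
  exists x => //; split=> // -[y Ly e]; apply: cx; rewrite -e; apply: cinv_cdom; exact: Lc.
apply: (smoothC_on_congr oV _ (smoothC_on_cst _ 0)) => _ [z [c'z Kz] <-].
by rewrite /= cmapK// (dlift_out _ bL Lc).
Qed.

Lemma pull_test_fun_on c r K : compact K -> K `<=` cdom c ->
  smoothC_on (c @` cdom c) (r c \o cinv c) -> (forall x, cdom c x -> ~ K x -> r c x = 0) ->
  test_fun (c @` K) (pull c r).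
Proof.
move=> cK Kc sr rK.
have h0 y : ~ (c @` K) y -> pull c r y = 0.
  move=> Ky; rewrite /pull; case: ifPn => // /set_mem cy.
  apply: rK => [|Kc']; first exact: cinv_cdom.
  by apply: Ky; exists (cinv c y) => //; rewrite cinvK.
split=> //; apply: smoothC_on_local => y _.
have [cy|cy] := pselect ((c @` cdom c) y).
  exists (c @` cdom c); first exact: cy.
  apply: (smoothC_on_congr (@cimage_open _ _ _ c) _ sr) => z cz.
  by rewrite /pull mem_set.
have oK : open (~` (c @` K)).
  apply: closed_openC; apply: compact_closed; first exact: norm_hausdorff.
  exact: compact_cimage.
exists (~` (c @` K)); first by move=> [x /Kc cx e]; apply: cy; exists x.
by apply: (smoothC_on_congr oK _ (smoothC_on_cst _ 0)) => z /h0.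
Qed.

Lemma pull_test_fun c r K : atlas c -> compact K -> K `<=` cdom c -> supported_density K r ->
  test_fun (c @` K) (pull c r).
Proof.
move=> ac cK Kc [[sr _] rK]; apply: pull_test_fun_on => //; first exact: sr.
by move=> x cx; exact: rK.
Qed.

Lemma dlift_pull c r K c' x : atlas c -> atlas c' -> K `<=` cdom c -> supported_density K r ->
  cdom c' x -> dlift c (pull c r) c' x = r c' x.
Proof.
move=> ac ac' Kc [[_ tr] rK] c'x; have [cx|cx] := pselect (cdom c x).
  by rewrite dlift_in// pull_in// -tr.
by rewrite /dlift /lift memNset// rK// => /Kc.
Qed.

Lemma pull_dlift c L b : atlas c -> L `<=` c @` cdom c -> test_fun L b -> pull c (dlift c b) = b.
Proof.
move=> ac Lc [_ bL]; apply/funext => y; rewrite /pull; case: ifPn => [/set_mem cy|/negP cy].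
  rewrite dlift_in; last exact: cinv_cdom.
  by rewrite jac_id//; [rewrite det1 normr1 mul1r cinvK|exact: cinv_cdom].
by rewrite bL// => /Lc cy'; apply: cy; exact: mem_set.
Qed.

Lemma supported_density_scale K (u : M -> R[i]) r : smooth_fun setT u -> supported_density K r ->
  supported_density K (density_scale u r).
Proof.
move=> su [[sr tr] rK]; split; last by move=> c x ac cx Kx; rewrite /density_scale rK// mulr0.
split=> [c ac|c c' x ac ac' cx c'x]; last first.
  by rewrite /density_scale (tr c c')// mulrCA.
exact: (smoothC_onM (@cimage_open _ _ _ c) (smooth_fun_on su ac) (sr c ac)).
Qed.

Lemma supported_density_scale_in K L (u : M -> R[i]) r : smooth_fun setT u ->
  (forall x, ~ L x -> u x = 0) -> supported_density K r -> supported_density (K `&` L) (density_scale u r).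
Proof.
move=> su uL sr; have [h _] := supported_density_scale su sr; split=> // c x ac cx /not_andP[Kx|Lx].
  by rewrite /density_scale (sr.2 c x)// mulr0.
by rewrite /density_scale uL// mul0r.
Qed.

Lemma supported_densityW K L r : K `<=` L -> supported_density K r -> supported_density L r.
Proof. by move=> KL [sr rK]; split=> // c x ac cx Lx; apply: rK => // /KL. Qed.

Lemma supported_density_lin K a r r' : supported_density K r -> supported_density K r' ->
  supported_density K (density_lin a r r').
Proof.
move=> [[sr tr] rK] [[sr' tr'] rK']; split; last first.
  by move=> c x ac cx Kx; rewrite /density_lin rK// rK'// mulr0 addr0.
split=> [c ac|c c' x ac ac' cx c'x]; last first.
  by rewrite /density_lin (tr c c')// (tr' c c')// mulrDr mulrCA.
have oc := @cimage_open _ _ _ c.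
exact: (smoothC_onD oc (smoothC_onZ a oc (sr c ac)) (sr' c ac)).
Qed.

Lemma test_density_supported U K r : compact K -> K `<=` U -> supported_density K r -> test_density U r.
Proof. by move=> cK KU sr; exists K. Qed.

Lemma test_density_lin U a r r' : test_density U r -> test_density U r' ->
  test_density U (density_lin a r r').
Proof.
move=> [K [cK KU sr]] [K' [cK' KU' sr']]; exists (K `|` K'); split.
- exact: compactU.
- by move=> x [/KU|/KU'].
- apply: supported_density_lin; first by apply: supported_densityW sr; exact: subsetUl.
  by apply: supported_densityW sr'; exact: subsetUr.
Qed.

Lemma test_density_scale U (u : M -> R[i]) r : smooth_fun setT u -> test_density U r ->
  test_density U (density_scale u r).
Proof. by move=> su [K [cK KU sr]]; exists K; split=> //; exact: supported_density_scale. Qed.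

Lemma supported_density0 K : supported_density K (fun _ _ => 0 : R[i]).
Proof. by split=> //; split=> [c ac|c c' x *]; [exact: smoothC_on_cst|rewrite mulr0]. Qed.

Lemma supported_density_partialsC c K r x s : atlas c -> compact K -> cdom c x -> ~ K x ->
  supported_density K r -> partialsC s (r c \o cinv c) (c x) = 0.
Proof.
move=> ac cK cx Kx [_ rK].
have oK : open (~` K) by apply: closed_openC; exact: compact_closed_manifold.
have oV : open (c @` (cdom c `&` ~` K)) by exact: open_cimage.
rewrite (@partialsC_congr _ _ (c @` (cdom c `&` ~` K)) _ (fun=> 0))//.
- by rewrite partialsC0.
- by move=> _ [z [cz Kz] <-]; rewrite /= cmapK// rK.
- by exists x.
Qed.

End densities.

(** * Generalized functions read in charts *)

Section generalized_functions.
Context {R : realType} {m : nat} {M : manifold R m} {U : set M}.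
Implicit Types (c : chart R m M) (f : gen_fun U) (r : density M) (K : set M).

(** Densities are represented by total functions, so a representative of the zero density may be
    nonzero off the atlas or off chart domains. All seminorms in the continuity estimate vanish on
    it, which forces the value 0. *)
Lemma gf0 f r : (forall c x, atlas c -> cdom c x -> r c x = 0) -> f r = 0.
Proof.
move=> r0; have sr : supported_density set0 r.
  split=> [|c x ac cx _]; last exact: r0.
  split=> [c ac|c c' x ac ac' cx c'x]; last by rewrite !r0// mulr0.
  apply: (smoothC_on_congr (@cimage_open _ _ _ c) _ (smoothC_on_cst _ 0)) => _ [x cx <-].
  by rewrite /= cmapK// r0.
have [_ _ h] := gf_continuous f.
have [B [n [c [L [s [hL hB]]]]]] := h set0 (@compact0 _) (@sub0set _ _).
apply: normc_eq0; rewrite -(mulr0 B); apply: hB => // j x Lx.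
have [ac _ Lc] := hL j; have cx := Lc x Lx.
by rewrite (supported_density_partialsC _ ac (@compact0 _) cx _ sr)// normc0.
Qed.

Lemma gf_ext f r r' : test_density U r -> test_density U r' ->
  (forall c x, atlas c -> cdom c x -> r c x = r' c x) -> f r = f r'.
Proof.
move=> tr tr' e; have := gf_linear f (-1) tr tr'.
rewrite (@gf0 f (density_lin (-1) r r')) => [|c x ac cx].
  by move=> /esym/eqP; rewrite mulN1r addrC subr_eq0 => /eqP.
by rewrite /density_lin e// mulN1r addNr.
Qed.

Lemma gf_scale_sum f (n : nat) (u : 'I_n -> M -> R[i]) r : test_density U r ->
  (forall k, smooth_fun setT (u k)) ->
  f (density_scale (fun x => \sum_k u k x) r) = \sum_k f (density_scale (u k) r).
Proof.
move=> tr su.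
suff H (s : seq 'I_n) : f (density_scale (fun x => \sum_(k <- s) u k x) r) =
    \sum_(k <- s) f (density_scale (u k) r) by exact: H.
elim: s => [|k s IH].
  rewrite big_nil; apply: gf0 => c x _ _.
  by rewrite /density_scale big_nil mul0r.
have t1 : test_density U (density_scale (u k) r) by exact: test_density_scale.
have t2 : test_density U (density_scale (fun x => \sum_(k <- s) u k x) r).
  by apply: test_density_scale => //; exact: smooth_fun_sum.
have e := gf_linear f 1 t1 t2.
rewrite big_cons -IH -[f (density_scale (u k) r)]mul1r -e.
apply: gf_ext => [| |c x _ _].
- by apply: test_density_scale => //; exact: smooth_fun_sum.
- exact: test_density_lin.
- by rewrite /density_scale /density_lin big_cons mul1r mulrDl.
Qed.

Definition chart_functional f (c : chart R m M) (h : 'rV[R]_m -> R[i]) : R[i] := f (dlift c h).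

Lemma cinv_compact c (L : set 'rV[R]_m) : compact L -> L `<=` c @` (cdom c `&` U) ->
  [/\ compact (cinv c @` L), cinv c @` L `<=` U & L `<=` c @` cdom c].
Proof.
move=> cL LU; have Lc : L `<=` c @` cdom c by move=> y /LU; exact: cimage_sub.
split=> //; first exact: compact_cinv.
by move=> _ [y /LU + <-]; rewrite cimageE => -[].
Qed.

(** The continuity estimate for [f] uses finitely many charts [d j] of its own. On compact sets
    where both charts are defined, [comp_bound], with the Jacobian as factor, converts derivatives
    in [d j] into derivatives in [c], with constants that depend on the support only. *)
Lemma chart_functional_distribution f c : atlas c -> open U ->
  is_distribution (c @` (cdom c `&` U)) (chart_functional f c).
Proof.
move=> ac oU; split=> [L a h h' cL LU th th'|L cL LU].
  have [cK KU Lc] := cinv_compact cL LU.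
  have t1 := test_density_supported cK KU (dlift_supported ac cL Lc th).
  have t2 := test_density_supported cK KU (dlift_supported ac cL Lc th').
  rewrite /chart_functional -(gf_linear f a t1 t2).
  congr (f _); apply/funext => c'; apply/funext => x; rewrite /density_lin /dlift /lift.
  by case: ifPn => _; [ring|rewrite mulr0 addr0].
have [cK KU Lc] := cinv_compact cL LU; set K := cinv c @` L in cK KU.
have [_ _ hf] := gf_continuous f.
have [B [n [d [Ld [s [hL hB]]]]]] := hf K cK KU.
have Kc : K `<=` cdom c by move=> _ [y Ly <-]; apply: cinv_cdom; exact: Lc.
pose F j y := c (cinv (d j) y).
have /choice [C CP] : forall j, exists C : R, 0 <= C /\ forall h, smoothC_on (c @` cdom c) h ->
    forall y t, (d j @` (Ld j `&` K)) y -> 0 <= t ->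
    (forall s' : seq 'I_m, (size s' <= size (s j))%N -> normc (partialsC s' h (F j y)) <= t) ->
    normc (partialsC (s j) (fun z => `|\det (jac (d j) c (cinv (d j) z))|%:C * h (F j z)) y) <= C * t.
  move=> j; have [ad cLd Ldd] := hL j.
  have LKd : Ld j `&` K `<=` cdom (d j) `&` cdom c by move=> x [/Ldd ? /Kc ?].
  have [||||||C C0 CP] := @comp_bound R m m (d j @` (cdom (d j) `&` cdom c)) (c @` cdom c) (F j)
      (d j @` (Ld j `&` K)) (s j) (fun z => `|\det (jac (d j) c (cinv (d j) z))|%:C)
      _ (@cimage_open _ _ _ c).
  - by apply: open_cimage; exact: cdom_open.
  - by move=> _ [x [dx cx] <-]; rewrite /F cmapK//; exists x.
  - exact: transition_smooth.
  - apply: compact_cimage; last by move=> x [/Ldd].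
    by apply: compact_closedI => //; exact: compact_closed_manifold.
  - by move=> _ [x /LKd ? <-]; exists x.
  - by apply: smoothC_on_real; exact: det_jac_smooth.
  - by exists C.
(* The sum of the lengths is a common bound for the orders [size (s j)]; [B] may be negative, hence
   the absolute value. *)
exists (`|B| * \sum_j C j), (\sum_j size (s j))%N; split.
  by rewrite mulr_ge0// sumr_ge0// => j _; exact: (CP j).1.
move=> h t th t0 ht.
have S0 : 0 <= \sum_j C j by rewrite sumr_ge0// => j _; exact: (CP j).1.
have sK := dlift_supported ac cL Lc th.
apply: (@le_trans _ _ (B * ((\sum_j C j) * t))); last first.
  by rewrite -mulrA ler_wpM2r ?ler_norm// mulr_ge0.
apply: hB => // [|j x Lx]; first by rewrite mulr_ge0.
have [ad cLd Ldd] := hL j; have dx := Ldd x Lx.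
have [Kx|Kx] := pselect (K x); last first.
  by rewrite (supported_density_partialsC _ ad cK dx Kx sK) normc0 mulr_ge0.
apply: (@le_trans _ _ (C j * t)); last first.
  by rewrite ler_wpM2r// (bigD1 j)//= lerDl sumr_ge0// => k _; exact: (CP k).1.
have oV : open (d j @` (cdom (d j) `&` cdom c)) by apply: open_cimage; exact: cdom_open.
rewrite (@partialsC_congr _ _ (d j @` (cdom (d j) `&` cdom c)) _
  (fun z => `|\det (jac (d j) c (cinv (d j) z))|%:C * h (F j z)))//; last 2 first.
- by move=> _ [z [dz cz] <-]; rewrite /F /= cmapK// dlift_in.
- by exists x => //; split=> //; exact: Kc.
apply: (CP j).2 => //.
- exact: smoothC_on_sub th.1.
- by exists x.
- by move=> s' ss'; apply: ht; rewrite (leq_trans ss')// (bigD1 j)//= leq_addr.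
Qed.

End generalized_functions.

(** * Bounded sets of densities and their common support *)

Section bounded_sets.
Context {R : realType} {m : nat} {M : manifold R m} {U : set M}.
Implicit Types (c : chart R m M) (x : M) (r : density M) (K : set M).

Lemma derivatives_on_compact_bounded c L s r : atlas c -> compact L -> L `<=` cdom c ->
  smooth_density r -> exists2 t : R, 0 <= t & forall x, L x -> normc (partialsC s (r c \o cinv c) (c x)) <= t.
Proof.
move=> ac cL Lc [sr _].
have cLc : c @` L `<=` c @` cdom c by move=> _ [x /Lc ? <-]; exists x.
have [t t0 tP] := smoothC_bounded (compact_cimage cL Lc) cLc (smoothC_on_partialsC s (sr c ac)).
by exists t => // x Lx; apply: tP; exists x.
Qed.

Variables (J : Type) (la : J -> density M -> R[i]).
Hypothesis laD : forall j r r', test_density U r -> test_density U r' ->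
  la j (density_lin 1 r r') = la j r + la j r'.
Hypothesis laZ : forall j a r, test_density U r -> la j (density_scale (fun=> a) r) = a * la j r.
Hypothesis la_bound : forall K, compact K -> K `<=` U ->
  exists (B : R) (n : nat) (c : 'I_n -> chart R m M) (L : 'I_n -> set M) (s : 'I_n -> seq 'I_m),
    (forall j, [/\ atlas (c j), compact (L j) & L j `<=` cdom (c j)]) /\
    forall r (t : R), supported_density K r -> 0 <= t ->
      (forall j x, L j x -> normc (partialsC (s j) (r (c j) \o cinv (c j)) (c j x)) <= t) ->
      forall j, normc (la j r) <= B * t.

(** The value 0 is included so that the supremum makes sense when [J] is empty. *)
Let values r : set R := [set v | v = 0 \/ exists j, v = normc (la j r)].

Let values_has_sup r : test_density U r -> has_sup (values r).
Proof.
move=> [K [cK KU sr]]; split; first by exists 0; left.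
have [B [n [c [L [s [hL hB]]]]]] := la_bound cK KU.
have /choice [T TP] : forall j, exists t : R, 0 <= t /\
    forall x, L j x -> normc (partialsC (s j) (r (c j) \o cinv (c j)) (c j x)) <= t.
  move=> j; have [ac cL Lc] := hL j.
  by have [t ? ?] := derivatives_on_compact_bounded (s j) ac cL Lc sr.1; exists t.
have T0 : 0 <= \sum_j T j by rewrite sumr_ge0// => j _; exact: (TP j).1.
have h := hB r (\sum_j T j) sr T0.
exists (`|B| * \sum_j T j) => _ [->|[j ->]]; first by rewrite mulr_ge0.
apply: (@le_trans _ _ (B * \sum_j T j)); last by rewrite ler_wpM2r ?ler_norm.
apply: h => k x Lx; rewrite (le_trans ((TP k).2 x Lx))// (bigD1 k)//= lerDl.
by rewrite sumr_ge0// => i _; exact: (TP i).1.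
Qed.

Let q r := sup (values r).

Let q_ge r j : test_density U r -> normc (la j r) <= q r.
Proof. by move=> tr; apply: sup_upper_bound; [exact: values_has_sup|right; exists j]. Qed.

Let q_ge0 r : test_density U r -> 0 <= q r.
Proof. by move=> tr; apply: sup_upper_bound; [exact: values_has_sup|left]. Qed.

Let q_le r b : 0 <= b -> (forall j, normc (la j r) <= b) -> q r <= b.
Proof.
move=> b0 h; apply: ge_sup; first by exists 0; left.
by move=> _ [->//|[j ->]].
Qed.

(** The estimate [la_bound] is uniform in [j] and survives the supremum. A bounded set of densities
    is therefore bounded for all functionals [la j] at once. *)
Lemma sup_seminorm_continuous : continuous_seminorm U q.
Proof.
split=> [r r' tr tr'|a r tr|K cK KU].
- apply: q_le => [|j]; first by rewrite addr_ge0// q_ge0.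
  by rewrite laD// (le_trans (ler_normcD _ _))// lerD// q_ge.
- apply/eqP; rewrite eq_le; apply/andP; split.
    apply: q_le => [|j]; first by rewrite mulr_ge0 ?normc_ge0// q_ge0.
    by rewrite laZ// normcM ler_wpM2l ?normc_ge0// q_ge.
  have tar : test_density U (density_scale (fun=> a) r).
    by apply: test_density_scale => //; exact: smooth_fun_cst.
  have [a0|a0] := eqVneq (normc a) 0; first by rewrite a0 mul0r q_ge0.
  have a1 : 0 < normc a by rewrite lt_neqAle eq_sym a0 normc_ge0.
  rewrite -ler_pdivlMl//; apply: q_le => [|j]; first by rewrite mulr_ge0 ?invr_ge0 ?q_ge0// ltW.
  by rewrite ler_pdivlMl// -normcM -laZ// q_ge.
- have [B [n [c [L [s [hL hB]]]]]] := la_bound cK KU.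
  exists `|B|, n, c, L, s; split=> // r t sr t0 ht.
  apply: q_le => [|j]; first by rewrite mulr_ge0.
  by rewrite (le_trans (hB r t sr t0 ht j))// ler_wpM2r ?ler_norm.
Qed.

Lemma bounded_family (B : set (density M)) : bounded_densities U B ->
  exists b : R, forall r j, B r -> normc (la j r) <= b.
Proof.
move=> [BU Bq]; have [b bP] := Bq _ sup_seminorm_continuous.
by exists b => r j Br; rewrite (le_trans (q_ge j (BU r Br)))// bP.
Qed.

End bounded_sets.

Section bounded_sets_supports.
Context {R : realType} {m : nat} {M : manifold R m} {U : set M}.
Implicit Types (c : chart R m M) (x : M) (r : density M) (K : set M).

(** [bounded_family] is applied to the derivatives evaluated at the points of [L], with one
    functional per point. *)
Lemma bounded_densities_derivatives (B : set (density M)) c (L : set M) s : bounded_densities U B ->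
  atlas c -> compact L -> L `<=` cdom c ->
  exists b : R, forall r x, B r -> L x -> normc (partialsC s (r c \o cinv c) (c x)) <= b.
Proof.
move=> Bb ac cL Lc.
pose la x r := if x \in L then partialsC s (r c \o cinv c) (c x) else 0.
have oc := @cimage_open _ _ _ c.
have [|||b bP] := @bounded_family R m M U M la _ _ _ B Bb.
- move=> x r r' [K [_ _ [[sr _] _]]] [K' [_ _ [[sr' _] _]]].
  rewrite /la; case: ifPn => [/set_mem Lx|_]; last by rewrite addr0.
  have cx : (c @` cdom c) (c x) by exists x => //; exact: Lc.
  rewrite -(partialsCD s oc cx (sr c ac) (sr' c ac)); congr (partialsC s _ _).
  by apply/funext => y; rewrite /density_lin /= mul1r.
- move=> x a r [K [_ _ [[sr _] _]]].
  rewrite /la; case: ifPn => [/set_mem Lx|_]; last by rewrite mulr0.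
  have cx : (c @` cdom c) (c x) by exists x => //; exact: Lc.
  by rewrite -(partialsCZ a s oc cx (sr c ac)).
- move=> K cK KU; exists 1, 1%N, (fun=> c), (fun=> L), (fun=> s); split=> // r t sr t0 ht x.
  rewrite mul1r /la; case: ifPn => [/set_mem Lx|_]; last by rewrite normc0.
  exact: ht ord0 x Lx.
- by exists b => r x Br Lx; have := bP r x Br; rewrite /la mem_set.
Qed.

Lemma compact_neighborhood x : open U -> U x -> exists C V, [/\ compact C, C `<=` U, open V, V x & V `<=` C].
Proof.
move=> oU Ux; have [ac cx] := chart_atP x; set c := chart_at x in ac cx.
have oV : open (c @` (cdom c `&` U)) by exact: open_cimage.
have cK : compact [set c x] by exact: compact_set1.
have KV : [set c x] `<=` c @` (cdom c `&` U) by move=> _ ->; exists x.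
have [L [cL LV] [e e0 LP]] := compact_thickening cK KV oV.
have [cC CU Lc] := cinv_compact cL LV.
exists (cinv c @` L), (cdom c `&` c @^-1` ball (c x) e); split=> //.
- by apply: open_cpreimage; exact: ball_open.
- by split => //; exact: ballxx.
- move=> z [cz]; rewrite /= -ball_normE /= => h; exists (c z); last exact: cmapK.
  by apply: (LP (c x)) => //; rewrite distrC ltW.
Qed.

(** The members of a countable base whose closure is compact and contained in [U] are numbered by an
    injection into the natural numbers; [E n] is the union of the closures with number at most [n],
    so each stage adds at most one compact set. *)
Lemma compact_exhaustion : open U -> exists E : nat -> set M,
  (forall n, compact (E n) /\ E n `<=` U) /\
  (forall k n, (k <= n)%N -> E k `<=` E n) /\
  forall K, compact K -> K `<=` U -> exists n, K `<=` E n.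
Proof.
move=> oU; have [Bs /countable_injP[code codeP] [Bo Bb]] := @carrier_second_countable R m M.
pose good k V := [/\ Bs V, code V = k, compact (closure V) & closure V `<=` U].
pose E n := [set x | exists k V, [/\ (k <= n)%N, good k V & closure V x]].
have piece k : compact [set x | exists2 V, good k V & closure V x].
  have [[V gV]|nV] := pselect (exists V, good k V); last first.
    rewrite (_ : [set x | _] = set0); first exact: compact0.
    by apply/seteqP; split=> // x [V gV _]; apply: nV; exists V.
  rewrite (_ : [set x | _] = closure V); first by have [] := gV.
  apply/seteqP; split=> x; last by move=> ?; exists V.
  move=> [V' gV' xV']; suff -> : V = V' by [].
  have [bV cV _ _] := gV; have [bV' cV' _ _] := gV'.
  by apply: codeP; rewrite ?inE// cV cV'.
have Emon k n : (k <= n)%N -> E k `<=` E n.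
  by move=> kn x [l [V [lk gV Vx]]]; exists l, V; split=> //; exact: leq_trans kn.
exists E; split; last split=> //.
- move=> n; split; last by move=> x [k [V [_ [_ _ _]]]]; apply.
  elim: n => [|n IH].
    have -> : E 0%N = [set x | exists2 V, good 0%N V & closure V x].
      apply/seteqP; split=> x; first by move=> [k [V [+ gV Vx]]]; rewrite leqn0 => /eqP k0; exists V => //; rewrite -k0.
      by move=> [V gV Vx]; exists 0%N, V.
    exact: piece.
  have -> : E n.+1 = E n `|` [set x | exists2 V, good n.+1 V & closure V x].
    apply/seteqP; split=> x.
      move=> [k [V [+ gV Vx]]]; rewrite leq_eqVlt => /orP[/eqP kn|kn].
        by right; exists V => //; rewrite -kn.
      by left; exists k, V.
    by move=> [/(Emon _ _ (leqnSn n))//|[V gV Vx]]; exists n.+1, V.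
  exact: compactU.
- move=> K cK KU; pose P (A : set M) := exists n, A `<=` E n.
  apply: (@compact_induction _ K P cK).
  + by exists 0%N; exact: sub0set.
  + move=> A A' [n An] [n' An']; exists (maxn n n') => x [/An|/An'].
      by apply: Emon; exact: leq_maxl.
    by apply: Emon; exact: leq_maxr.
  + by move=> A A' AA' [n An]; exists n; exact: subset_trans An.
  + move=> x Kx; have [C [V [cC CU oV Vx VC]]] := compact_neighborhood oU (KU x Kx).
    have [|W [BW Wx] WV] := Bb x V; first by apply: open_nbhs_nbhs; split.
    have clC : closed C by exact: compact_closed_manifold.
    have WC : closure W `<=` C.
      by apply: (subset_trans _ clC); apply: closureS; exact: subset_trans VC.
    exists W; first by apply: open_nbhs_nbhs; split=> //; exact: Bo.
    exists (code W) => y Wy; exists (code W), W; split=> //; last exact: subset_closure.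
    split=> //; last exact: subset_trans CU.
    by apply: (subclosed_compact _ cC) => //; exact: closed_closure.
Qed.

(** Otherwise each [E n] is left by some [r_n] in [B], nonzero at a point [x_n] outside [E n]. The
    functionals [r |-> n * r (x_n) / |r_n (x_n)|] satisfy a uniform estimate on densities supported
    in [K], because [K] contains [x_n] for finitely many [n] only; yet they are unbounded on [B]. *)
Lemma bounded_densities_supported (B : set (density M)) : open U -> bounded_densities U B ->
  exists K, [/\ compact K, K `<=` U & forall r, B r -> supported_density K r].
Proof.
move=> oU Bb; have [E [EU [Emon EK]]] := compact_exhaustion oU.
apply: contrapT => nK.
have H n : exists p : density M * chart R m M * M,
    [/\ B p.1.1, atlas p.1.2 /\ cdom p.1.2 p.2, ~ E n p.2 & p.1.1 p.1.2 p.2 != 0].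
  apply: contrapT => hn; apply: nK; exists (E n); have [cE EnU] := EU n; split=> // r Br.
  have [K [_ _ [sr _]]] := Bb.1 r Br; split=> // c x ac cx Ex.
  by apply: contrapT => /eqP rx; apply: hn; exists (r, c, x).
have [p pP] := choice H.
pose rn n := (p n).1.1; pose cn n := (p n).1.2; pose xn n := (p n).2.
(* The weight makes the [n]-th functional equal to [n] in absolute value at [r_n]. *)
pose k n : R := n%:R / normc (rn n (cn n) (xn n)).
have k0 n : 0 <= k n by rewrite divr_ge0 ?normc_ge0.
pose la n r := (k n)%:C * r (cn n) (xn n).
have [|||b bP] := @bounded_family R m M U nat la _ _ _ B Bb.
- by move=> n r r' _ _; rewrite /la /density_lin mul1r mulrDr.
- by move=> n a r _; rewrite /la /density_scale mulrCA.
- move=> K cK KU; have [N KN] := EK K cK KU.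
  exists (\sum_(n < N) k n), N, (fun n => cn n), (fun n => [set xn n]), (fun=> [::]).
  split=> [j|r t sr t0 ht n].
    have [_ [aj cj] _ _] := pP j; split=> //; first exact: compact_set1.
    by move=> _ ->.
  have S0 : 0 <= \sum_(n < N) k n by rewrite sumr_ge0.
  have [_ [an cdn] En _] := pP n.
  have [nN|Nn] := ltnP n N; last first.
    rewrite /la (sr.2 (cn n) (xn n))// ?mulr0 ?normc0 ?mulr_ge0// => Kx.
    by apply: En; apply: (Emon _ _ Nn); exact: KN.
  rewrite /la normcM normc_real (ger0_norm (k0 n)) ler_pM ?normc_ge0//.
    by rewrite (bigD1 (Ordinal nN))//= lerDl sumr_ge0.
  have := ht (Ordinal nN) (xn n) erefl.
  by rewrite partialsC_nil /= cmapK.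
- have bn n : n%:R <= b.
    have [Bn _ _ rn0] := pP n; have := bP (rn n) n Bn.
    rewrite /la normcM normc_real (ger0_norm (k0 n)) /k divfK//.
    by apply: contra rn0 => /eqP/ComplexField.Normc.eq0_normc/eqP.
  have := archi_boundP (normr_ge0 b); rewrite ltNge => /negP; apply.
  by rewrite (le_trans (bn _))// ler_norm.
Qed.

End bounded_sets_supports.

(** * Smooth generalized functions and approximation *)

Section manifold_partitions.
Context {R : realType} {m : nat} {M : manifold R m}.
Implicit Types (c : chart R m M) (x : M) (K U O : set M).

Definition real_smooth (w : M -> R) := smooth_fun setT (fun x => (w x)%:C).

Lemma manifold_cutoff c x O : atlas c -> open O -> O x -> cdom c x ->
  exists (w : M -> R) G C, [/\ real_smooth w, forall z, 0 <= w z <= 1,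
    open G /\ G x, forall z, G z -> w z = 1 &
    [/\ compact C, C `<=` O `&` cdom c & forall z, ~ C z -> w z = 0]].
Proof.
move=> ac oO Ox cx.
have oV : open (c @` (cdom c `&` O)) by exact: open_cimage.
have KV : [set c x] `<=` c @` (cdom c `&` O) by move=> _ ->; exists x.
have [L [cL LV] [e e0 LP]] := compact_thickening (@compact_set1 _ (c x)) KV oV.
have [cC CO Lc] := cinv_compact cL LV.
have [b [sb b01 b1 b0]] := cube_cutoff (c x) e0.
have bL y : ~ L y -> b y = 0.
  move=> Ly; apply: b0; rewrite ltNge; apply/negP => h; apply: Ly.
  exact: (LP (c x)).
exists (lift c b), (cdom c `&` c @^-1` ball (c x) (e / 2)), (cinv c @` L); split.
- have tb : test_fun L (fun y => (b y)%:C) by split; [exact: smoothC_on_real|move=> y /bL ->].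
  have := lift_smooth ac cL Lc tb; congr smooth_fun; apply/funext => z.
  by rewrite /lift; case: ifP.
- by move=> z; rewrite /lift; case: ifP => _; rewrite ?lexx ?ler01.
- split; first by apply: open_cpreimage; exact: ball_open.
  by split=> //; apply: ballxx; rewrite divr_gt0.
- move=> z [cz]; rewrite /= -ball_normE /= distrC => h.
  by rewrite lift_in// b1// ltW.
- split=> //; first by move=> z zC; split; [exact: CO|case: zC => y /Lc ? <-; exact: cinv_cdom].
  by move=> z; exact: lift_out.
Qed.

(** Charts and open sets are indexed by an arbitrary type, so that a prescribed chart can be forced
    on part of [K]. *)
Lemma manifold_partition (I : Type) (cs : I -> chart R m M) (O : I -> set M) K : compact K ->
  (forall i, atlas (cs i) /\ open (O i)) ->
  (forall x, K x -> exists i, O i x /\ cdom (cs i) x) ->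
  exists n (w : 'I_n -> M -> R) (p : 'I_n -> I),
    [/\ forall k, real_smooth (w k),
        forall k, exists C, [/\ compact C, C `<=` O (p k) `&` cdom (cs (p k)) & forall z, ~ C z -> w k z = 0] &
        exists G, [/\ open G, K `<=` G & forall z, G z -> \sum_k w k z = 1]].
Proof.
move=> cK aO KO.
have one_minus u : real_smooth u -> real_smooth (fun y => 1 - u y).
  move=> su; have := smooth_funD (smooth_fun_cst 1) (smooth_funM (smooth_fun_cst (-1)) su).
  by congr smooth_fun; apply/funext => z; rewrite rmorphB/= mulN1r.
have prod_smooth u v : real_smooth u -> real_smooth v -> real_smooth (fun y => u y * v y).
  move=> su sv; have := smooth_funM su sv.
  by congr smooth_fun; apply/funext => z; rewrite rmorphM.
have [|||n [w [p [h1 _ _ h4]]]] := @partition_of_unity R M I real_smooth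
  (fun i w => exists C, [/\ compact C, C `<=` O i `&` cdom (cs i) & forall z, ~ C z -> w z = 0])
  K cK _ one_minus prod_smooth.
- exact: smooth_fun_cst.
- move=> i u v _ [C [cC CO vC]]; exists C; split=> // z /vC ->; exact: mulr0.
- move=> x Kx; have [i [Ox cx]] := KO x Kx; have [ai oi] := aO i.
  have [w [G [C [sw w01 oG Gw hC]]]] := manifold_cutoff ai oi Ox cx.
  by exists i, w, G; split=> //; exists C.
- by exists n, w, p; split=> // k; have [] := h1 k.
Qed.

End manifold_partitions.

Section differential_operators.
Context {R : realType} {m : nat} {M : manifold R m} (n : nat) (D : operator M).
Hypothesis dD : diff_op n D.
Implicit Types (c : chart R m M) (u w : M -> R[i]).

Lemma diff_op_local V u w x : smooth_fun setT u -> smooth_fun setT w -> open V -> V x ->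
  (forall z, V z -> u z = w z) -> D u x = D w x.
Proof.
move=> su sw oV Vx uw; have [ac cx] := chart_atP x; set c := chart_at x in ac cx.
have [a [_ aP]] := dD ac; rewrite !aP//.
apply: eq_bigr => j _; apply: eq_bigr => s _; congr (_ * _).
apply: (@partialsC_congr _ _ (c @` (cdom c `&` V))); first exact: open_cimage.
  by move=> _ [z [cz Vz] <-]; rewrite /= cmapK// uw.
by exists x.
Qed.

Lemma diff_op_smooth u : smooth_fun setT u -> smooth_fun setT (D u).
Proof.
move=> su; apply/smooth_funP => c ac; have [a [sa aP]] := dD ac.
have oc := @cimage_open _ _ _ c.
have H : smoothC_on (c @` cdom c) (fun y => \sum_(j < n.+1) \sum_(s : j.-tuple 'I_m)
    (a s \o cinv c) y * partialsC s (u \o cinv c) y).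
  apply: smoothC_on_sum => // j; apply: smoothC_on_sum => // s; apply: smoothC_onM => //.
    by have := sa s c ac; rewrite setIid.
  exact/smoothC_on_partialsC/smooth_fun_on.
apply: (smoothC_on_congr oc _ H) => y cy.
rewrite [RHS]/= aP//; last exact: cinv_cdom.
by rewrite (cinvK cy).
Qed.

Lemma diff_op_sum (N : nat) (u : 'I_N -> M -> R[i]) x : (forall k, smooth_fun setT (u k)) ->
  D (fun z => \sum_k u k z) x = \sum_k D (u k) x.
Proof.
move=> su; have [ac cx] := chart_atP x; set c := chart_at x in ac cx.
have [a [_ aP]] := dD ac; rewrite aP//; last exact: smooth_fun_sum.
under [RHS]eq_bigr do rewrite aP//.
rewrite [RHS]exchange_big; apply: eq_bigr => j _.
rewrite [RHS]exchange_big; apply: eq_bigr => s _.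
rewrite -mulr_sumr; congr (_ * _).
have cy : (c @` cdom c) (c x) by exists x.
rewrite -(partialsC_sum _ s (@cimage_open _ _ _ c) cy (fun k => smooth_fun_on (su k) ac)).
by [].
Qed.

Lemma diff_op_support C u x : closed C -> smooth_fun setT u -> (forall z, ~ C z -> u z = 0) ->
  ~ C x -> D u x = 0.
Proof.
move=> clC su uC Cx.
(* The empty case of [diff_op_sum]. *)
have sum0 : D (fun=> 0) x = 0.
  have := @diff_op_sum 0 (fun=> fun=> 0) x (fun=> smooth_fun_cst 0).
  by rewrite !big_ord0.
rewrite -sum0; apply: (diff_op_local su (smooth_fun_cst 0) (closed_openC clC)) => //.
Qed.

End differential_operators.

Section smooth_generalized_functions.
Context {R : realType} {m : nat} {M : manifold R m} (U : set M).
Implicit Types (c : chart R m M) (u : M -> R[i]) (r : density M).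

Definition small_support c u C := [/\ atlas c, smooth_fun setT u, compact C, C `<=` U `&` cdom c &
  forall z, ~ C z -> u z = 0].

Lemma chart_integralE c r : chart_integral c r = cintegral (pull c r).
Proof. by []. Qed.

Lemma pull_scale_test_fun c u C r : small_support c u C -> test_density U r ->
  test_fun (c @` C) (pull c (density_scale u r)).
Proof.
move=> [ac su cC CU uC] [K [cK KU sr]].
apply: pull_test_fun => //; first by move=> x /CU[].
by apply: supported_densityW (supported_density_scale_in su uC sr) => x [].
Qed.

Lemma pull_fun_test_fun c u C : small_support c u C -> test_fun (c @` C) (pull c (fun=> u)).
Proof.
move=> [ac su cC CU uC]; apply: pull_test_fun_on => //; first by move=> x /CU[].
  exact: smooth_fun_on.
by move=> x _; exact: uC.
Qed.

Lemma pull_scale c u r y : pull c (density_scale u r) y = pull c (fun=> u) y * pull c r y.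
Proof. by rewrite /pull; case: ifP; rewrite // mulr0. Qed.

Lemma small_support_compact c u C : small_support c u C -> compact (c @` C).
Proof. by move=> [ac su cC CU uC]; apply: compact_cimage => // x /CU[]. Qed.

Lemma chart_integral_lin c u C a r r' : small_support c u C -> test_density U r -> test_density U r' ->
  chart_integral c (density_scale u (density_lin a r r')) =
  a * chart_integral c (density_scale u r) + chart_integral c (density_scale u r').
Proof.
move=> h tr tr'; have t1 := pull_scale_test_fun h tr; have t2 := pull_scale_test_fun h tr'.
have cL := small_support_compact h.
have [d d0 b1] := test_fun_bsupp cL t1; have [d' d'0 b2] := test_fun_bsupp cL t2.
pose e := Num.max d d'.
have {}b1 : bsupp e (pull c (density_scale u r)) by apply: bsuppW b1; rewrite le_max lexx.
have {}b2 : bsupp e (pull c (density_scale u r')) by apply: bsuppW b2; rewrite le_max lexx orbT.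
rewrite !chart_integralE -(cintegralZ a t1.1 b1) -(@cintegralD _ _ _ _ e) //.
- congr cintegral; apply/funext => y; rewrite !pull_scale /pull /density_lin.
  by case: ifP => _; ring.
- by apply: smoothC_onZ; [exact: openT|exact: t1.1].
- exact: t2.1.
- exact: bsupp_mulr.
Qed.

Lemma chart_integral_scale c u C a r : small_support c u C -> test_density U r ->
  chart_integral c (density_scale u (density_scale (fun=> a) r)) =
  a * chart_integral c (density_scale u r).
Proof.
move=> h tr; have t1 := pull_scale_test_fun h tr.
have [d d0 b1] := test_fun_bsupp (small_support_compact h) t1.
rewrite !chart_integralE -(cintegralZ a t1.1 b1); congr cintegral; apply/funext => y.
by rewrite !pull_scale /pull /density_scale; case: ifP => _; ring.
Qed.

Lemma chart_integral_bound c u C : small_support c u C -> exists2 A : R, 0 <= A &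
  forall r t, test_density U r -> 0 <= t -> (forall x, C x -> normc (r c x) <= t) ->
  normc (chart_integral c (density_scale u r)) <= A * t.
Proof.
move=> h; have cL := small_support_compact h; have tu := pull_fun_test_fun h.
have [a a0 aP] := compact_norm_bound cL.
have bu : bsupp a (pull c (fun=> u)) by move=> y ay; apply: tu.2 => /aP; rewrite leNgt ay.
have [B B0 BP] := bsuppC_bounded tu.1 bu.
exists (2 * B * (2 * a) ^+ m) => [|r t tr t0 ht].
  by rewrite mulr_ge0 ?mulr_ge0// exprn_ge0// mulr_ge0.
rewrite chart_integralE (_ : 2 * B * _ * t = 2 * (B * t) * (2 * a) ^+ m); last by ring.
have tur := pull_scale_test_fun h tr.
apply: (cintegral_bound (p := 0)) => //; first exact: tur.1.
  by move=> y; rewrite subr0 => ay; apply: tur.2 => /aP; rewrite leNgt ay.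
move=> y; have [[x Cx <-]|Ly] := pselect ((c @` C) y); last first.
  by rewrite tur.2// normc0 mulr_ge0.
have [_ _ _ CU _] := h; have [_ cx] := CU x Cx.
by rewrite pull_scale normcM ler_pM ?normc_ge0 ?BP// pull_in// ht.
Qed.

Variables (N : nat) (cs : 'I_N -> chart R m M) (us : 'I_N -> M -> R[i]) (Cs : 'I_N -> set M).
Hypothesis hs : forall k, small_support (cs k) (us k) (Cs k).

(** A smooth function is kept together with its decomposition into pieces [us k], each supported in
    its chart [cs k]; these provide the pieces that [density_integral] asks for in
    [smooth_gen_fun_embeds]. *)
Definition smooth_functional (r : density M) : R[i] :=
  \sum_k chart_integral (cs k) (density_scale (us k) r).

Let sf_linear a r r' : test_density U r -> test_density U r' ->
  smooth_functional (density_lin a r r') = a * smooth_functional r + smooth_functional r'.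
Proof.
move=> tr tr'; rewrite /smooth_functional mulr_sumr -big_split /=.
by apply: eq_bigr => k _; exact: (chart_integral_lin a (hs k)).
Qed.

Let sf_continuous : continuous_seminorm U (fun r => normc (smooth_functional r)).
Proof.
split=> [r r' tr tr'|a r tr|K cK KU].
- by rewrite sf_linear// mul1r ler_normcD.
- rewrite -normcM /smooth_functional mulr_sumr; congr normc.
  by apply: eq_bigr => k _; exact: (chart_integral_scale a (hs k)).
- have /choice [A AP] : forall k, exists A : R, 0 <= A /\
      forall r t, test_density U r -> 0 <= t -> (forall x, Cs k x -> normc (r (cs k) x) <= t) ->
      normc (chart_integral (cs k) (density_scale (us k) r)) <= A * t.
    by move=> k; have [A ? ?] := chart_integral_bound (hs k); exists A.
  exists (\sum_k A k), N, cs, Cs, (fun=> [::]); split=> [k|r t sr t0 ht].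
    by have [? _ ? Ck _] := hs k; split=> // x /Ck[].
  have tr : test_density U r by exists K.
  rewrite mulr_suml (le_trans (ler_normc_sum _ _ _))// ler_sum// => k _.
  apply: (AP k).2 => // x Cx; have := ht k x Cx; rewrite partialsC_nil /= cmapK//.
  by have [_ _ _ Ck _] := hs k; have [] := Ck x Cx.
Qed.

Definition smooth_gen_fun : gen_fun U := GenFun sf_linear sf_continuous.

Lemma smooth_gen_fun_embeds : gf_embeds (fun x => \sum_k us k x) smooth_gen_fun.
Proof.
move=> r [K [cK KU sr]]; exists N, cs, (fun k => density_scale (us k) r); split.
- move=> k; have [ac su cC CU uC] := hs k; split=> //; exists (K `&` Cs k); split.
  + by apply: compact_closedI => //; exact: compact_closed_manifold.
  + by move=> x [_ /CU].
  + exact: supported_density_scale_in.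
- by move=> c' x _ _; rewrite /density_scale mulr_suml.
- by [].
Qed.

End smooth_generalized_functions.

Section approximation.
Context {R : realType} {m : nat} {M : manifold R m} {U : set M}.
Implicit Types (c : chart R m M) (f : gen_fun U) (u : M -> R[i]) (r : density M) (K C : set M).

Lemma gf_scale f (a : R[i]) r : test_density U r -> f (density_scale (fun=> a) r) = a * f r.
Proof.
move=> tr; have t0 : test_density U (fun _ _ => 0 : R[i]).
  by exists set0; split; [exact: compact0|exact: sub0set|exact: supported_density0].
have f0 : f (fun _ _ => 0) = 0 by exact: gf0.
have := gf_linear f a tr t0; rewrite f0 addr0 => <-.
apply: gf_ext => [| |c x _ _].
- by apply: test_density_scale => //; exact: smooth_fun_cst.
- exact: test_density_lin.
- by rewrite /density_scale /density_lin addr0.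
Qed.

Section difference.
Variables f g : gen_fun U.

Let sub r : R[i] := f r - g r.

Let sub_linear a r r' : test_density U r -> test_density U r' ->
  sub (density_lin a r r') = a * sub r + sub r'.
Proof. by move=> tr tr'; rewrite /sub !gf_linear//; ring. Qed.

Let sub_continuous : continuous_seminorm U (fun r => normc (sub r)).
Proof.
split=> [r r' tr tr'|a r tr|K cK KU].
- by rewrite sub_linear// mul1r ler_normcD.
- by rewrite -normcM /sub !gf_scale// mulrBr.
- have [_ _ hf] := gf_continuous f; have [_ _ hg] := gf_continuous g.
  have [b [n [c [L [s [hL hb]]]]]] := hf K cK KU.
  have [b' [n' [c' [L' [s' [hL' hb']]]]]] := hg K cK KU.
  exists (b + b'), (n + n')%N,
    (fun j => match fintype.split j with inl i => c i | inr i => c' i end),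
    (fun j => match fintype.split j with inl i => L i | inr i => L' i end),
    (fun j => match fintype.split j with inl i => s i | inr i => s' i end).
  split=> [j|r t sr t0 ht]; first by case: (fintype.split j).
  rewrite mulrDl (le_trans (ler_normcB _ _))// lerD//.
    by apply: hb => // j x Lx; have := ht (lshift n' j) x; rewrite (unsplitK (inl j)); apply.
  by apply: hb' => // j x Lx; have := ht (rshift n j) x; rewrite (unsplitK (inr j)); apply.
Qed.

Definition gf_sub : gen_fun U := GenFun sub_linear sub_continuous.

End difference.

Hypothesis oU : open U.

(** In the chart [c], the densities [phi * r] with [r] in [B] form a family of test functions on one
    compact set with uniformly bounded derivatives. So [distribution_approximation] provides one
    smooth [v] for the whole family, and [u] is [v * phi]. *)
Lemma piece_approximation f c phi C (B : set (density M)) (e : R) :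
  small_support U c phi C -> bounded_densities U B -> 0 < e ->
  exists u, small_support U c u C /\ forall r, B r ->
    normc (f (density_scale phi r) - chart_integral c (density_scale u r)) <= e.
Proof.
move=> hphi Bb e0; have [ac sphi cC CU phiC] := hphi.
have Cc : C `<=` cdom c by move=> x /CU[].
pose L := c @` C; have cL : compact L := small_support_compact hphi.
pose W := c @` (cdom c `&` U); have oW : open W := open_cimage oU.
have LW : L `<=` W by move=> _ [x Cx <-]; exists x => //; have [] := CU x Cx.
have Lc : L `<=` c @` cdom c by move=> _ [x Cx <-]; exists x => //; exact: Cc.
pose h r := pull c (density_scale phi r).
have th r : B r -> test_fun L (h r) by move=> /(Bb.1 r) tr; exact: pull_scale_test_fun hphi tr.
have oc := @cimage_open _ _ _ c.
have /choice [b0 b0P] : forall s, exists b : R, forall r x, B r -> C x ->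
    normc (partialsC s (r c \o cinv c) (c x)) <= b.
  by move=> s; exact: (bounded_densities_derivatives s Bb ac cC Cc).
have /choice [b1 b1P] : forall s, exists b : R, forall r y, B r -> normc (partialsC s (h r) y) <= b.
  move=> s; have [b b_ge0 bP] := seq_bound (size s) (fun s => normr_ge0 (b0 s)).
  (* The product rule for [phi * r] is obtained from [comp_bound] with the identity as inner map. *)
  have sid j : smooth_on (c @` cdom c) (fun y : 'rV[R]_m => (id y : 'rV[R]_m) 0 j).
    exact: smooth_on_coord.
  have [A A0 AP] := comp_bound s oc oc (fun y cy => cy) sid cL Lc (smooth_fun_on sphi ac).
  exists (A * b) => r y Br; have [Ly|Ly] := pselect (L y); last first.
    by rewrite (test_fun_partialsC s cL (th r Br)).2// normc0 mulr_ge0.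
  have -> : partialsC s (h r) y =
      partialsC s (fun z => (phi \o cinv c) z * (r c \o cinv c) (id z)) y.
    apply: (partialsC_congr _ oc) => [z cz|]; last exact: Lc.
    by rewrite /h /pull mem_set.
  have [_ [_ _ [[sr _] _]]] := Bb.1 r Br.
  apply: AP => // [|s' ss']; first exact: sr.
  have [x Cx xy] := Ly; rewrite /= -xy (le_trans (b0P s' r x Br Cx))//.
  by rewrite (le_trans (ler_norm _))// bP.
(* [distribution_approximation] wants a bound that depends on the order of the derivative only. *)
have /choice [b2 b2P] : forall k, exists b : R, forall s : seq 'I_m, (size s <= k)%N -> `|b1 s| <= b.
  by move=> k; have [b _ bP] := seq_bound k (fun s => normr_ge0 (b1 s)); exists b.
have [n [w [kappa [sw wP]]]] := distribution_approximation (chart_functional_distribution f ac oU)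
  b2 oW cL LW e0.
pose v y := \sum_k kappa k * (w k y)%:C.
have sv : smoothC_on setT v.
  apply: smoothC_on_sum => [|k]; first exact: openT.
  by apply: smoothC_onZ; [exact: openT|exact: smoothC_on_real].
have tv : test_fun L (fun y => v y * pull c (fun=> phi) y).
  exact/(test_funM sv)/(pull_fun_test_fun hphi).
exists (lift c (fun y => v y * pull c (fun=> phi) y)); split.
  split=> //; first exact: lift_smooth tv.
  move=> x Cx; rewrite /lift; case: ifPn => // /set_mem cx.
  by rewrite pull_in// phiC// mulr0.
move=> r Br; have hr := th r Br.
have tr := Bb.1 r Br.
have -> : f (density_scale phi r) = chart_functional f c (h r).
  have [K [cK KU sr]] := tr.
  have sphir := supported_density_scale_in sphi phiC sr.
  apply: gf_ext => [||c' x ac' c'x].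
  - exact: test_density_scale.
  - have [cK' KU' _] := cinv_compact cL LW.
    exact: test_density_supported cK' KU' (dlift_supported ac cL Lc hr).
  - rewrite [RHS](@dlift_pull _ _ _ c _ (K `&` C))// => z [_]; exact: Cc.
have [d d0 bh] := test_fun_bsupp cL hr.
have -> : chart_integral c (density_scale (lift c (fun y => v y * pull c (fun=> phi) y)) r) =
    \sum_k kappa k * cintegral (fun y => (w k y)%:C * h r y).
  have swh k : smoothC_on setT (fun y => (w k y)%:C * h r y).
    by apply: smoothC_onM; [exact: openT|exact: smoothC_on_real|exact: hr.1].
  have bwh k : bsupp d (fun y => (w k y)%:C * h r y) by exact: bsupp_mulr.
  under [RHS]eq_bigr => k _ do rewrite -(cintegralZ (kappa k) (swh k) (bwh k)).
  rewrite chart_integralE -(@cintegral_sum _ _ _ _ _ d) => [|k|k].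
  - congr cintegral; apply/funext => y; rewrite pull_scale /h pull_scale.
    have [cy|cy] := pselect ((c @` cdom c) y); last first.
      by rewrite /pull memNset//= mulr0 big1// => k _; rewrite !mulr0.
    rewrite /pull mem_set// lift_in ?cinvK//; last exact: cinv_cdom.
    rewrite mem_set// /v mulr_suml mulr_suml; apply: eq_bigr => k _; ring.
  - by apply: smoothC_onZ; [exact: openT|exact: swh].
  - exact/bsupp_mulr/bwh.
by apply: wP => // s y; rewrite (le_trans (b1P s r y Br))// (le_trans (ler_norm _))// b2P.
Qed.

Variables (n : nat) (D : operator M).
Hypothesis dD : diff_op n D.

Lemma small_support_diff_op c u C : small_support U c u C -> small_support U c (D u) C.
Proof.
move=> [ac su cC CU uC]; split=> //; first exact: (diff_op_smooth dD).
by move=> z Cz; apply: (diff_op_support dD) Cz => //; exact: compact_closed_manifold.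
Qed.

Variables (c0 : chart R m M) (a : seq 'I_m -> M -> R[i]).
Hypothesis ac0 : atlas c0.
Hypothesis sa : forall s, smooth_fun (cdom c0) (a s).
Hypothesis aP : forall u, smooth_fun setT u -> forall x, cdom c0 x ->
  D u x = \sum_(j < n.+1) \sum_(s : j.-tuple 'I_m) a s x * partialsC s (u \o cinv c0) (c0 x).

Let aD s := a s \o cinv c0.

Lemma smoothC_on_coefficients s : smoothC_on (c0 @` cdom c0) (aD s).
Proof. by have := sa s ac0; rewrite setIid. Qed.

Lemma transpose_test_fun L h : compact L -> L `<=` c0 @` cdom c0 -> test_fun L h ->
  test_fun L (transpose_op n aD h).
Proof.
move=> cL Lc th; apply: test_fun_sum => j; apply: test_fun_sum => s.
apply/test_funZ/test_fun_partialsC => //.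
by apply: (test_fun_mul_local cL (@cimage_open _ _ _ c0) Lc _ th); exact: smoothC_on_coefficients.
Qed.

(** Each term is integrated by parts in the chart. The coefficient [a s] is smooth on the chart
    image only, but [a s * h] has compact support there and extends by 0. *)
Lemma chart_integral_transpose u C L h : small_support U c0 u C -> compact L ->
  L `<=` c0 @` cdom c0 -> test_fun L h ->
  chart_integral c0 (density_scale (D u) (dlift c0 h)) =
  chart_integral c0 (density_scale u (dlift c0 (transpose_op n aD h))).
Proof.
move=> hu cL Lc th; have [_ su cC CU uC] := hu.
have oc := @cimage_open _ _ _ c0.
pose v := pull c0 (fun=> u); have tv : test_fun (c0 @` C) v := pull_fun_test_fun hu.
have tah s : test_fun L (fun y => aD s y * h y).
  by apply: (test_fun_mul_local cL oc Lc _ th); exact: smoothC_on_coefficients.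
have /choice [d dP] : forall s, exists d : R, bsupp d (fun y => aD s y * h y).
  by move=> s; have [d _ ?] := test_fun_bsupp cL (tah s); exists d.
have [d0 d00 d0P] := compact_norm_bound cL.
have bL g : test_fun L g -> bsupp d0 g by move=> tg y ay; apply: tg.2 => /d0P; rewrite leNgt ay.
have E1 : pull c0 (density_scale (D u) (dlift c0 h)) =
    fun y => \sum_(j < n.+1) \sum_(s : j.-tuple 'I_m) partialsC s v y * (aD s y * h y).
  apply/funext => y; rewrite pull_scale (pull_dlift ac0 Lc th).
  have [cy|cy] := pselect ((c0 @` cdom c0) y); last first.
    rewrite th.2 ?mulr0; last by move=> /Lc.
    by rewrite big1// => j _; rewrite big1// => s _; rewrite !mulr0.
  rewrite /pull mem_set// aP//; last exact: cinv_cdom.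
  rewrite cinvK// mulr_suml; apply: eq_bigr => j _; rewrite mulr_suml; apply: eq_bigr => s _.
  have uv z : (c0 @` cdom c0) z -> (u \o cinv c0) z = v z.
    by move=> cz; rewrite /v /pull mem_set.
  by rewrite (partialsC_congr _ oc uv cy) /aD /=; ring.
have E2 : pull c0 (density_scale u (dlift c0 (transpose_op n aD h))) =
    fun y => \sum_(j < n.+1) \sum_(s : j.-tuple 'I_m)
      (-1) ^+ j * (v y * partialsC (rev s) (fun z => aD s z * h z) y).
  apply/funext => y; rewrite pull_scale (pull_dlift ac0 Lc (transpose_test_fun cL Lc th)).
  rewrite mulr_sumr; apply: eq_bigr => j _; rewrite mulr_sumr; apply: eq_bigr => s _.
  by rewrite /v; ring.
have t1 (s : seq 'I_m) : test_fun L (fun y => partialsC s v y * (aD s y * h y)).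
  by apply: test_funM => //; apply: smoothC_on_partialsC; exact: tv.1.
have t2 (s : seq 'I_m) : test_fun L (fun y => v y * partialsC (rev s) (fun z => aD s z * h z) y).
  by apply: test_funM; [exact: tv.1|exact: test_fun_partialsC].
rewrite !chart_integralE E1 E2.
rewrite !(@cintegral_sum _ _ _ _ _ d0).
- apply: eq_bigr => j _; rewrite !(@cintegral_sum _ _ _ _ _ d0).
  + apply: eq_bigr => s _; rewrite (integration_by_parts_partialsC _ tv.1 (tah s).1 (dP s)).
    by rewrite size_tuple (cintegralZ _ (t2 s).1 (bL _ (t2 s))).
  + by move=> s; exact: (test_funZ _ (t2 s)).1.
  + by move=> s; exact/bL/test_funZ/t2.
  + by move=> s; exact: (t1 s).1.
  + by move=> s; exact/bL/t1.
- move=> j; apply: (_ : test_fun L _).1; apply: test_fun_sum => s; exact: test_funZ.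
- move=> j; apply: bL; apply: test_fun_sum => s; exact: test_funZ.
- move=> j; apply: (_ : test_fun L _).1; apply: test_fun_sum => s; exact: t1.
- move=> j; apply: bL; apply: test_fun_sum => s; exact: t1.
Qed.

End approximation.

(** * The transposed equation for solutions *)

Section solutions.
Context {R : realType} {m : nat} {M : manifold R m} {U : set M}.
Hypothesis oU : open U.
Implicit Types (c : chart R m M) (f : gen_fun U) (u : M -> R[i]) (r : density M) (K C : set M).

(** [K0] is to carry the densities of the transposed equation. The partition uses [c0], indexed by
    [None], with the whole of [U], and all other charts off [K0] only. Hence a piece that meets [K0]
    is written in [c0], where integration by parts is available. *)
Lemma smooth_approximation f c0 (B : set (density M)) K0 (e : R) : atlas c0 ->
  bounded_densities U B -> compact K0 -> K0 `<=` U `&` cdom c0 -> 0 < e ->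
  exists N (cs : 'I_N -> chart R m M) (us : 'I_N -> M -> R[i]) (Cs : 'I_N -> set M),
    [/\ forall k, small_support U (cs k) (us k) (Cs k),
        forall k, cs k = c0 \/ forall x, Cs k x -> ~ K0 x &
        forall r, B r -> normc (f r - smooth_functional cs us r) <= e].
Proof.
move=> ac0 Bb cK0 K0U e0; have [K [cK KU BK]] := bounded_densities_supported oU Bb.
have oK0 : open (~` K0) by apply: closed_openC; exact: compact_closed_manifold.
pose cs (i : option M) := if i is Some x then chart_at x else c0.
pose O (i : option M) := if i is Some x then U `&` ~` K0 else U.
have [||N [w [p [sw hC [G [oG KG Gw]]]]]] := @manifold_partition R m M _ cs O K cK.
- by case=> [x|] //; split; [exact: (chart_atP x).1|exact: openI].
- move=> x Kx; have [K0x|K0x] := pselect (K0 x); first by exists None; have [] := K0U x K0x.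
  by exists (Some x); split; [split=> //; exact: KU|exact: (chart_atP x).2].
have {hC} /choice [C CP] := hC.
pose wC k x := (w k x)%:C.
have hw k : small_support U (cs (p k)) (wC k) (C k).
  have [cC CO C0] := CP k; split=> //.
  - by rewrite /cs; case: (p k) => // x; exact: (chart_atP x).1.
  - exact: sw.
  - by move=> x /CO [h ?]; split=> //; move: h; rewrite /O; case: (p k) => [_ []|].
  - by move=> x /C0; rewrite /wC => ->.
(* The divisor is [N.+1] because the partition may be empty. *)
have eN : 0 < e / N.+1%:R by rewrite divr_gt0// ltr0n.
have /choice [us uP] := fun k => piece_approximation oU f (hw k) Bb eN.
exists N, (cs \o p), us, C; split=> [k|k|r Br].
- by have [] := uP k.
- have [_ + _] := CP k; rewrite /= /cs /O; case: (p k) => [x|]; last by left.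
  by move=> CO; right => z /CO [[_]].
have tr := Bb.1 r Br; have swC k : smooth_fun setT (wC k) by exact: sw.
have -> : f r = \sum_k f (density_scale (wC k) r).
  rewrite -gf_scale_sum//; apply: gf_ext => // [|c x ac cx].
    by apply: test_density_scale => //; exact: smooth_fun_sum.
  rewrite /density_scale; have [Kx|Kx] := pselect (K x).
    by rewrite -rmorph_sum Gw ?mul1r//; exact: KG.
  by rewrite (BK r Br).2// mulr0.
rewrite /smooth_functional -sumrB (le_trans (ler_normc_sum _ _ _))//.
apply: (@le_trans _ _ (\sum_(k < N) e / N.+1%:R)).
  by apply: ler_sum => k _; exact: (uP k).2.
rewrite sumr_const card_ord -[X in X <= _]mulr_natr -mulrA ler_piMr ?(ltW e0)//.
by rewrite mulrC ler_pdivrMr ?ltr0n// mul1r ler_nat.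
Qed.

Lemma bounded_densities1 r : test_density U r -> bounded_densities U [set r].
Proof. by move=> tr; split=> [_ ->//|q _]; exists (q r) => _ ->. Qed.

Lemma bounded_densitiesU (B B' : set (density M)) : bounded_densities U B -> bounded_densities U B' ->
  bounded_densities U (B `|` B').
Proof.
move=> [BU Bq] [BU' Bq']; split=> [r [/BU|/BU']//|q hq].
have [b bP] := Bq q hq; have [b' bP'] := Bq' q hq.
by exists (Num.max b b') => r [/bP|/bP'] h; rewrite le_max h ?orbT.
Qed.

Variables (n : nat) (D : operator M) (c0 : chart R m M) (a : seq 'I_m -> M -> R[i]).
Hypothesis dD : diff_op n D.
Hypothesis ac0 : atlas c0.
Hypothesis sa : forall s, smooth_fun (cdom c0) (a s).
Hypothesis aP : forall u, smooth_fun setT u -> forall x, cdom c0 x ->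
  D u x = \sum_(j < n.+1) \sum_(s : j.-tuple 'I_m) a s x * partialsC s (u \o cinv c0) (c0 x).

(* Both sides are computed on smooth functions that are close to [f] on the bounded set of
   densities provided by the strong continuity of [T]. *)
Lemma solution_transpose f (T : gen_fun U -> gen_fun U) L h : continuous_extension D T ->
  gf_is0 (T f) -> compact L -> L `<=` c0 @` (cdom c0 `&` U) -> test_fun L h ->
  chart_functional f c0 (transpose_op n (fun s => a s \o cinv c0) h) = 0.
Proof.
move=> [Tlin Tcont Tsmooth] Tf cL LU th.
have [cK0 K0U Lc] := cinv_compact cL LU; set K0 := cinv c0 @` L in cK0 K0U.
set th' := transpose_op _ _ _; have tth' : test_fun L th' by exact: transpose_test_fun.
pose r0 := dlift c0 h; pose r1 := dlift c0 th'.
have t0 : test_density U r0 := test_density_supported cK0 K0U (dlift_supported ac0 cL Lc th).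
have t1 : test_density U r1 := test_density_supported cK0 K0U (dlift_supported ac0 cL Lc tth').
(* Strong continuity of [T] at the single density [r0] yields the bounded set [B]; [r1] is added to
   it so that the approximation of [f] is also valid at [r1]. *)
have [B [b [Bb TB]]] := Tcont _ (bounded_densities1 t0).
have Bb' := bounded_densitiesU Bb (bounded_densities1 t1).
have K0U' : K0 `<=` U `&` cdom c0.
  by move=> x Kx; split; [exact: K0U|case: Kx => y Ly <-; apply: cinv_cdom; exact: Lc].
have b1 : 0 < `|b| + 1 by rewrite ltr_wpDl.
apply: normc_eq0; apply/ler_addgt0Pr => e' e'0; rewrite add0r -/(chart_functional f c0 th').
(* Replacing [f r1] by [F r1] costs [e], and [F r1] itself is at most [|b| * e]; together this is
   [e']. *)
pose e := e' / (`|b| + 1); have e0 : 0 < e by rewrite divr_gt0.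
have [N [cs [us [Cs [hs csK fB]]]]] := smooth_approximation f ac0 Bb' cK0 K0U' e0.
have hDs k := small_support_diff_op dD (hs k).
pose F := smooth_gen_fun hs.
have sus k : smooth_fun setT (us k) by have [] := hs k.
have TF : T F r0 = F r1.
  have -> : T F r0 = smooth_gen_fun hDs r0.
    apply: (Tsmooth (fun x => \sum_k us k x) (fun x => \sum_k D (us k) x)) t0.
    - by move=> c ac; exact: (smoothC_on_sub (@cimage_sub _ _ _ c U) (smooth_fun_on (smooth_fun_sum _ sus) ac)).
    - move=> x Ux w sw xw; rewrite -(diff_op_sum dD)//.
      apply: (diff_op_local dD _ sw (open_interior _) xw); first exact: smooth_fun_sum.
      by move=> z /interior_subset.
    - exact: smooth_gen_fun_embeds.
    - exact: smooth_gen_fun_embeds.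
  (* Pieces in [c0] are integrated by parts. The others miss [K0], which carries [r0] and [r1], so
     both integrands vanish. *)
  apply: eq_bigr => k _; have [ck|CK] := csK k.
    have := hs k; rewrite ck => hk.
    exact: (chart_integral_transpose ac0 sa aP hk cL Lc th).
  rewrite !chart_integralE; congr cintegral; apply/funext => y; rewrite /pull.
  case: ifPn => // /set_mem cy; rewrite /density_scale.
  have [Cy|Cy] := pselect (Cs k (cinv (cs k) y)).
    by rewrite /r0 /r1 !(dlift_out _ _ Lc) ?mulr0//; [exact: tth'.2| exact: CK | exact: th.2| exact: CK].
  have [_ _ _ _ Ck] := hs k; have [_ _ _ _ DCk] := hDs k.
  by rewrite Ck// DCk// !mul0r.
(* As [T f] vanishes, the value of [T (f - F)] at [r0] is [- F r1], so strong continuity bounds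
   [F r1]. *)
have TG : T (gf_sub f F) r0 = - F r1.
  by rewrite (@Tlin (-1) F f) => //; [rewrite TF Tf// addr0 mulN1r|move=> r _; rewrite /= mulN1r addrC].
have Fr1 : normc (F r1) <= b * e.
  by rewrite -normcN -TG; apply: (TB _ _ (ltW e0)) => // r Br; apply: fB; left.
rewrite -[chart_functional _ _ _]/(f r1) -(subrK (F r1) (f r1)) (le_trans (ler_normcD _ _))//.
have -> : e' = e + `|b| * e by rewrite -[X in X + _]mul1r -mulrDl addrC mulrC divfK// gt_eqF.
rewrite lerD//; first by apply: fB; right.
by rewrite (le_trans Fr1)// ler_wpM2r ?ler_norm// ltW.
Qed.

End solutions.

(** * Noncharacteristic covectors *)

Section orthogonal_covector.
Context {R : realType} {m : nat}.
Variables (G W : 'M[R]_m).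
Hypotheses (G_sym : G^T = G) (G_unit : G \in unitmx).

Let mx11_eq0 (A : 'M[R]_1) : A 0 0 = 0 -> A = 0.
Proof. by move=> h; apply/matrixP => i j; rewrite !ord1 h mxE. Qed.

(** The orthogonal [P] of [W] is nonzero because [W] has rank less than [m]. If all vectors of [P]
    were isotropic, polarization would make [P] orthogonal to itself. It is also orthogonal to [W],
    and [W + P] is everything since [W] meets [P] trivially, so a nonzero vector of [P] would be in
    the kernel of [G]. *)
Lemma anisotropic_orthogonal_vector : nondegenerate_subspace G W -> (\rank W < m)%N ->
  exists w : 'rV[R]_m, (forall w' : 'rV[R]_m, (w' <= W)%MS -> w *m G *m w'^T = 0) /\
    (w *m G *m w^T) 0 0 != 0.
Proof.
move=> Wnd rW; pose P := kermx (G *m W^T).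
have PW (w w' : 'rV[R]_m) : (w <= P)%MS -> (w' <= W)%MS -> w *m G *m w'^T = 0.
  move=> /sub_kermxP wP /submxP[v ->]; by rewrite trmx_mul mulmxA -[X in X *m _]mulmxA wP mul0mx.
have rGW : \rank (G *m W^T) = \rank W.
  by rewrite -[RHS]mxrank_tr (eqmxMfull _ _)// row_full_unit.
have rP : (\rank W + \rank P)%N = m.
  by rewrite mxrank_ker rGW subnKC// ltnW.
apply: contrapT => no.
have iso (w : 'rV[R]_m) : (w <= P)%MS -> w *m G *m w^T = 0.
  move=> wP; apply: mx11_eq0; apply/eqP; apply: contrapT => /negP h.
  by apply: no; exists w; split=> // w'; exact: PW.
have polar (w w' : 'rV[R]_m) : (w <= P)%MS -> (w' <= P)%MS -> w *m G *m w'^T = 0.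
  move=> wP wP'; have := iso _ (addmx_sub wP wP').
  rewrite linearD/= !mulmxDl !mulmxDr (iso w)// (iso w')// add0r addr0.
  have -> : w' *m G *m w^T = w *m G *m w'^T.
    rewrite -[LHS]trmxK [X in X^T]trmx_mul trmxK [X in _ *m X]trmx_mul G_sym mulmxA.
    by apply/matrixP => i j; rewrite !ord1 mxE.
  move=> /matrixP/(_ 0 0); rewrite !mxE => /eqP; rewrite -mulr2n mulrn_eq0/= => /eqP h.
  by apply: mx11_eq0; rewrite mxE.
have WP0 : (W :&: P)%MS = 0.
  apply/eqP/rowV0P => v; rewrite sub_capmx => /andP[vW vP].
  by apply: Wnd => // w'; exact: PW.
have full : row_full (W + P)%MS.
  by rewrite /row_full -[X in _ == X]rP -mxrank_sum_cap WP0 mxrank0 addn0.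
have P0 : P != 0.
  by apply/eqP => e; move: rP; rewrite e mxrank0 addn0 => e'; rewrite e' ltnn in rW.
have /rowV0Pn[w wP /negP] := P0; apply; apply/eqP.
have wG x : w *m G *m (x : 'rV[R]_m)^T = 0.
  have /sub_addsmxP[v ->] : (x <= W + P)%MS by exact: submx_full.
  by rewrite linearD/= mulmxDr PW ?submxMl// add0r polar// submxMl.
have {}wG : w *m G = 0.
  apply/rowP => j; have := wG (delta_mx 0 j).
  by rewrite trmx_delta -colE => /colP/(_ 0); rewrite !mxE.
by rewrite -[w](mulmxK G_unit) wG mul0mx.
Qed.

End orthogonal_covector.

(** * Symbols evaluated on the square of a linear form *)

Section symbols.
Context {R : realType} {m : nat} {M : manifold R m}.
Implicit Types (c : chart R m M) (u : M -> R[i]).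

(** [vector_field_op] is computed in [chart_at x], a choice that may jump with [x]. Smoothness and
    repeated differentiation need the formula in one fixed chart. *)
Lemma vector_field_op_chart (X : chart R m M -> M -> 'rV[R]_m) u c x : is_vector_field X ->
  smooth_fun setT u -> atlas c -> cdom c x ->
  vector_field_op X u x = \sum_i (X c x 0 i)%:C * partialC i (u \o cinv c) (c x).
Proof.
move=> [_ Xt] su ac cx; rewrite /vector_field_op.
have [ac' c'x] := chart_atP x; set c' := chart_at x in ac' c'x *.
pose V := c @` (cdom c `&` cdom c'); have oV : open V by apply: open_cimage; exact: cdom_open.
have Vx : V (c x) by exists x.
have oW := @cimage_open _ _ _ c'.
have VW y : V y -> (c' @` cdom c') (c' (cinv c y)) by move=> [z [cz c'z] <-]; rewrite cmapK//; exists z.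
have sF k : smooth_on V (fun y => c' (cinv c y) 0 k) by exact: transition_smooth.
transitivity (\sum_i \sum_j (X c x 0 i)%:C * ((jac c c' x i j)%:C * partialC j (u \o cinv c') (c' x))).
  rewrite exchange_big; apply: eq_bigr => j _; rewrite (Xt c c')// mxE rmorph_sum mulr_suml.
  by apply: eq_bigr => i _; rewrite rmorphM mulrA.
apply: eq_bigr => i _; rewrite -mulr_sumr; congr (_ * _).
have e z : V z -> (u \o cinv c) z = (u \o cinv c') (c' (cinv c z)).
  by move=> [t [ct c't] <-]; rewrite /= !cmapK.
rewrite (partialC_congr i oV Vx e) (partialC_comp oW VW sF i Vx (smooth_fun_on su ac')).
by rewrite cmapK//; apply: eq_bigr => j _; rewrite mxE mulrC.
Qed.

Lemma vector_field_op_smooth (X : chart R m M -> M -> 'rV[R]_m) u : is_vector_field X ->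
  smooth_fun setT u -> smooth_fun setT (vector_field_op X u).
Proof.
move=> hX su; apply/smooth_funP => c ac; have oc := @cimage_open _ _ _ c.
have H : smoothC_on (c @` cdom c)
    (fun y => \sum_i (X c (cinv c y) 0 i)%:C * partialC i (u \o cinv c) y).
  apply: smoothC_on_sum => // i; apply: smoothC_onM => //.
    by apply: smoothC_on_real; exact: hX.1.
  exact/smoothC_on_partialC/smooth_fun_on.
apply: (smoothC_on_congr oc _ H) => y cy; rewrite /=.
by rewrite (vector_field_op_chart hX su ac (cinv_cdom cy)) (cinvK cy).
Qed.

Variables (c : chart R m M) (z : M) (xi : 'rV[R]_m).
Hypotheses (ac : atlas c) (cz : cdom c z) (xi_z : linear_form xi (c z) = 0).

Let lf y : R[i] := (linear_form xi y)%:C.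

Let smooth_lf : smoothC_on setT lf.
Proof. by apply: smoothC_on_real; exact: smooth_linear_form. Qed.

Let partial_lf i y : partialC i lf y = (xi 0 i)%:C.
Proof. by rewrite /lf partialC_real partial_linear_form. Qed.

(** The function on which symbols are read off: where [l] vanishes, so do [l ^ 2] and its first
    derivatives, and an operator of order 2 reduces to its symbol. The global function is the square
    of a cut-off copy of [l]. *)
Lemma linear_form_square_extension : exists u V, [/\ smooth_fun setT u, open V, V z &
  forall y, (c @` (cdom c `&` V)) y -> (u \o cinv c) y = lf y * lf y].
Proof.
have [w [V [C [sw _ [oV Vz] wV [cC CU Cw]]]]] := manifold_cutoff ac openT I cz.
have hw : small_support setT c (fun x => (w x)%:C) C.
  by split=> // x /Cw ->.
have cL := small_support_compact hw.
have Lc : c @` C `<=` c @` cdom c by move=> _ [x Cx <-]; exists x => //; have [] := CU x Cx.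
have sl := lift_smooth ac cL Lc (test_funM smooth_lf (pull_fun_test_fun hw)).
exists (fun x => lift c (fun y => lf y * pull c (fun=> fun x => (w x)%:C) y) x *
  lift c (fun y => lf y * pull c (fun=> fun x => (w x)%:C) y) x), V.
split=> //; first exact: smooth_funM.
by move=> _ [x [cx Vx] <-]; rewrite /= cmapK// lift_in// pull_in// wV// mulr1.
Qed.

Variables (u : M -> R[i]) (V : set M).
Hypotheses (su : smooth_fun setT u) (oV : open V) (Vz : V z).
Hypothesis uE : forall y, (c @` (cdom c `&` V)) y -> (u \o cinv c) y = lf y * lf y.

Let oVc : open (c @` (cdom c `&` V)) := open_cimage oV.
Let Vcz : (c @` (cdom c `&` V)) (c z).
Proof. by exists z. Qed.

Let partial_square i y : (c @` (cdom c `&` V)) y ->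
  partialC i (u \o cinv c) y = 2 * (lf y * (xi 0 i)%:C).
Proof.
move=> Vy; rewrite (partialC_congr i oVc Vy uE) (@partialCM _ _ setT)//.
by rewrite partial_lf; ring.
Qed.

Let lfz : lf (c z) = 0.
Proof. by rewrite /lf xi_z. Qed.

Lemma linear_form_square_derivatives_lt2 s : (size s < 2)%N -> partialsC s (u \o cinv c) (c z) = 0.
Proof.
case: s => [|i [|//]] _; first by rewrite partialsC_nil uE// lfz mul0r.
by rewrite partialsC1 partial_square// lfz mul0r mulr0.
Qed.

Lemma linear_form_square_derivatives2 (s : 2.-tuple 'I_m) :
  partialsC s (u \o cinv c) (c z) = 2 * \prod_(i <- s) (xi 0 i)%:C.
Proof.
case: s => [[|i [|j []]]] //= _; rewrite partialsC_cons partialsC1.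
have e y : (c @` (cdom c `&` V)) y -> partialC j (u \o cinv c) y = (2 * (xi 0 j)%:C) * lf y.
  by move=> Vy; rewrite partial_square//; ring.
rewrite (partialC_congr i oVc Vcz e) (@partialCZ _ _ setT)// partial_lf !big_cons big_nil.
by ring.
Qed.

Lemma order1_linear_form_square (D1 : operator M) : diff_op 1 D1 -> D1 u z = 0.
Proof.
move=> dD1; have [a [_ aP]] := dD1 c ac; rewrite aP// big1// => j _; rewrite big1// => s _.
by rewrite linear_form_square_derivatives_lt2 ?mulr0// size_tuple.
Qed.

Lemma order2_linear_form_square (D : operator M) (a : seq 'I_m -> M -> R[i]) :
  (forall v, smooth_fun setT v -> forall x, cdom c x ->
    D v x = \sum_(j < 3) \sum_(s : j.-tuple 'I_m) a s x * partialsC s (v \o cinv c) (c x)) ->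
  D u z = 2 * \sum_(s : 2.-tuple 'I_m) a s z * \prod_(i <- s) (xi 0 i)%:C.
Proof.
move=> aP; rewrite aP// big_ord_recr/= big1 => [|j _].
  rewrite add0r mulr_sumr; apply: eq_bigr => s _.
  by rewrite linear_form_square_derivatives2 mulrCA.
by rewrite big1// => s _; rewrite linear_form_square_derivatives_lt2 ?mulr0// size_tuple.
Qed.

(** Where [l = 0] one has [X Y (l ^ 2) = 2 (X l) (Y l)]: differentiating the coefficients of [Y]
    only contributes a multiple of [l]. *)
Lemma vector_fields_linear_form_square X Y : is_vector_field X -> is_vector_field Y ->
  vector_field_op X (vector_field_op Y u) z =
  2 * (((X c z *m xi^T) 0 0)%:C * ((Y c z *m xi^T) 0 0)%:C).
Proof.
move=> hX hY; rewrite (vector_field_op_chart hX (vector_field_op_smooth hY su) ac cz).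
pose eta y : R[i] := \sum_i (Y c (cinv c y) 0 i)%:C * (xi 0 i)%:C.
have seta : smoothC_on (c @` (cdom c `&` V)) eta.
  apply: smoothC_on_sum => // i; apply: smoothC_onM => //; last exact: smoothC_on_cst.
  by apply: smoothC_on_real; apply: smooth_on_sub (hY.1 c ac i); exact: cimage_sub.
have slf : smoothC_on (c @` (cdom c `&` V)) lf by exact: smoothC_on_sub smooth_lf.
have e y : (c @` (cdom c `&` V)) y -> (vector_field_op Y u \o cinv c) y = 2 * (lf y * eta y).
  move=> Vy; have cy := cimage_sub Vy.
  rewrite /= (vector_field_op_chart hY su ac (cinv_cdom cy)) (cinvK cy).
  by rewrite !mulr_sumr; apply: eq_bigr => i _; rewrite partial_square//; ring.
have etaz : eta (c z) = ((Y c z *m xi^T) 0 0)%:C.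
  by rewrite mxE rmorph_sum; apply: eq_bigr => i _; rewrite cmapK// mxE rmorphM.
rewrite -etaz mxE rmorph_sum mulr_suml mulr_sumr; apply: eq_bigr => i _.
rewrite (partialC_congr i oVc Vcz e) (partialCZ _ _ Vcz (smoothC_onM oVc slf seta)).
by rewrite (partialCM i Vcz slf seta) lfz partial_lf mul0r addr0 mxE rmorphM; ring.
Qed.

End symbols.

Section noncharacteristic_covectors.
Context {R : realType} {m : nat} {M : manifold R m}.
Variables (g : pseudo_riemannian M) (D : operator M).
Hypothesis hD : laplacian_type g D.


(** [symprod] adds both orders of the tensor product, so pairing it twice with [xi] gives the same
    factor 2 as in [vector_fields_linear_form_square]. *)
Let symprod_covector (u v xi : 'rV[R]_m) :
  (map_mx (fun t : R => t%:C) xi *m symprod u v *m (map_mx (fun t : R => t%:C) xi)^T) 0 0 =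
  2 * (((u *m xi^T) 0 0)%:C * ((v *m xi^T) 0 0)%:C).
Proof.
have -> : (map_mx (fun t : R => t%:C) xi)^T = map_mx (real_complex R) xi^T.
  by apply/matrixP => i j; rewrite !mxE.
rewrite /symprod -!(map_mxM (real_complex R)) mxE mulmxDr mulmxDl mxE.
have -> : xi *m (u^T *m v) *m xi^T = (u *m xi^T)^T *m (v *m xi^T).
  by rewrite trmx_mul trmxK !mulmxA.
have -> : xi *m (v^T *m u) *m xi^T = (v *m xi^T)^T *m (u *m xi^T).
  by rewrite trmx_mul trmxK !mulmxA.
have E (A B : 'M[R]_1) : (A^T *m B) 0 0 = A 0 0 * B 0 0 by rewrite mxE big_ord1 mxE.
by rewrite !E rmorphD !rmorphM; ring.
Qed.

(** [D] is evaluated at [z] on the extension of [l ^ 2] in two ways: by its coefficients in [c], and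
    by the vector fields that define its symbol. For a basis [u] with dual basis [v] the symbol is
    the inverse metric, which [xi = w * G] turns into the square length of [w]. *)
Lemma laplacian_symbol c z (w : 'rV[R]_m) (a : seq 'I_m -> M -> R[i]) : atlas c -> cdom c z ->
  (forall v, smooth_fun setT v -> forall x, cdom c x ->
    D v x = \sum_(j < 3) \sum_(s : j.-tuple 'I_m) a s x * partialsC s (v \o cinv c) (c x)) ->
  linear_form (w *m g c z) (c z) = 0 ->
  \sum_(s : 2.-tuple 'I_m) a s z * \prod_(i <- s) ((w *m g c z) 0 i)%:C =
  ((w *m g c z *m w^T) 0 0)%:C.
Proof.
move=> ac cz aP; set xi := w *m g c z => xi_z.
have [h [V [sh oV Vz hE]]] := linear_form_square_extension xi ac cz.
have [_ [S [[n [b [X [Y [D1 [XY dD1 DE SE]]]]]] hS]]] := hD.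
have [u [v [uu uv SE']]] := hS c z ac cz.
have Q1 := order2_linear_form_square cz xi_z sh oV Vz hE aP.
have Q2 := DE h sh z.
rewrite (order1_linear_form_square ac cz xi_z sh oV Vz hE dD1) addr0 in Q2.
pose xiC := map_mx (fun t : R => t%:C) xi.
have {}Q2 : D h z = (xiC *m S c z *m xiC^T) 0 0.
  rewrite Q2 SE// mulmx_sumr mulmx_suml summxE; apply: eq_bigr => j _.
  rewrite -scalemxAr -scalemxAl mxE symprod_covector.
  by rewrite (vector_fields_linear_form_square ac cz xi_z sh oV Vz hE (XY j).1 (XY j).2).
have {}Q2 : D h z = 2 * ((w *m g c z *m w^T) 0 0)%:C.
  rewrite Q2 SE' mulmx_sumr mulmx_suml summxE.
  under eq_bigr do rewrite symprod_covector.
  rewrite -mulr_sumr; congr (_ * _).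
  have -> : w *m g c z *m w^T = (u *m xi^T)^T *m (v *m xi^T).
    (* The duality relation, permuted cyclically and transposed, says that [u^T *m v] is the inverse
       of the Gram matrix. *)
    have uvG : u^T *m v *m g c z = 1%:M.
      have /(congr1 trmx) : g c z *m v^T *m u = 1%:M by apply: mulmx1C; rewrite mulmxA.
      by rewrite !trmx_mul trmxK trmx1 (gram_symmetric _ ac cz) mulmxA.
    have xiT : xi^T = g c z *m w^T by rewrite trmx_mul (gram_symmetric _ ac cz).
    by rewrite -/xi trmx_mul trmxK xiT -[w^T in LHS]mul1mx -uvG !mulmxA.
  rewrite mxE rmorph_sum; apply: eq_bigr => i _.
  by rewrite -!row_mul !mxE rmorphM.
have /mulfI : (2 : R[i]) != 0 by rewrite pnatr_eq0.
by apply; rewrite -Q1 Q2.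
Qed.

End noncharacteristic_covectors.

(** * Localization and the final argument *)

Section local_vanishing_of_solutions.
Context {R : realType} {m : nat} {M : manifold R m} {U : set M}.
Hypothesis oU : open U.
Implicit Types (c : chart R m M) (f : gen_fun U) (r : density M) (K C O : set M).

Lemma gf_locally_zero f r K : compact K -> K `<=` U -> supported_density K r ->
  (forall x, K x -> exists c O, [/\ atlas c, open O, O x, cdom c x &
     forall phi C, small_support U c phi C -> C `<=` O -> f (density_scale phi r) = 0]) ->
  f r = 0.
Proof.
move=> cK KU sr loc.
(* Pairs of a chart and an open set with the required property serve as index type of the partition
   of unity on the support of [r]. *)
pose P (p : chart R m M * set M) := [/\ atlas p.1, open p.2 &
  forall phi C, small_support U p.1 phi C -> C `<=` p.2 -> f (density_scale phi r) = 0].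
have [||N [w [p [sw hC [G [_ KG Gw]]]]]] := @manifold_partition R m M {p | P p}
  (fun i => (sval i).1) (fun i => U `&` (sval i).2) K cK.
- by case=> -[c O] [/= ac oO _]; split=> //; exact: openI.
- move=> x Kx; have [c [V [ac oO Ox cx h]]] := loc x Kx.
  have pP : P (c, V) by [].
  by exists (exist _ _ pP); split=> //; split=> //; exact: KU.
have tr := test_density_supported cK KU sr.
have -> : f r = \sum_k f (density_scale (fun x => (w k x)%:C) r).
  have sw' k : smooth_fun setT (fun x => (w k x)%:C) by exact: sw.
  rewrite -gf_scale_sum//; apply: gf_ext => // [|c x ac cx].
    by apply: test_density_scale => //; exact: smooth_fun_sum.
  rewrite /density_scale; have [Kx|Kx] := pselect (K x); last by rewrite sr.2// mulr0.
  by rewrite -rmorph_sum Gw ?mul1r//; exact: KG.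
apply: big1 => k _; have [C [cC CO C0]] := hC k; have [ac oO h] := svalP (p k).
apply: (h _ C) => [|x /CO[[]]//]; split=> //; first exact: sw.
  by move=> x /CO [[? _] ?].
by move=> x /C0 ->.
Qed.

Lemma gf_support_zero f x : U x -> ~ gf_support f x -> exists c O, [/\ atlas c, open O, O x, cdom c x &
  forall r phi C, test_density U r -> small_support U c phi C -> C `<=` O -> f (density_scale phi r) = 0].
Proof.
move=> Ux nx.
have [V [oV VU Vx Vf]] : exists V, [/\ open V, V `<=` U, V x & forall r, test_density V r -> f r = 0].
  apply: contrapT => no; apply: nx; split=> // V oV VU Vx; apply: contrapT => nr.
  apply: no; exists V; split=> // r' tr'; apply: contrapT => fr; apply: nr.
  by exists r'.
have [ac cx] := chart_atP x.
exists (chart_at x), V; split=> // r' phi C [K [cK KU sr]] [_ sphi cC CU C0] CV.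
apply: Vf; exists (K `&` C); split.
- by apply: compact_closedI => //; exact: compact_closed_manifold.
- by move=> y [_ /CV].
- exact: supported_density_scale_in.
Qed.

End local_vanishing_of_solutions.

Lemma is_distributionW (R : realType) m (V W : set 'rV[R]_m) F : V `<=` W ->
  is_distribution W F -> is_distribution V F.
Proof.
move=> VW [Flin Fb]; split=> [K a h h' cK KV|K cK KV]; last by apply: Fb => // y /KV/VW.
by apply: Flin => // y /KV/VW.
Qed.

Section slices.
Context {R : realType} {m : nat} {M : manifold R m}.
Variables (g : pseudo_riemannian M) (Z : set M) (D : operator M).
Hypotheses (hZg : metrically_proper g Z) (hD : laplacian_type g D).

(** The covector is the metric dual of an anisotropic [w] orthogonal to [W]. The rows of [pid_mx k]
    lie in [W], so its first [k] components vanish. On [Z] the remaining coordinates of a slice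
    chart vanish, so the linear form is 0 on all of [Z] in the chart and not only to first order at
    [z]. *)
Lemma noncharacteristic_slice k c z (a : seq 'I_m -> M -> R[i]) : slice_chart Z k c -> cdom c z -> Z z ->
  (forall v, smooth_fun setT v -> forall x, cdom c x ->
    D v x = \sum_(j < 3) \sum_(s : j.-tuple 'I_m) a s x * partialsC s (v \o cinv c) (c x)) ->
  exists xi : 'rV[R]_m, (forall x, cdom c x -> Z x -> linear_form xi (c x) = 0) /\
    \sum_(s : 2.-tuple 'I_m) a s z * \prod_(i <- s) (xi 0 i)%:C != 0.
Proof.
move=> sl cz Zz aP; have [ac km cZ] := sl.
have [W [kW rW Wnd]] := hZg Zz sl cz.
have [w [wW ww]] := anisotropic_orthogonal_vector (gram_symmetric g ac cz) (gram_nondegenerate g ac cz) Wnd rW.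
pose xi := w *m g c z.
have xi0 (i : 'I_m) : (i < k)%N -> xi 0 i = 0.
  move=> ik; have iW : ((delta_mx 0 i : 'rV[R]_m) <= W)%MS.
    apply: submx_trans kW; rewrite (_ : delta_mx 0 i = row i (pid_mx k)) ?row_sub//.
    by apply/rowP => j; rewrite !mxE eqxx ik andbT eq_sym.
  have := wW _ iW; rewrite trmx_delta -colE => /colP/(_ 0); rewrite mxE => ->.
  by rewrite mxE.
have xiZ x : cdom c x -> Z x -> linear_form xi (c x) = 0.
  move=> cx Zx; apply: big1 => i _; have [ik|ki] := ltnP i k; first by rewrite xi0// mulr0.
  have : (c @` (cdom c `&` Z)) (c x) by exists x.
  by rewrite cZ => -[_ /= ->//]; rewrite mul0r.
exists xi; split=> //.
rewrite (laplacian_symbol hD ac cz aP); last exact: xiZ.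
by rewrite eq_complex/= negb_and ww.
Qed.

End slices.

Theorem proposition2p2 (R : realType) (m : nat) (M : manifold R m)
  (g : pseudo_riemannian M) (Z : set M) (D : operator M)
  (hZ : submanifold Z) (hZg : metrically_proper g Z)
  (hD : laplacian_type g D)
  (U : set M) (hU : closed_in_open Z U) (f : gen_fun U) :
  gen_solutions Z D f -> gf_is0 f.
Proof.
move=> [fZ [T [DT Tf]]] r [K [cK KU sr]]; have [oU _ _] := hU.
have outside x : U x -> ~ Z x -> exists c O, [/\ atlas c, open O, O x, cdom c x &
    forall r phi C, test_density U r -> small_support U c phi C -> C `<=` O -> f (density_scale phi r) = 0].
  by move=> Ux Zx; apply: gf_support_zero => // /fZ.
have tr := test_density_supported cK KU sr.
apply: (gf_locally_zero oU cK KU sr) => x Kx; have Ux := KU x Kx.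
have [Zx|Zx] := pselect (Z x); last first.
  have [c [V [ac oO Ox cx h]]] := outside x Ux Zx.
  by exists c, V; split=> // phi C; exact: h.
have [k [c [sl cx]]] := hZ x Zx; have [ac _ _] := sl.
have [dD _] := hD; have [a [sa aP]] := dD c ac.
have [xi [xiZ xix]] := noncharacteristic_slice hZg hD sl cx Zx aP.
have oc := @cimage_open _ _ _ c.
pose q y : R[i] := \sum_(s : 2.-tuple 'I_m) a s (cinv c y) * \prod_(i <- s) (xi 0 i)%:C.
have scx : (c @` cdom c) (c x) by exists x.
have sq : smoothC_on (c @` cdom c) q.
  apply: smoothC_on_sum => // s; apply: smoothC_onM => //; last exact: smoothC_on_cst.
  by have := sa s c ac; rewrite setIid.
have near_neq0 (p : 'rV[R]_m -> R) : {for c x, continuous p} -> p (c x) != 0 ->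
    \forall y \near c x, p y != 0 by move=> pc px; exact: (pc _ (open_nbhs_nbhs (conj (@open_neq R 0) px))).
have qx : \forall y \near c x, q y != 0.
  have : q (c x) != 0 by rewrite /q cmapK.
  (* Real and imaginary part of [q] are continuous separately, and one of them is nonzero at
     [c x]. *)
  rewrite eq_complex/= negb_and => /orP[h|h].
    apply: filterS (near_neq0 _ (sq.1 [::] _ scx).1 h) => y hy.
    by rewrite eq_complex/= negb_and hy.
  apply: filterS (near_neq0 _ (sq.2 [::] _ scx).1 h) => y hy.
  by rewrite eq_complex/= negb_and hy orbT.
(* The symbol is known to be nonzero at [x] only; continuity provides the neighbourhood required by
   [local_vanishing]. *)
pose O := U `&` (cdom c `&` c @^-1` (interior [set y | q y != 0])).
have oO : open O by apply: openI => //; apply: open_cpreimage; exact: open_interior.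
exists c, O; split=> // phi C hphi CO; have [_ sphi cC CU phiC] := hphi.
pose W := c @` (cdom c `&` O); have oW : open W := open_cimage oO.
have WU : W `<=` c @` (cdom c `&` U) by move=> _ [z [cz [Uz _]] <-]; exists z.
have dF := is_distributionW WU (chart_functional_distribution f ac oU).
have cL := small_support_compact hphi.
have LW : c @` C `<=` W by move=> _ [z Cz <-]; exists z => //; split; [case: (CU z Cz)|exact: CO].
have th := pull_scale_test_fun hphi tr.
have -> : f (density_scale phi r) = chart_functional f c (pull c (density_scale phi r)).
  have Lc : c @` C `<=` c @` cdom c by move=> y /LW; exact: cimage_sub.
  have [cK' K'U _] := cinv_compact cL (subset_trans LW WU).
  apply: gf_ext => [||c' z ac' c'z].
  - exact: test_density_scale.
  - exact: test_density_supported cK' K'U (dlift_supported ac cL Lc th).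
  - rewrite [RHS](@dlift_pull _ _ _ c _ (K `&` C))//; first by move=> y [_ /CU[]].
    exact: supported_density_scale_in.
apply: (@local_vanishing _ _ W _ xi (fun s => a s \o cinv c) oW dF _ _ _ _ (c @` C)) => //.
- by move=> s; apply: smoothC_on_sub (smoothC_on_coefficients ac sa s); exact: cimage_sub.
(* The support condition is checked locally: off [Z] the functional [f] vanishes, and near a point
   of [Z] the linear form is smaller than [d], so [h] vanishes. *)
- move=> L h d cLh LhW tLh d0 hd.
  have [cK0 K0U Lc] := cinv_compact cLh (subset_trans LhW WU).
  have sh := dlift_supported ac cLh Lc tLh.
  apply: (gf_locally_zero oU cK0 K0U sh) => z K0z; have Uz := K0U z K0z.
  have [Zz|Zz] := pselect (Z z); last first.
    have [c' [V' [ac' oO' O'z c'z h']]] := outside z Uz Zz.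
    exists c', V'; split=> // psi C' hpsi; apply: h' => //.
    exact: test_density_supported cK0 K0U sh.
  have cz : cdom c z by case: K0z => y Ly <-; apply: cinv_cdom; exact: Lc.
  exists c, (cdom c `&` c @^-1` [set y | `|linear_form xi y| < d]); split=> //.
  + apply: open_cpreimage; rewrite openE => y yd.
    have lc : {for y, continuous (linear_form xi)} := (@smooth_linear_form _ _ xi [::] y I).1.
    apply: (lc [set t | `|t| < d]); apply: open_nbhs_nbhs; split=> //.
    rewrite (_ : [set t | _] = [set t | - d < t] `&` [set t | t < d]); last first.
      by apply/seteqP; split=> t /=; rewrite ltr_norml => /andP.
    exact: openI (@open_gt _ _) (@open_lt _ _).
  + by split=> //=; rewrite xiZ// normr0.
  + move=> psi C' [_ spsi _ _ C'0] C'O; apply: gf0 => c' y ac' c'y.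
    rewrite /density_scale; have [/C'O [cy /= dy]|C'y] := pselect (C' y).
      by rewrite dlift_in// hd// !mulr0.
    by rewrite C'0// mul0r.
- move=> L h cLh LhW tLh.
  exact: (solution_transpose oU dD ac sa aP DT Tf cLh (subset_trans LhW WU) tLh).
- by move=> _ [z [_ [_ [_ hz]]] <-]; exact: interior_subset hz.
Qed.
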